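(* Given an integer $N\ge 1$ and a real number $d>1$, there exists a constant $B=B(N,d)>1$ with the following property. Let $f:S^1\to S^1$ be a multicritical circle map without periodic points, with at most $N$ critical points, whose criticalities are bounded by $d$, let $c_0$ be one of its critical points, and let $\mathcal{P}_n=\mathcal{P}_n(c_0)$ $(n\ge 0)$ be the dynamical partitions of $f$ associated to $c_0$. Then there exists $n_0=n_0(f)\in\mathbb{N}$ such that for all $n\ge n_0$ and for any two adjacent intervals $I$ and $J$ in $\mathcal{P}_n$ we have $$\frac{|J|}{B}\le |I|\le B\,|J| .$$
   Context: $S^1=\mathbb{R}/\mathbb{Z}$ is the unit circle and $|I|$ denotes the length of an interval $I$. Non-flat critical points: a critical point $c$ of a one-dimensional $C^3$ map $f$ is non-flat of degree $\delta>1$ ($\delta$ real, also called the criticality, type or order of $c$) if there is a neighborhood $W$ of $c$ such that $f(x)=f(c)+\phi(x)|\phi(x)|^{\delta-1}$ for all $x\in W$, where $\phi:W\to\phi(W)$ is a $C^3$ diffeomorphism with $\phi(c)=0$. A multicritical circle map is an orientation-preserving $C^3$ homeomorphism of $S^1$ having a finite number, at least one, of critical points, all of which are non-flat. Dynamical partitions: if $f$ has no periodic points, its rotation number $\rho$ is irrational, with continued fraction expansion $\rho=[a_0,a_1,\dots]=1/(a_0+1/(a_1+\cdots))$. The return times are $q_0=1$, $q_1=a_0$, $q_{n+1}=a_nq_n+q_{n-1}$ for $n\ge 1$. For $x\in S^1$ let $I_n(x)$ be the interval with endpoints $x$ and $f^{q_n}(x)$ containing $f^{q_{n+2}}(x)$.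 The $n$-th dynamical partition associated to $x$ is $$\mathcal{P}_n(x)=\{f^i(I_n(x)):0\le i\le q_{n+1}-1\}\cup\{f^j(I_{n+1}(x)):0\le j\le q_n-1\},$$ which is a partition of $S^1$ modulo endpoints. Two of its elements are adjacent if they share an endpoint. *)

(* Defs.v *)
From Stdlib Require Export Reals Lra Lia List.
From Coquelicot Require Export Coquelicot.

Open Scope R_scope.

(* R/Z is represented by its fundamental domain [0,1); its topological and
   differentiable structure enters only through the covering map [proj]. *)
Definition S1 : Type := {x : R | 0 <= x < 1}.

Definition coord (x : S1) : R := proj1_sig x.

Lemma frac_part_range (x : R) : 0 <= frac_part x < 1.
Proof. destruct (base_fp x) as [H0 H1]; split; [apply Rge_le|]; assumption. Qed.

Definition proj (x : R) : S1 :=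
  exist (fun y => 0 <= y < 1) (frac_part x) (frac_part_range x).

(* Differentiability of every order up to 3 is listed because [Derive_n] is
   total: [ex_derive_n g 3 x] alone does not give the lower orders. The
   predicate is only used at all points of an open set, where it says that
   [g] is of class C^3 there. *)
Definition C3_at (g : R -> R) (x : R) : Prop :=
  (forall k : nat, (k <= 3)%nat -> ex_derive_n g k x) /\
  continuous (Derive_n g 3) x.

(* [F] is a lift of [f], and [f] is an orientation-preserving C^3
   homeomorphism: [F] is C^3, strictly increasing and of degree one. *)
Definition C3_lift (F : R -> R) (f : S1 -> S1) : Prop :=
  (forall x : R, proj (F x) = f (proj x)) /\
  (forall x : R, F (x + 1) = F x + 1) /\
  (forall x y : R, x < y -> F x < F y) /\
  (forall x : R, C3_at F x).

Definition C3_circle_homeo (f : S1 -> S1) : Prop :=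
  exists F : R -> R, C3_lift F f.

Definition critical_point (f : S1 -> S1) (c : S1) : Prop :=
  exists (F : R -> R) (x : R), C3_lift F f /\ proj x = c /\ is_derive F x 0.

(* [psi] is the inverse of the diffeomorphism [phi : W -> phi(W)]. The image
   of an open set under a continuous injection is open, so that the
   derivatives of [psi] on phi(W) do not depend on its values elsewhere. *)
Definition C3_diffeo_on (W : R -> Prop) (phi : R -> R) : Prop :=
  (forall y : R, W y -> C3_at phi y) /\
  exists psi : R -> R,
    forall y : R, W y -> psi (phi y) = y /\ C3_at psi (phi y).

(* In the standard library [Rpower 0 a = 1], but the power is multiplied by
   [phi y], so the product vanishes where [phi] does, as it should. *)
Definition non_flat (f : S1 -> S1) (c : S1) (delta : R) : Prop :=
  1 < delta /\
  exists (F : R -> R) (x : R) (W : R -> Prop) (phi : R -> R),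
    C3_lift F f /\ proj x = c /\
    open W /\ W x /\
    C3_diffeo_on W phi /\ phi x = 0 /\
    forall y : R, W y ->
      F y = F x + phi y * Rpower (Rabs (phi y)) (delta - 1).

Definition multicritical_circle_map (f : S1 -> S1) : Prop :=
  C3_circle_homeo f /\
  (exists l : list S1, forall c : S1, critical_point f c -> In c l) /\
  (exists c : S1, critical_point f c) /\
  (forall c : S1, critical_point f c -> exists delta : R, non_flat f c delta).

Definition at_most_critical_points (f : S1 -> S1) (N : nat) : Prop :=
  exists l : list S1,
    (length l <= N)%nat /\ forall c : S1, critical_point f c -> In c l.

Definition criticalities_bounded (f : S1 -> S1) (d : R) : Prop :=
  forall (c : S1) (delta : R),
    critical_point f c -> non_flat f c delta -> delta <= d.

Definition no_periodic_points (f : S1 -> S1) : Prop :=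
  forall (x : S1) (k : nat), (1 <= k)%nat -> Nat.iter k f x <> x.

(* Translation numbers of different lifts differ by integers; exactly one
   lift has its translation number in [0,1). *)
Definition is_rotation_number (f : S1 -> S1) (rho : R) : Prop :=
  0 <= rho < 1 /\
  exists F : R -> R, C3_lift F f /\
    forall x : R,
      is_lim_seq (fun k : nat => (Nat.iter k F x - x) / INR k) rho.

(* [cfrac a n] = 1/(a_0 + 1/(a_1 + ... + 1/a_n)). *)
Fixpoint cfrac (a : nat -> nat) (n : nat) : R :=
  match n with
  | O => 1 / INR (a O)
  | S m => 1 / (INR (a O) + cfrac (fun k => a (S k)) m)
  end.

Definition cf_expansion (rho : R) (a : nat -> nat) : Prop :=
  (forall k : nat, (1 <= a k)%nat) /\ is_lim_seq (cfrac a) rho.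

Fixpoint return_time (a : nat -> nat) (n : nat) : nat :=
  match n with
  | O => 1
  | S O => a O
  | S (S m as k) => a k * return_time a k + return_time a m
  end%nat.

(* [Arc x y] is the closed interval of the circle going from [x] to [y] in
   the positive direction; [Arc x x] is the single point [x]. *)
Record arc : Type := Arc { src : S1; tgt : S1 }.

Definition ccw_dist (x y : S1) : R := frac_part (coord y - coord x).

Definition arc_length (I : arc) : R := ccw_dist (src I) (tgt I).

Definition in_arc (I : arc) (y : S1) : Prop :=
  ccw_dist (src I) y <= arc_length I.

Definition is_image (g : S1 -> S1) (I K : arc) : Prop :=
  forall y : S1, in_arc K y <-> exists x : S1, in_arc I x /\ g x = y.

(* [I] is I_n(x), where q is the sequence of return times. *)
Definition is_base_arc (f : S1 -> S1) (q : nat -> nat) (n : nat) (x : S1)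
    (I : arc) : Prop :=
  (I = Arc x (Nat.iter (q n) f x) \/ I = Arc (Nat.iter (q n) f x) x) /\
  in_arc I (Nat.iter (q (n + 2)%nat) f x).

(* Membership of [K] in P_n(x). *)
Definition dyn_partition (f : S1 -> S1) (q : nat -> nat) (n : nat) (x : S1)
    (K : arc) : Prop :=
  (exists (I : arc) (i : nat), is_base_arc f q n x I /\
     (i < q (n + 1))%nat /\ is_image (Nat.iter i f) I K) \/
  (exists (I : arc) (j : nat), is_base_arc f q (n + 1) x I /\
     (j < q n)%nat /\ is_image (Nat.iter j f) I K).

Definition adjacent (I J : arc) : Prop :=
  src I = src J \/ src I = tgt J \/ tgt I = src J \/ tgt I = tgt J.

(* Main.v *)
Require Import Defs.
From Stdlib Require Import ZArith Psatz Classical ClassicalEpsilon ProofIrrelevance.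

(** Why the theorem holds.

    The proof takes place on a lift [F] of [f], and measures distortion by the cross-ratio
    [(b - a) (d - c) / ((c - a) (d - b))] of four points [a < b < c < d]. Near a critical point the map
    is an odd power in a smooth coordinate. Odd powers do not expand the
    cross-ratio of points on one side of the critical point
    ([odd_power_schwarz]), and expand that of any four points by at most a
    factor depending on the degree ([odd_power_slope]); a smooth map without critical points
    expands it by a factor that differs from 1 by a term quadratic in the length of the arc
    ([C3_schwarz]). Hence one iterate of [F] on a small arc [[a, d]]
    expands cross-ratios by at most [exp (V d - V a)], where the increasing
    function [V] counts critical points and, with a
    bounded coefficient, length. If the three arcs [[a, b]], [[b, c]], [[c, d]] have
    disjoint orbits, these exponents add up to at most three times the
    total weight of the circle ([cross_ratio_iter]), which depends only
    on [N] and [d] ([controlled_small]).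

    Let [G] be the return [f^(q_n)]. At a point where [G] moves least, four consecutive
    points of the [G]-orbit have cross-ratio bounded below; since every orbit
    comes close to this point within [q_n + q_(n+1)] iterates, the
    cross-ratio inequality carries the bound to the whole circle: consecutive
    displacements [|G x - x|] and [|G (G x) - G x|] are comparable everywhere
    ([steps_comparable]). This already makes the lengths of the return intervals tend to 0
    ([return_length_vanishes]). It is used twice. With constants that depend
    on [f] and arcs of length up to 3 ([controlled_large]) it shows that the
    intervals become small; from then on the universal constants apply.

    The critical point enters in the comparison of the two return intervals
    at [c]. If the one of level [n+1], of length [s], were much shorter than the
    one of level [n], then for a large constant [K] the image under [F] of [[c, c + K s]] would be
    longer than that of [[c - s, c]] by a factor of order [K^2], while the remaining
    iterates of the return, whose distortion is bounded, bring the first arc to a length at most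
    [(K + 1) s] and the second one to a length comparable to [s] ([right_le_left_critical]). The cross-ratio inequality then carries the
    comparison from the end of the critical orbit back to its earlier points
    ([right_le_left_orbit]), which settles all pairs of adjacent intervals
    ([adjacent_pieces_comparable]).

    The order of the points of an orbit is that of the rotation by the
    rotation number ([irrational_lift_intro]), so disjointness of arcs reduces to the
    law of best approximation for continued fractions ([best_approximation]). *)

(** * Disjoint arcs and monotone weights *)

Fixpoint big_sum (u : nat -> R) (r : nat) : R :=
  match r with
  | O => 0
  | S r' => big_sum u r' + u r'
  end.

Lemma big_sum_ext (u v : nat -> R) (r : nat) :
  (forall j, (j < r)%nat -> u j = v j) -> big_sum u r = big_sum v r.
Proof.
  induction r as [|r IH]; intros H; simpl; [reflexivity|].
  rewrite IH, (H r) by auto with arith; reflexivity.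
Qed.

Lemma big_sum_plus (u v : nat -> R) (r : nat) :
  big_sum (fun j => u j + v j) r = big_sum u r + big_sum v r.
Proof. induction r as [|r IH]; simpl; [ring|rewrite IH; ring]. Qed.

Definition nondecreasing (V : R -> R) : Prop := forall x y, x <= y -> V x <= V y.

(** Collapsing the last interval to a point changes [V] into a monotone function
    that gives the other intervals the same weight. This removes one interval
    from the family, so that the intervals need not be sorted. *)
Lemma disjoint_weight_le (r : nat) : forall (V : R -> R) (a b : nat -> R) (u v : R),
  nondecreasing V -> u <= v ->
  (forall j, (j < r)%nat -> u <= a j <= b j /\ b j <= v) ->
  (forall j j', (j < r)%nat -> (j' < r)%nat -> j <> j' ->
     b j <= a j' \/ b j' <= a j) ->
  big_sum (fun j => V (b j) - V (a j)) r <= V v - V u.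
Proof.
  induction r as [|r IH]; intros V a b u v HV Huv Hin Hdis; simpl.
  - specialize (HV u v Huv); lra.
  - set (W := fun x => if Rle_dec x (a r) then V x
                       else if Rle_dec x (b r) then V (a r)
                       else V x - (V (b r) - V (a r))).
    destruct (Hin r (Nat.lt_succ_diag_r r)) as [[Hua Hab] Hbv].
    assert (HW : nondecreasing W).
    { intros x y Hxy; unfold W.
      destruct (Rle_dec x (a r)); destruct (Rle_dec y (a r)); try lra.
      - apply HV; lra.
      - destruct (Rle_dec y (b r)).
        + apply HV; lra.
        + assert (V x <= V (a r)) by (apply HV; lra).
          assert (V (b r) <= V y) by (apply HV; lra). lra.
      - destruct (Rle_dec x (b r)); destruct (Rle_dec y (b r)); try lra.
        + assert (V (b r) <= V y) by (apply HV; lra). lra.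
        + assert (V x <= V y) by (apply HV; lra). lra. }
    assert (HL : forall x, x <= a r -> W x = V x).
    { intros x Hx; unfold W; destruct (Rle_dec x (a r)); lra. }
    assert (HR : forall x, b r <= x -> W x = V x - (V (b r) - V (a r))).
    { intros x Hx; unfold W; destruct (Rle_dec x (a r)) as [H1|H1].
      - assert (x = b r) by lra. assert (b r = a r) by lra. subst x. rewrite H0; lra.
      - destruct (Rle_dec x (b r)); [|lra]. assert (x = b r) by lra. subst x; lra. }
    assert (HI := IH W a b u v HW Huv).
    rewrite (HL u), (HR v) in HI by lra.
    rewrite (big_sum_ext _ (fun j => W (b j) - W (a j))).
    + apply Rle_trans with
        ((V v - (V (b r) - V (a r)) - V u) + (V (b r) - V (a r))); [|lra].
      apply Rplus_le_compat_r, HI.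
      * intros j Hj; apply Hin; lia.
      * intros j j' Hj Hj'; apply Hdis; lia.
    + intros j Hj.
      destruct (Hin j) as [[_ Hj1] _]; [lia|].
      destruct (Hdis j r) as [H|H]; try lia.
      * rewrite !HL by lra; lra.
      * rewrite !HR by lra; lra.
Qed.

(** * Lifts of circle maps *)

Definition degree_one (F : R -> R) : Prop :=
  (forall x y, x < y -> F x < F y) /\ (forall x, F (x + 1) = F x + 1).

Definition iter (F : R -> R) (k : nat) (x : R) : R := Nat.iter k F x.

Lemma iter_0 F x : iter F 0 x = x.
Proof. reflexivity. Qed.

Lemma iter_S F k x : iter F (S k) x = F (iter F k x).
Proof. reflexivity. Qed.

Lemma iter_plus F k l x : iter F (k + l) x = iter F k (iter F l x).
Proof. apply Nat.iter_add. Qed.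

Lemma shift_by_integers (V : R -> R) (v : R) :
  (forall x, V (x + 1) = V x + v) ->
  forall (m : Z) x, V (x + IZR m) = V x + IZR m * v.
Proof.
  intros H.
  assert (HN : forall (n : nat) x, V (x + INR n) = V x + INR n * v).
  { induction n as [|n IH]; intros x.
    - simpl; rewrite Rplus_0_r; ring.
    - rewrite S_INR, <- Rplus_assoc, H, IH; ring. }
  intros m x.
  destruct (Z_le_gt_dec 0 m) as [Hm|Hm].
  - rewrite <- (Z2Nat.id m Hm), <- INR_IZR_INZ; apply HN.
  - assert (E := HN (Z.to_nat (- m)) (x + IZR m)).
    rewrite INR_IZR_INZ, Z2Nat.id, opp_IZR in E by lia.
    replace (x + IZR m + - IZR m) with x in E by ring. lra.
Qed.

Lemma iter_degree_one F k : degree_one F -> degree_one (iter F k).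
Proof.
  intros [H1 H2]; induction k as [|k [I1 I2]].
  - split; intros; unfold iter; simpl; auto.
  - split; intros; rewrite !iter_S; [auto|rewrite I2; apply H2].
Qed.

Lemma iter_shift F k (m : Z) x :
  degree_one F -> iter F k (x + IZR m) = iter F k x + IZR m.
Proof.
  intros HF; destruct (iter_degree_one F k HF) as [_ H].
  rewrite (shift_by_integers _ 1); [ring|exact H].
Qed.

Lemma iter_shift_minus F k (m : Z) x :
  degree_one F -> iter F k (x - IZR m) = iter F k x - IZR m.
Proof.
  intros HF; unfold Rminus; rewrite <- opp_IZR; apply iter_shift, HF.
Qed.

Lemma iter_lt F k x y : degree_one F -> x < y -> iter F k x < iter F k y.
Proof. intros HF; apply (iter_degree_one F k HF). Qed.

Lemma iter_le F k x y : degree_one F -> x <= y -> iter F k x <= iter F k y.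
Proof.
  intros HF [H|H]; [left; apply iter_lt; auto|right; subst; reflexivity].
Qed.

(** Disjointness of the arcs [F^j [a,b)], [j < r], on the circle, expressed for all
    their integer translates; the case [j = j'], [m <> 0] says that each of
    them has length at most 1. *)
Definition disjoint_orbit (F : R -> R) (r : nat) (a b : R) : Prop :=
  forall (j j' : nat) (m : Z), (j < r)%nat -> (j' < r)%nat ->
    (j <> j' \/ m <> 0%Z) ->
    iter F j b <= iter F j' a + IZR m \/ iter F j' b + IZR m <= iter F j a.

Lemma disjoint_orbit_sub F r a b a' b' :
  degree_one F -> disjoint_orbit F r a b -> a <= a' -> b' <= b ->
  disjoint_orbit F r a' b'.
Proof.
  intros HF HD Ha Hb j j' m Hj Hj' Hne.
  assert (A1 := iter_le F j a a' HF Ha). assert (A2 := iter_le F j' a a' HF Ha).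
  assert (B1 := iter_le F j b' b HF Hb). assert (B2 := iter_le F j' b' b HF Hb).
  destruct (HD j j' m Hj Hj' Hne); [left|right]; lra.
Qed.

(** On the circle, moving every arc by an integer into the period that starts at [a]
    reduces the count to disjoint intervals of the line: no arc can cross the end
    of that period, where a translate of the first arc begins. *)
Lemma disjoint_orbit_weight F r a b V v :
  degree_one F -> nondecreasing V -> (forall x, V (x + 1) = V x + v) ->
  a < b -> disjoint_orbit F r a b ->
  big_sum (fun j => V (iter F j b) - V (iter F j a)) r <= v.
Proof.
  intros HF HV HV1 Hab HD.
  assert (Hv : 0 <= v).
  { assert (V 0 <= V (0 + 1)) by (apply HV; lra). rewrite HV1 in H; lra. }
  destruct (Nat.eq_dec r 0) as [->|Hr]; [simpl; exact Hv|].
  set (m := fun j => (- Int_part (iter F j a - a))%Z).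
  assert (Hm : forall j, a <= iter F j a + IZR (m j) < a + 1).
  { intros j; unfold m; rewrite opp_IZR.
    destruct (base_Int_part (iter F j a - a)); lra. }
  assert (Hm0 : m 0%nat = 0%Z).
  { assert (H := Hm 0%nat). unfold iter in H; simpl in H.
    assert (IZR (-1) < IZR (m 0%nat)) by (simpl; lra).
    assert (IZR (m 0%nat) < IZR 1) by lra.
    apply lt_IZR in H0. apply lt_IZR in H1. lia. }
  rewrite (big_sum_ext _ (fun j => V (iter F j b + IZR (m j)) - V (iter F j a + IZR (m j)))).
  2:{ intros j _. rewrite !(shift_by_integers V v HV1); ring. }
  replace v with (V (a + 1) - V a) by (rewrite HV1; ring).
  apply disjoint_weight_le; [exact HV|lra| |].
  - intros j Hj. assert (H := Hm j).
    assert (iter F j a <= iter F j b) by (apply iter_le; auto; lra).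
    repeat split; try lra.
    assert (Hne : j <> 0%nat \/ (1 - m j)%Z <> 0%Z).
    { destruct (Nat.eq_dec j 0) as [->|]; [right; rewrite Hm0; lia|left; assumption]. }
    destruct (HD j 0%nat (1 - m j)%Z Hj ltac:(lia) Hne) as [H1|H1];
      rewrite iter_0, minus_IZR in H1; lra.
  - intros j j' Hj Hj' Hne.
    destruct (HD j j' (m j' - m j)%Z Hj Hj' (or_introl Hne)) as [H|H];
      rewrite minus_IZR in H; [left|right]; lra.
Qed.

(** * Cross-ratios along an orbit *)

Definition cross_ratio (a b c d : R) : R :=
  ((b - a) * (d - c)) / ((c - a) * (d - b)).

Lemma cross_ratio_pos a b c d : a < b -> b < c -> c < d -> 0 < cross_ratio a b c d.
Proof.
  intros; unfold cross_ratio; apply Rdiv_lt_0_compat; apply Rmult_lt_0_compat; lra.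
Qed.

(** The distortion of the cross-ratio by one iterate is charged to the weight that [V]
    gives to the arc. Since weights of disjoint arcs add up to at most [v], the
    total weight of the circle, this makes the distortion along an orbit
    independent of the number of iterates. *)
Definition controlled (F : R -> R) (V : R -> R) (v eta : R) : Prop :=
  nondecreasing V /\ (forall x, V (x + 1) = V x + v) /\
  forall a b c d, a < b -> b < c -> c < d -> d - a <= eta ->
    cross_ratio (F a) (F b) (F c) (F d) <= exp (V d - V a) * cross_ratio a b c d.

(** Along an orbit the exponents add up, and each of the three disjoint families
    contributes at most the weight of the circle. *)
Lemma cross_ratio_iter F V v eta r a b c d :
  degree_one F -> controlled F V v eta ->
  a < b -> b < c -> c < d ->
  disjoint_orbit F r a b -> disjoint_orbit F r b c -> disjoint_orbit F r c d ->
  (forall j, (j < r)%nat -> iter F j d - iter F j a <= eta) ->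
  cross_ratio (iter F r a) (iter F r b) (iter F r c) (iter F r d)
    <= exp (3 * v) * cross_ratio a b c d.
Proof.
  intros HF [HV [HV1 Hc]] Hab Hbc Hcd D1 D2 D3 Hsz.
  assert (P := cross_ratio_pos a b c d Hab Hbc Hcd).
  assert (HS : forall r, (forall j, (j < r)%nat -> iter F j d - iter F j a <= eta) ->
    cross_ratio (iter F r a) (iter F r b) (iter F r c) (iter F r d)
    <= exp (big_sum (fun j => V (iter F j d) - V (iter F j a)) r) * cross_ratio a b c d).
  { clear r D1 D2 D3 Hsz; induction r as [|r IH]; intros Hsz.
    - simpl; rewrite exp_0; unfold iter; simpl; lra.
    - simpl big_sum; rewrite exp_plus, !iter_S.
      eapply Rle_trans; [apply Hc; try (apply iter_lt; assumption); apply Hsz; lia|].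
      rewrite (Rmult_comm (exp (big_sum _ _))), Rmult_assoc.
      apply Rmult_le_compat_l; [left; apply exp_pos|].
      apply IH; intros; apply Hsz; lia. }
  eapply Rle_trans; [apply HS, Hsz|].
  apply Rmult_le_compat_r; [lra|].
  assert (W1 := disjoint_orbit_weight F r a b V v HF HV HV1 Hab D1).
  assert (W2 := disjoint_orbit_weight F r b c V v HF HV HV1 Hbc D2).
  assert (W3 := disjoint_orbit_weight F r c d V v HF HV HV1 Hcd D3).
  assert (E : big_sum (fun j => V (iter F j d) - V (iter F j a)) r <= 3 * v).
  { rewrite (big_sum_ext _ (fun j => ((V (iter F j b) - V (iter F j a))
       + (V (iter F j c) - V (iter F j b))) + (V (iter F j d) - V (iter F j c))))
      by (intros; ring).
    rewrite !big_sum_plus; lra. }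
  destruct E as [E|E]; [left; apply exp_increasing, E|right; rewrite E; reflexivity].
Qed.

(** * Orbits ordered as those of an irrational rotation *)

Definition irrational_lift (F : R -> R) (rho : R) : Prop :=
  degree_one F /\ continuity F /\
  (forall (k k' : nat) (m m' : Z) x,
     INR k * rho + IZR m < INR k' * rho + IZR m' ->
     iter F k x + IZR m < iter F k' x + IZR m') /\
  (forall (k : nat) (m : Z), INR k * rho = IZR m -> k = 0%nat).

Lemma orbit_lt F rho (k k' : nat) (m m' : Z) x : irrational_lift F rho ->
  INR k * rho + IZR m < INR k' * rho + IZR m' ->
  iter F k x + IZR m < iter F k' x + IZR m'.
Proof. intros (_ & _ & H & _); apply H. Qed.

Lemma rotation_injective F rho (k k' : nat) (m m' : Z) : irrational_lift F rho ->
  INR k * rho + IZR m = INR k' * rho + IZR m' -> k = k' /\ m = m'.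
Proof.
  intros (_ & _ & _ & H) E.
  assert (k = k') as ->.
  { destruct (Nat.le_ge_cases k k') as [L|L].
    - assert (k' - k = 0)%nat; [|lia].
      apply (H _ (m - m')%Z). rewrite minus_INR, minus_IZR by exact L. lra.
    - assert (k - k' = 0)%nat; [|lia].
      apply (H _ (m' - m)%Z). rewrite minus_INR, minus_IZR by exact L. lra. }
  split; [reflexivity|apply eq_IZR; lra].
Qed.

Lemma orbit_le F rho (k k' : nat) (m m' : Z) x : irrational_lift F rho ->
  INR k * rho + IZR m <= INR k' * rho + IZR m' ->
  iter F k x + IZR m <= iter F k' x + IZR m'.
Proof.
  intros HF [H|H]; [left; apply (orbit_lt F rho); assumption|].
  destruct (rotation_injective F rho k k' m m' HF H) as [-> ->]; lra.
Qed.

Lemma iter_surjective F rho k : irrational_lift F rho ->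
  forall y, exists x, iter F k x = y.
Proof.
  intros (HF & HC & _) ; induction k as [|k IH]; intros y.
  - exists y; reflexivity.
  - assert (HS : exists z, F z = y).
    { set (m := Int_part (y - F 0)).
      destruct (base_Int_part (y - F 0)) as [H1 H2]; fold m in H1, H2.
      assert (E1 := iter_shift F 1 m 0 HF). assert (E2 := iter_shift F 1 (m + 1) 0 HF).
      rewrite !Rplus_0_l in E1, E2. unfold iter in E1, E2; simpl in E1, E2.
      rewrite plus_IZR in E2.
      destruct (IVT_gen F (IZR m) (IZR (m + 1)) y HC) as [z [_ Hz]].
      - rewrite plus_IZR, E1, E2, Rmin_left, Rmax_right by lra. lra.
      - exists z; exact Hz. }
    destruct HS as [z Hz]. destruct (IH z) as [x Hx].
    exists x; rewrite iter_S, Hx; exact Hz.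
Qed.

(** [step F q p] is the lift of [f^q] that moves every point by about [q rho - p]. *)
Definition step (F : R -> R) (q : nat) (p : Z) (x : R) : R := iter F q x - IZR p.

Lemma step_iter F q p j x : degree_one F ->
  step F q p (iter F j x) = iter F j (step F q p x).
Proof.
  intros HF; unfold step; rewrite iter_shift_minus, <- !iter_plus by exact HF.
  f_equal; f_equal; lia.
Qed.

Lemma step_point F q p k m x : degree_one F ->
  step F q p (iter F k x + IZR m) = iter F (q + k) x + IZR (m - p).
Proof.
  intros HF; unfold step; rewrite iter_shift, <- iter_plus, minus_IZR by exact HF; ring.
Qed.

Lemma step_shift F q p m x : degree_one F ->
  step F q p (x + IZR m) = step F q p x + IZR m.
Proof. intros HF; unfold step; rewrite iter_shift by exact HF; ring. Qed.

Lemma step_lt F q p x y : degree_one F -> x < y -> step F q p x < step F q p y.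
Proof. intros HF H; unfold step; assert (H' := iter_lt F q x y HF H); lra. Qed.

Lemma step_surjective F rho q p : irrational_lift F rho ->
  forall y, exists x, step F q p x = y.
Proof.
  intros HF y; destruct (iter_surjective F rho q HF (y + IZR p)) as [x Hx].
  exists x; unfold step; lra.
Qed.

Definition no_closer_return (rho : R) (r : nat) (g : R) : Prop :=
  forall k l : Z, (k <> 0%Z \/ l <> 0%Z) -> (Z.abs k < Z.of_nat r)%Z ->
    g <= Rabs (IZR k * rho - IZR l).

(** Two arcs of the orbit whose endpoints differ by fewer than [r] iterates are
    displaced from each other by at least their common rotation length. *)
Lemma disjoint_orbit_arc F rho r (k1 k2 : nat) (m1 m2 : Z) x :
  irrational_lift F rho ->
  no_closer_return rho r
    ((INR k2 * rho + IZR m2) - (INR k1 * rho + IZR m1)) ->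
  disjoint_orbit F r (iter F k1 x + IZR m1) (iter F k2 x + IZR m2).
Proof.
  intros HF HB j j' m Hj Hj' Hne.
  assert (HD := proj1 HF).
  rewrite !iter_shift, <- !iter_plus by exact HD.
  assert (Hk : ((Z.of_nat j' - Z.of_nat j) <> 0 \/ (- m)%Z <> 0)%Z) by lia.
  assert (H := HB _ _ Hk ltac:(lia)).
  rewrite opp_IZR, minus_IZR, <- !INR_IZR_INZ in H.
  assert (L : forall (a b : nat) (c d e : Z),
    INR a * rho + (IZR c + IZR d) <= INR b * rho + IZR e ->
    iter F a x + IZR c + IZR d <= iter F b x + IZR e).
  { intros a b c d e Hl; rewrite Rplus_assoc, <- plus_IZR.
    apply (orbit_le F rho); [exact HF|rewrite plus_IZR; exact Hl]. }
  assert (L' : forall (a b : nat) (c d e : Z),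
    INR b * rho + IZR e <= INR a * rho + (IZR c + IZR d) ->
    iter F b x + IZR e <= iter F a x + IZR c + IZR d).
  { intros a b c d e Hl; rewrite Rplus_assoc, <- plus_IZR.
    apply (orbit_le F rho); [exact HF|rewrite plus_IZR; exact Hl]. }
  unfold Rabs in H; destruct (Rcase_abs _) in H; [right; apply L|left; apply L'];
    rewrite !plus_INR; lra.
Qed.

(** Two consecutive closest returns, the first to the right and the second to
    the left. Levels of the other parity are brought to this form by the
    reflection [x |-> - x]. *)
Record level (rho : R) (q : nat) (p : Z) (q' : nat) (p' : Z) : Prop := {
  level_pos : (1 <= q <= q')%nat;
  level_left : 0 < IZR p' - INR q' * rho;
  level_decr : IZR p' - INR q' * rho < INR q * rho - IZR p;
  level_best : no_closer_return rho q' (INR q * rho - IZR p);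
  level_best' : no_closer_return rho (q + q') (IZR p' - INR q' * rho) }.

Lemma disjoint_orbit_right F rho q p q' p' r x :
  irrational_lift F rho -> level rho q p q' p' -> (r <= q')%nat ->
  disjoint_orbit F r x (step F q p x).
Proof.
  intros HF HL Hr.
  replace x with (iter F 0 x + IZR 0) at 1 by (rewrite iter_0; ring).
  unfold step, Rminus; rewrite <- opp_IZR.
  apply (disjoint_orbit_arc F rho); [exact HF|].
  intros k l Hne Hk. rewrite opp_IZR; simpl INR.
  assert (H := level_best _ _ _ _ _ HL k l Hne ltac:(lia)). lra.
Qed.

Lemma disjoint_orbit_left F rho q p q' p' r x :
  irrational_lift F rho -> level rho q p q' p' -> (r <= q + q')%nat ->
  disjoint_orbit F r (step F q' p' x) x.
Proof.
  intros HF HL Hr.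
  replace x with (iter F 0 x + IZR 0) at 2 by (rewrite iter_0; ring).
  unfold step, Rminus; rewrite <- opp_IZR.
  apply (disjoint_orbit_arc F rho); [exact HF|].
  intros k l Hne Hk. rewrite opp_IZR; simpl INR.
  assert (H := level_best' _ _ _ _ _ HL k l Hne ltac:(lia)). lra.
Qed.

Lemma orbit_above F rho k m x : irrational_lift F rho ->
  0 < INR k * rho + IZR m -> x < iter F k x + IZR m.
Proof.
  intros HF H.
  assert (H' := orbit_lt F rho 0 k 0 m x HF ltac:(simpl INR; lra)).
  rewrite iter_0 in H'. lra.
Qed.

Lemma orbit_below F rho k m x : irrational_lift F rho ->
  INR k * rho + IZR m < 0 -> iter F k x + IZR m < x.
Proof.
  intros HF H.
  assert (H' := orbit_lt F rho k 0 m 0 x HF ltac:(simpl INR; lra)).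
  rewrite iter_0 in H'. lra.
Qed.

Lemma step_right F rho q p x :
  irrational_lift F rho -> 0 < INR q * rho - IZR p -> x < step F q p x.
Proof.
  intros HF H; unfold step, Rminus; rewrite <- opp_IZR.
  apply (orbit_above F rho); [exact HF|rewrite opp_IZR; lra].
Qed.

Lemma step_left F rho q p x :
  irrational_lift F rho -> INR q * rho - IZR p < 0 -> step F q p x < x.
Proof.
  intros HF H; unfold step, Rminus; rewrite <- opp_IZR.
  apply (orbit_below F rho); [exact HF|rewrite opp_IZR; lra].
Qed.

(** * The orbit of a point visits every fundamental arc in time *)

Lemma last_orbit_point F x w n : degree_one F -> (1 <= n)%nat ->
  exists (i : nat) (m : Z), (1 <= i <= n)%nat /\ iter F i w + IZR m <= x /\
    forall (i' : nat) (m' : Z), (1 <= i' <= n)%nat -> iter F i' w + IZR m' <= x ->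
      iter F i' w + IZR m' <= iter F i w + IZR m.
Proof.
  intros HF Hn; induction n as [|n IH]; [lia|].
  set (m0 := Int_part (x - iter F (S n) w)).
  destruct (base_Int_part (x - iter F (S n) w)) as [B1 B2]; fold m0 in B1, B2.
  assert (Hm0 : forall m', iter F (S n) w + IZR m' <= x -> IZR m' <= IZR m0).
  { intros m' H; apply IZR_le, Zlt_succ_le, lt_IZR; rewrite succ_IZR; lra. }
  destruct (Nat.eq_dec n 0) as [->|Hn0].
  - exists 1%nat, m0; split; [lia|split; [lra|]].
    intros i' m' Hi' H'. assert (i' = 1)%nat by lia; subst i'.
    specialize (Hm0 m' H'); lra.
  - destruct (IH ltac:(lia)) as (i & m & Hi & Hle & Hmax).
    destruct (Rle_lt_dec (iter F (S n) w + IZR m0) (iter F i w + IZR m)) as [L|L].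
    + exists i, m; split; [lia|split; [exact Hle|]].
      intros i' m' Hi' H'. destruct (Nat.eq_dec i' (S n)) as [->|].
      * specialize (Hm0 m' H'); lra.
      * apply Hmax; [lia|exact H'].
    + exists (S n), m0; split; [lia|split; [lra|]].
      intros i' m' Hi' H'. destruct (Nat.eq_dec i' (S n)) as [->|].
      * specialize (Hm0 m' H'); lra.
      * specialize (Hmax i' m' ltac:(lia) H'); lra.
Qed.

(** Among the first [q + q'] points of an orbit, the [i]-th one is followed, before
    its image under the right return, by another one: that image itself, at time
    [i + q], if [i <= q'], and otherwise the point of time [i - q'], because the
    left return is the shorter one. Hence the right return arcs of these
    points cover the circle. *)
Lemma orbit_visits F rho q p q' p' x z :
  irrational_lift F rho -> level rho q p q' p' ->
  exists (s : nat) (m : Z), (s <= q + q')%nat /\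
    z <= iter F s x - IZR m < step F q p z.
Proof.
  intros HF HL. assert (HD := proj1 HF).
  destruct (level_pos _ _ _ _ _ HL) as [Hq Hqq].
  destruct (iter_surjective F rho (q + q') HF z) as [w Hw].
  destruct (last_orbit_point F x w (q + q') HD ltac:(lia)) as (i & m & Hi & Hle & Hmax).
  exists (q + q' - i)%nat, m; split; [lia|].
  assert (Hx : x < step F q p (iter F i w + IZR m)).
  { assert (L1 := level_left _ _ _ _ _ HL). assert (L2 := level_decr _ _ _ _ _ HL).
    rewrite step_point by exact HD.
    destruct (le_lt_dec i q') as [Hi'|Hi'].
    - destruct (Rlt_le_dec x (iter F (q + i) w + IZR (m - p))) as [|L]; [assumption|].
      specialize (Hmax (q + i)%nat (m - p)%Z ltac:(lia) L).
      assert (C := orbit_lt F rho i (q + i) m (m - p) w HF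
        ltac:(rewrite plus_INR, minus_IZR; lra)). lra.
    - assert (C := orbit_lt F rho (i - q') (q + i) (m + p') (m - p) w HF
        ltac:(rewrite plus_INR, minus_IZR, minus_INR, plus_IZR by lia; lra)).
      destruct (Rlt_le_dec x (iter F (i - q') w + IZR (m + p'))) as [L|L]; [lra|].
 specialize (Hmax (i - q')%nat (m + p')%Z ltac:(lia) L).
      assert (C' := orbit_lt F rho i (i - q') m (m + p') w HF
        ltac:(rewrite minus_INR, plus_IZR by lia; lra)). lra. }
  assert (E : iter F (q + q' - i) (iter F i w + IZR m) = z + IZR m).
  { rewrite iter_shift, <- iter_plus, <- Hw by exact HD. do 2 f_equal; lia. }
  split.
  - assert (H := iter_le F (q + q' - i) _ _ HD Hle). lra.
  - assert (H := iter_lt F (q + q' - i) _ _ HD Hx).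
    rewrite <- step_iter, E, step_shift in H by exact HD. lra.
Qed.

(** * Consecutive displacements are comparable *)

Lemma cross_ratio_lower a b c d A B :
  a < b -> b < c -> c < d -> 0 <= A -> 0 <= B ->
  c - b <= A * (b - a) -> c - b <= B * (d - c) ->
  1 / ((1 + A) * (1 + B)) <= cross_ratio a b c d.
Proof.
  intros Hab Hbc Hcd HA HB H1 H2; unfold cross_ratio.
  apply Rle_div_l; [apply Rmult_lt_0_compat; lra|].
  assert (P : 0 < (c - a) * (d - b)) by (apply Rmult_lt_0_compat; lra).
  replace ((b - a) * (d - c) / ((c - a) * (d - b)) * ((1 + A) * (1 + B)))
    with (((1 + A) * (b - a)) * ((1 + B) * (d - c)) / ((c - a) * (d - b)))
    by (field; split; lra).
  apply Rle_div_r; [exact P|]. rewrite Rmult_1_l.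
  apply Rmult_le_compat; lra.
Qed.

Lemma cross_ratio_le_left a b c d : a < b -> b < c -> c < d ->
  cross_ratio a b c d * (c - b) <= b - a.
Proof.
  intros Hab Hbc Hcd; unfold cross_ratio.
  replace ((b - a) * (d - c) / ((c - a) * (d - b)) * (c - b))
    with ((b - a) * (((c - b) * (d - c)) / ((c - a) * (d - b)))) by (field; split; lra).
  rewrite <- (Rmult_1_r (b - a)) at 2.
  apply Rmult_le_compat_l; [lra|].
  apply Rle_div_l; [apply Rmult_lt_0_compat; lra|].
  rewrite Rmult_1_l; apply Rmult_le_compat; lra.
Qed.

Lemma cross_ratio_reflect a b c d :
  cross_ratio (- d) (- c) (- b) (- a) = cross_ratio a b c d.
Proof. unfold cross_ratio; f_equal; ring. Qed.

Lemma cross_ratio_le_right a b c d : a < b -> b < c -> c < d ->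
  cross_ratio a b c d * (c - b) <= d - c.
Proof.
  intros; rewrite <- cross_ratio_reflect.
  assert (L := cross_ratio_le_left (- d) (- c) (- b) (- a)). lra.
Qed.

Definition comparable_steps (F : R -> R) (q : nat) (p : Z) (C : R) : Prop :=
  forall x, let G := step F q p in
    Rabs (G x - x) <= C * Rabs (G (G x) - G x) /\
    Rabs (G (G x) - G x) <= C * Rabs (G x - x).

Lemma displacement_min F q p : degree_one F -> continuity F ->
  exists z, forall x, step F q p z - z <= step F q p x - x.
Proof.
  intros HF HC.
  assert (HI : forall k, continuity (iter F k)).
  { induction k as [|k IH].
    - intros x; apply continuity_pt_id.
    - intros x; apply (continuity_pt_comp (iter F k) F x (IH x) (HC _)). }
  destruct (continuity_ab_min (fun x => step F q p x - x) 0 1) as [z [Hz _]]; [lra| |].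
  - intros c _. apply continuity_pt_minus; [|apply continuity_pt_id].
    apply continuity_pt_minus; [apply HI|apply continuity_pt_const; intros ? ?; reflexivity].
  - exists z; intros x.
    set (m := Int_part x). destruct (base_Int_part x) as [B1 B2]; fold m in B1, B2.
    assert (H := Hz (x - IZR m) ltac:(lra)). simpl in H.
    assert (E := step_shift F q p (- m) x HF). rewrite opp_IZR in E.
    fold (Rminus x (IZR m)) in E. rewrite E in H. lra.
Qed.

Definition step_bound (v : R) : R := exp (3 * v) ^ 2 * (1 + 20 * exp (3 * v) ^ 3) ^ 2.

Lemma total_weight_pos F V v eta : controlled F V v eta -> 0 <= v.
Proof.
  intros (HV & HV1 & _).
  assert (V 0 <= V (0 + 1)) by (apply HV; lra). rewrite HV1 in H; lra.
Qed.

Lemma weight_factor_ge_1 F V v eta : controlled F V v eta -> 1 <= exp (3 * v).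
Proof.
  intros H; apply total_weight_pos in H.
  rewrite <- exp_0; destruct H as [H|H]; [left; apply exp_increasing; lra|].
  right; f_equal; lra.
Qed.

(** At a point [z] of smallest displacement the cross-ratio of four consecutive
    points of the orbit under [G] is bounded below. Pulling this back along
    [f^q] bounds the displacements at [G^-1 z] and [G^-2 z] by multiples of the
    smallest one, hence also the displacement at every point between [G^-2 z]
    and [G^-1 z]. Every orbit visits this arc in time, so pulling back once more spreads
    the bound over the circle. *)
Lemma steps_comparable F rho V v eta q p q' p' :
  irrational_lift F rho -> controlled F V v eta -> level rho q p q' p' ->
  (forall x, step F q p x - x <= eta / 3) ->
  comparable_steps F q p (step_bound v).
Proof.
  intros HF HV HL Hsz. set (G := step F q p).
  assert (HD := proj1 HF). assert (HC := proj1 (proj2 HF)).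
  destruct (level_pos _ _ _ _ _ HL) as [Hq Hqq].
  assert (L1 := level_left _ _ _ _ _ HL). assert (L2 := level_decr _ _ _ _ _ HL).
  assert (HG : forall x, x < G x) by (intros x; apply (step_right F rho); auto; lra).
  set (E := exp (3 * v)).
  assert (HE : 1 <= E) by (apply (weight_factor_ge_1 F V v eta HV)).
  assert (HE2 : E <= E ^ 2) by nra.
  assert (HE3 : E <= E ^ 3) by nra.
  set (T := fun y => cross_ratio y (G y) (G (G y)) (G (G (G y)))).
  assert (HT1 : forall r y, (r <= q')%nat -> T (iter F r y) <= E * T y).
  { intros r y Hr; unfold T, G. rewrite !step_iter by exact HD.
    apply (cross_ratio_iter F V v eta); auto; try apply HG;
      try (apply (disjoint_orbit_right F rho q p q' p'); assumption).
    intros j _. rewrite <- !step_iter by exact HD.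
    assert (A1 := Hsz (iter F j y)). assert (A2 := Hsz (G (iter F j y))).
    assert (A3 := Hsz (G (G (iter F j y)))). unfold G in *. lra. }
  assert (HT2 : forall r y, (r <= q' + q')%nat -> T (iter F r y) <= E ^ 2 * T y).
  { intros r y Hr. destruct (le_lt_dec r q') as [H|H].
    - assert (A := HT1 r y H).
      assert (P : 0 < T y) by (apply cross_ratio_pos; apply HG).
      apply Rle_trans with (1 := A). apply Rmult_le_compat_r; lra.
    - replace r with ((r - q') + q')%nat by lia. rewrite iter_plus.
      assert (A := HT1 (r - q')%nat (iter F q' y) ltac:(lia)).
      assert (B := HT1 q' y ltac:(lia)).
      assert (E * T (iter F q' y) <= E * (E * T y)) by (apply Rmult_le_compat_l; lra). lra. }
  assert (HTG : forall y, T (G y) <= E * T y).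
  { intros y. replace (T (G y)) with (T (iter F q y)); [apply HT1; lia|].
    replace (G y) with (iter F q y + IZR (- p))
      by (unfold G, step; rewrite opp_IZR; ring).
    unfold T, G; rewrite !step_shift by exact HD.
    unfold cross_ratio; f_equal; ring. }
  set (D := fun x => G x - x).
  assert (HDpos : forall x, 0 < D x) by (intros x; unfold D; specialize (HG x); lra).
  assert (HTl : forall y, T y * D (G y) <= D y).
  { intros y; apply cross_ratio_le_left; apply HG. }
  assert (HTr : forall y, T y * D (G y) <= D (G (G y))).
  { intros y; apply cross_ratio_le_right; apply HG. }
  assert (HTlow : forall y A, 0 <= A -> D (G y) <= A * D y ->
     D (G y) <= A * D (G (G y)) -> 1 <= (1 + A) ^ 2 * T y).
  { intros y A HA H1 H2.
    assert (H := cross_ratio_lower y (G y) (G (G y)) (G (G (G y))) A A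
      (HG _) (HG _) (HG _) HA HA H1 H2).
    assert (P : 0 < (1 + A) * (1 + A)) by (apply Rmult_lt_0_compat; lra).
    apply (Rle_div_l _ _ _ P) in H. unfold T; lra. }
  destruct (displacement_min F q p HD HC) as [z Hz].
  fold G in Hz. change (forall x, D z <= D x) in Hz.
  assert (HS := step_surjective F rho q p HF). fold G in HS.
  destruct (HS z) as [z1 Hz1]. destruct (HS z1) as [z2 Hz2]. destruct (HS z2) as [z3 Hz3].
  assert (T1 : 1 <= 4 * T z1).
  { assert (H := HTlow z1 1 ltac:(lra)). rewrite Hz1 in H.
    assert (A1 := Hz z1). assert (A2 := Hz (G z)). lra. }
  assert (T2 : 1 <= 4 * E * T z2) by (assert (H := HTG z2); rewrite Hz2 in H; lra).
  assert (D1 : D z1 <= 4 * E * D z).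
  { assert (H := HTr z2). rewrite Hz2, Hz1 in H.
    assert (P := HDpos z1).
    assert (1 * D z1 <= 4 * E * T z2 * D z1) by (apply Rmult_le_compat_r; lra).
    assert (4 * E * (T z2 * D z1) <= 4 * E * D z) by (apply Rmult_le_compat_l; lra). lra. }
  assert (T3 : 1 <= 4 * E ^ 2 * T z3).
  { assert (H := HTG z3). rewrite Hz3 in H.
    assert (E * T z2 <= E * (E * T z3)) by (apply Rmult_le_compat_l; lra). lra. }
  assert (D2 : D z2 <= 4 * E ^ 2 * D z1).
  { assert (H := HTr z3). rewrite Hz3, Hz2 in H. assert (P := HDpos z2).
    assert (1 * D z2 <= 4 * E ^ 2 * T z3 * D z2) by (apply Rmult_le_compat_r; lra).
    assert (4 * E ^ 2 * (T z3 * D z2) <= 4 * E ^ 2 * D z1) by (apply Rmult_le_compat_l; lra). lra. }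
  assert (P0 := HDpos z).
  assert (D12 : D z1 + D z2 <= 20 * E ^ 3 * D z).
  { assert (4 * E ^ 2 * D z1 <= 4 * E ^ 2 * (4 * E * D z)) by
      (apply Rmult_le_compat_l; [lra|exact D1]).
    assert (4 * E * D z <= 4 * E ^ 3 * D z) by
      (apply Rmult_le_compat_r; lra).
    replace (20 * E ^ 3 * D z) with (4 * E ^ 3 * D z + 4 * E ^ 2 * (4 * E * D z)) by ring.
    lra. }
  assert (HA : 0 <= 20 * E ^ 3) by lra.
  assert (Key : forall y, 1 <= step_bound v * T y).
  { intros y.
    destruct (orbit_visits F rho q p q' p' (G y) z2 HF HL) as (s & m & Hs & Hl & Hr).
    fold G in Hr.
    set (w := iter F s y + IZR (- m)).
    assert (Ew : G w = iter F s (G y) - IZR m).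
    { unfold w, G; rewrite step_shift, step_iter, opp_IZR by exact HD. ring. }
    rewrite <- Ew in Hl, Hr.
    assert (ET : T w = T (iter F s y)).
    { unfold w, T, G. rewrite !step_shift by exact HD.
      unfold cross_ratio; f_equal; ring. }
    assert (DW : D (G w) <= 20 * E ^ 3 * D z).
    { apply Rle_trans with (2 := D12).
      assert (B := step_lt F q p _ _ HD Hr). fold G in B.
      rewrite Hz2 in B. unfold D. rewrite Hz1, Hz2. rewrite Hz1 in B. lra. }
    assert (H := HTlow w (20 * E ^ 3) HA).
    assert (A1 := Hz w). assert (A2 := Hz (G (G w))).
    assert (B1 : D (G w) <= 20 * E ^ 3 * D w)
      by (apply Rle_trans with (1 := DW), Rmult_le_compat_l; lra).
    assert (B2 : D (G w) <= 20 * E ^ 3 * D (G (G w)))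
      by (apply Rle_trans with (1 := DW), Rmult_le_compat_l; lra).
    specialize (H B1 B2). rewrite ET in H.
    assert (H2 := HT2 s y ltac:(lia)).
    unfold step_bound; fold E.
    assert (0 <= (1 + 20 * E ^ 3) ^ 2) by apply pow2_ge_0.
    assert ((1 + 20 * E ^ 3) ^ 2 * T (iter F s y) <= (1 + 20 * E ^ 3) ^ 2 * (E ^ 2 * T y))
      by (apply Rmult_le_compat_l; assumption).
    lra. }
  assert (HB : 0 < step_bound v).
  { unfold step_bound; fold E. apply Rmult_lt_0_compat; apply pow_lt; lra. }
  intros x. change (Rabs (D x) <= step_bound v * Rabs (D (G x)) /\
    Rabs (D (G x)) <= step_bound v * Rabs (D x)).
  destruct (HS x) as [y Hy].
  assert (P1 := HDpos x). assert (P2 := HDpos (G x)).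
  rewrite !Rabs_pos_eq by lra.
  split.
  - assert (K := Key y). assert (H := HTr y). rewrite Hy in H.
    assert (0 < T y) by (apply cross_ratio_pos; apply HG).
    rewrite <- (Rmult_1_l (D x)) at 1.
    apply Rle_trans with (step_bound v * (T y * D x));
      [rewrite <- Rmult_assoc; apply Rmult_le_compat_r; [lra|exact K]|].
    apply Rmult_le_compat_l; lra.
  - assert (K := Key x). assert (H := HTl x).
    rewrite <- (Rmult_1_l (D (G x))) at 1.
    apply Rle_trans with (step_bound v * (T x * D (G x)));
      [rewrite <- Rmult_assoc; apply Rmult_le_compat_r; [lra|exact K]|].
    apply Rmult_le_compat_l; lra.
Qed.

(** * Two consecutive levels at a critical point *)

(** Iterating the left return from [G x] leads to the next return [K x] of [x] and, one
    step later, beyond [x]. So the arc from [x] to [K x] is covered by this last step, which is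
    comparable to the one before it, and the latter lies between [K x] and [G x]. *)
Lemma displacement_contracts F rho C q p q' p' a x :
  irrational_lift F rho -> level rho q p q' p' -> 0 <= C ->
  comparable_steps F q' p' C -> (1 <= a)%nat ->
  0 < INR (a * q' + q) * rho - IZR (Z.of_nat a * p' + p) < IZR p' - INR q' * rho ->
  (1 + C) * Rabs (step F (a * q' + q) (Z.of_nat a * p' + p) x - x)
    <= C * Rabs (step F q p x - x).
Proof.
  intros HF HL HC0 HC Ha [Hg1 Hg2].
  assert (HD := proj1 HF).
  assert (L1 := level_left _ _ _ _ _ HL). assert (L2 := level_decr _ _ _ _ _ HL).
  set (w := iter F ((a - 1) * q' + q) x + IZR (- ((Z.of_nat a - 1) * p' + p))).
  set (K := step F (a * q' + q) (Z.of_nat a * p' + p)) in *.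
  assert (Ew : step F q' p' w = K x).
  { unfold w, K; rewrite step_point by exact HD. unfold step, Rminus; rewrite <- opp_IZR.
    f_equal; [f_equal; nia|f_equal; nia]. }
  assert (HKx : x < K x) by (apply (step_right F rho); assumption).
  assert (HGx : x < step F q p x) by (apply (step_right F rho); [exact HF|lra]).
  assert (HKK : step F q' p' (K x) < x).
  { unfold K; unfold step at 2; unfold Rminus; rewrite <- opp_IZR, step_point by exact HD.
    apply (orbit_below F rho); [exact HF|].
    rewrite minus_IZR, opp_IZR, (plus_INR q'); lra. }
  assert (Hw : w <= step F q p x).
  { unfold w, step, Rminus; rewrite <- (opp_IZR p). apply (orbit_le F rho); [exact HF|].
    rewrite plus_INR, mult_INR, minus_INR, !opp_IZR, plus_IZR, mult_IZR, minus_IZR, <- INR_IZR_INZ by lia.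
    assert (1 <= INR a) by (apply (le_INR 1); exact Ha). simpl INR.
    nra. }
  destruct (HC w) as [_ H]. cbv zeta in H. rewrite Ew in H.
  assert (Hlt : K x < w) by (rewrite <- Ew; apply (step_left F rho); [exact HF|lra]).
  rewrite !Rabs_left in H by lra.
  rewrite !Rabs_pos_eq by lra.
  assert (C * (w - K x) <= C * (step F q p x - K x)) by (apply Rmult_le_compat_l; lra).
  lra.
Qed.

(** The preimage of [x] under the left return lies between [x] and [G x], and
    consecutive steps of the left return are comparable. *)
Lemma left_le_right F rho C q p q' p' x :
  irrational_lift F rho -> level rho q p q' p' -> 0 <= C ->
  comparable_steps F q' p' C ->
  x - step F q' p' x <= C * (step F q p x - x).
Proof.
  intros HF HL HC0 HC.
  assert (HD := proj1 HF).
  assert (L1 := level_left _ _ _ _ _ HL). assert (L2 := level_decr _ _ _ _ _ HL).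
  destruct (step_surjective F rho q' p' HF x) as [w Hw].
  assert (Hle : w < step F q p x).
  { rewrite <- Hw. unfold step at 2; unfold Rminus; rewrite <- opp_IZR, step_point by exact HD.
    apply (orbit_above F rho); [exact HF|].
    rewrite minus_IZR, opp_IZR, plus_INR; lra. }
  destruct (HC w) as [_ H]. cbv zeta in H. rewrite Hw in H.
  assert (H1 : step F q' p' x < x) by (apply (step_left F rho); [exact HF|lra]).
  assert (H2 : step F q' p' w < w) by (apply (step_left F rho); [exact HF|lra]).
  rewrite Hw in H2. rewrite !Rabs_left in H by lra.
  assert (C * (w - x) <= C * (step F q p x - x)) by (apply Rmult_le_compat_l; lra).
  lra.
Qed.

(** The only property of a critical point that enters the comparison of levels: an
    arc on one side, [t / s] times as long as an arc on the other side, has an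
    image longer by at least the square of that ratio, up to a factor 4. *)
Definition quadratic_at (F : R -> R) (c e : R) : Prop :=
  forall s t, 0 < s -> 2 * s <= t -> t < e ->
    (t / (2 * s)) ^ 2 * (F c - F (c - s)) <= F (c + t) - F c /\
    (t / (2 * s)) ^ 2 * (F (c + s) - F c) <= F c - F (c - t).

Lemma disjoint_orbit_tail F r a b :
  disjoint_orbit F (S r) a b -> disjoint_orbit F r (F a) (F b).
Proof.
  intros H j j' m Hj Hj' Hne.
  assert (E : forall k x, iter F k (F x) = iter F (S k) x).
  { intros k x; unfold iter; rewrite Nat.iter_succ_r; reflexivity. }
  rewrite !E; apply H; lia.
Qed.

Definition critical_factor (E C : R) : R := 8 * E * (1 + 2 * C) + 2.

Definition critical_bound (E C : R) : R := 2 * (1 + C) * (critical_factor E C + 1).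

(** If the left return interval, of length [s], were much shorter than the
    right one, the arc [[c, c + K s]] would fit into the latter. Its image
    under [F] is at least [K^2/4] times as long as that of [[c - s, c]],
    whereas the remaining iterates, which distort cross-ratios by a bounded
    factor, would have to bring it back to a length of at most [(K + 1) s]. *)
Lemma right_le_left_critical F rho V v eta C e q p q' p' c :
  irrational_lift F rho -> controlled F V v eta -> level rho q p q' p' -> 1 <= C ->
  comparable_steps F q p C -> comparable_steps F q' p' C ->
  (forall x, step F q p x - x <= eta / 3) ->
  (forall x, x - step F q' p' x <= eta / 3) ->
  quadratic_at F c e -> step F q p c - c < e ->
  step F q p c - c <= critical_bound (exp (3 * v)) C * (c - step F q' p' c).
Proof.
  intros HF HV HL HC CG CH Hs1 Hs2 Hcrit He.
  assert (HD := proj1 HF).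
  destruct (level_pos _ _ _ _ _ HL) as [Hq Hqq].
  assert (L1 := level_left _ _ _ _ _ HL). assert (L2 := level_decr _ _ _ _ _ HL).
  set (G := step F q p) in *. set (H := step F q' p') in *.
  assert (HG : forall x, x < G x) by (intros x; apply (step_right F rho); auto; lra).
  assert (HH : forall x, H x < x) by (intros x; apply (step_left F rho); auto; lra).
  set (E := exp (3 * v)).
  assert (HE : 1 <= E) by (apply (weight_factor_ge_1 F V v eta HV)).
  set (K := critical_factor E C).
  assert (HK : 2 <= K) by (unfold K, critical_factor; nra).
  unfold critical_bound; fold K.
  destruct (Rle_lt_dec (G c - c) (2 * (1 + C) * (K + 1) * (c - H c))) as [|Hlong]; [assumption|].
  exfalso.
  set (s := c - H c) in *. assert (Hs : 0 < s) by (unfold s; specialize (HH c); lra).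
  set (t := K * s).
  assert (Ht2 : 2 * s <= t) by (unfold t; apply Rmult_le_compat_r; lra).
  assert (HtL : 2 * (1 + C) * (t + s) < G c - c).
  { replace (t + s) with ((K + 1) * s) by (unfold t; ring). lra. }
  assert (HtL' : t + s < G c - c) by nra.
  destruct (Hcrit s t Hs Ht2 ltac:(lra)) as [Hq2 _].
  replace (c - s) with (H c) in Hq2 by (unfold s; ring).
  replace (t / (2 * s)) with (K / 2) in Hq2 by (unfold t; field; lra).
  (* one iterate of [F], then [q' - 1] iterates of bounded distortion *)
  destruct q' as [|r]; [lia|].
  assert (EH : forall y, H y = iter F r (F y) - IZR p').
  { intros y; unfold H, step, iter; rewrite Nat.iter_succ_r; reflexivity. }
  assert (EI : forall j y, iter F j (F y) = iter F (S j) y).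
  { intros j y; unfold iter; rewrite Nat.iter_succ_r; reflexivity. }
  assert (Hhead : F (H c) < F c) by (apply HD, HH).
  assert (Hmid : F c < F (c + t)) by (apply HD; lra).
  assert (Htail : F (c + t) < F (G c)) by (apply HD; lra).
  assert (DL : disjoint_orbit F (S r) (H c) c)
    by (apply (disjoint_orbit_left F rho q p (S r) p'); auto; lia).
  assert (DR : disjoint_orbit F (S r) c (G c))
    by (apply (disjoint_orbit_right F rho q p (S r) p'); auto).
  assert (Hcr : cross_ratio (H (H c)) (H c) (H (c + t)) (H (G c))
    <= E * cross_ratio (F (H c)) (F c) (F (c + t)) (F (G c))).
  { eapply Rle_trans; [right|apply (cross_ratio_iter F V v eta r); auto].
    - rewrite (EH (H c)), (EH c), (EH (c + t)), (EH (G c)).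
      unfold cross_ratio; f_equal; ring.
    - apply disjoint_orbit_tail, DL.
    - apply disjoint_orbit_tail, (disjoint_orbit_sub F _ c (G c)); auto; lra.
    - apply disjoint_orbit_tail, (disjoint_orbit_sub F _ c (G c)); auto; lra.
    - intros j _. rewrite !EI. unfold G, H; rewrite <- !step_iter by exact HD.
      assert (A1 := Hs1 (iter F (S j) c)). assert (A2 := Hs2 (iter F (S j) c)).
      fold G in A1 |- *. fold H in A2 |- *.
      assert (0 <= eta / 3) by (specialize (HG (iter F (S j) c)); lra). lra. }
  assert (Hct : H (c + t) < c + t) by apply HH.
  assert (Hinc1 : H c < H (c + t)) by (apply step_lt; auto; lra).
  assert (Hinc2 : H (c + t) < H (G c)) by (apply step_lt; auto; lra).
  assert (A0 : s <= C * (H c - H (H c))).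
  { assert (A := proj1 (CH c) : Rabs (H c - c) <= C * Rabs (H (H c) - H c)).
    assert (B1 := HH c). assert (B2 := HH (H c)).
    rewrite !Rabs_left in A by lra. unfold s; lra. }
  assert (HHG : H c <= H (H (G c))).
  { left. apply step_lt; [exact HD|].
    unfold H, G, step at 2; unfold Rminus; rewrite <- opp_IZR, step_point by exact HD.
    apply (orbit_above F rho); [exact HF|].
    rewrite minus_IZR, opp_IZR, plus_INR; lra. }
  assert (B0 : G c - c <= (1 + C) * (H (G c) - H c)).
  { assert (A := proj1 (CH (G c)) : Rabs (H (G c) - G c) <= C * Rabs (H (H (G c)) - H (G c))).
    assert (B1 := HH (G c)). assert (B2 := HH (H (G c))). assert (B3 := HH c).
    rewrite !Rabs_left in A by lra.
    assert (C * (H (G c) - H (H (G c))) <= C * (H (G c) - H c))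
      by (apply Rmult_le_compat_l; lra).
    lra. }
  assert (Hlow : 1 / ((1 + C * (K + 1)) * (1 + 1)) <=
     cross_ratio (H (H c)) (H c) (H (c + t)) (H (G c))).
  { apply cross_ratio_lower; auto; try lra; try nra.
    - apply Rle_trans with ((K + 1) * s).
      + unfold t, s in *; lra.
      + rewrite (Rmult_comm C), Rmult_assoc. apply Rmult_le_compat_l; lra.
    - assert (2 * (t + s) <= H (G c) - H c); [|unfold s in *; lra].
      apply Rmult_le_reg_l with (1 + C); lra. }
  assert (Hup := cross_ratio_le_left _ _ _ _ Hhead Hmid Htail).
  set (X := cross_ratio (F (H c)) (F c) (F (c + t)) (F (G c))) in *.
  assert (HX : 0 < X) by (apply cross_ratio_pos; assumption).
  assert (HX2 : X * (K / 2) ^ 2 <= 1).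
  { apply Rmult_le_reg_r with (F c - F (H c)); [lra|].
    rewrite Rmult_1_l. apply Rle_trans with (2 := Hup).
    rewrite Rmult_assoc. apply Rmult_le_compat_l; lra. }
  assert (P : 0 < (1 + C * (K + 1)) * (1 + 1)) by nra.
  assert (Hlow' := Rle_trans _ _ _ Hlow Hcr).
  apply (Rle_div_l _ _ _ P) in Hlow'.
  assert (HKK : 8 * E * (1 + C * (K + 1)) < K ^ 2).
  { assert (K = 8 * E * (1 + 2 * C) + 2) by reflexivity.
    assert (8 * E * (1 + C * (K + 1)) <= 8 * E * ((1 + 2 * C) * K))
      by (apply Rmult_le_compat_l; nra).
    nra. }
  nra.
Qed.

Definition transport_bound (E C C2 : R) : R :=
  E ^ 2 * (1 + ((C2 + 1) * C + 1) * C) * (1 + C).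

(** Once the two return intervals at [c] are comparable they remain so at
    [f^(2q') c]; the cross-ratio inequality pulls this back along the orbit. *)
Lemma right_le_left_orbit F rho V v eta C C2 q p q' p' c i :
  irrational_lift F rho -> controlled F V v eta -> level rho q p q' p' ->
  1 <= C -> 0 <= C2 ->
  comparable_steps F q p C -> comparable_steps F q' p' C ->
  (forall x, step F q p x - x <= eta / 3) ->
  (forall x, x - step F q' p' x <= eta / 3) ->
  step F q p c - c <= C2 * (c - step F q' p' c) -> (i <= q' + q')%nat ->
  let y := iter F i c in
  step F q p y - y <= transport_bound (exp (3 * v)) C C2 * (y - step F q' p' y).
Proof.
  intros HF HV HL HC HC2 CG CH Hs1 Hs2 Hc Hi.
  assert (HD := proj1 HF).
  destruct (level_pos _ _ _ _ _ HL) as [Hq Hqq].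
  assert (L1 := level_left _ _ _ _ _ HL). assert (L2 := level_decr _ _ _ _ _ HL).
  set (G := step F q p) in *. set (H := step F q' p') in *.
  assert (HG : forall x, x < G x) by (intros x; apply (step_right F rho); auto; lra).
  assert (HH : forall x, H x < x) by (intros x; apply (step_left F rho); auto; lra).
  set (E := exp (3 * v)).
  assert (HE : 1 <= E) by (apply (weight_factor_ge_1 F V v eta HV)).
  assert (Hnext : forall A x, 0 <= A -> G x - x <= A * (x - H x) ->
    G (iter F q' x) - iter F q' x <=
      ((A + 1) * C) * (iter F q' x - H (iter F q' x))).
  { intros A x HA Hx.
    assert (E1 : G (iter F q' x) - iter F q' x = G (H x) - H x).
    { unfold H at 1 2, step, Rminus; rewrite <- opp_IZR. unfold G.
      rewrite step_shift by exact HD. ring. }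
    assert (E2 : iter F q' x - H (iter F q' x) = H x - H (H x)).
    { unfold H at 2 4; unfold step at 2; unfold Rminus; rewrite <- opp_IZR. unfold H.
      rewrite step_shift by exact HD. unfold step at 2; ring_simplify. 
      rewrite opp_IZR; ring. }
    rewrite E1, E2.
    assert (GH : G (H x) < G x) by (apply step_lt; auto).
    assert (B := proj1 (CH x) : Rabs (H x - x) <= C * Rabs (H (H x) - H x)).
    assert (B1 := HH x). assert (B2 := HH (H x)).
    rewrite !Rabs_left in B by lra.
    apply Rle_trans with ((A + 1) * (x - H x)); [lra|].
    rewrite Rmult_assoc; apply Rmult_le_compat_l; lra. }
  set (A2 := ((C2 + 1) * C + 1) * C).
  assert (HA2 : 0 <= A2) by (unfold A2; nra).
  assert (Hend : let Y := iter F (q' + q') c in G Y - Y <= A2 * (Y - H Y)).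
  { cbv zeta. rewrite iter_plus. apply Hnext; [nra|]. apply Hnext; assumption. }
  cbv zeta in Hend |- *. set (y := iter F i c). set (Y := iter F (q' + q') c) in *.
  (* at most two blocks of [q'] iterates lead from [y] to [Y] *)
  set (T := fun x => cross_ratio (H x) x (G x) (G (G x))).
  assert (HT1 : forall r x, (r <= q')%nat -> T (iter F r x) <= E * T x).
  { intros r x Hr; unfold T, G, H; rewrite !step_iter by exact HD.
    apply (cross_ratio_iter F V v eta); auto; try apply HG; try apply HH;
      try (apply (disjoint_orbit_right F rho q p q' p'); assumption);
      try (apply (disjoint_orbit_left F rho q p q' p'); auto; lia).
    intros j _. rewrite <- !step_iter by exact HD.
    assert (A1' := Hs1 (iter F j x)). assert (A2' := Hs1 (G (iter F j x))).
    assert (A3' := Hs2 (iter F j x)). unfold G, H in *. lra. }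
  assert (HTpos : forall x, 0 < T x) by (intros x; apply cross_ratio_pos; auto).
  assert (HT : T Y <= E ^ 2 * T y).
  { unfold Y, y. destruct (le_lt_dec i q') as [Hi'|Hi'].
    - replace (q' + q')%nat with (q' + ((q' - i) + i))%nat by lia.
      rewrite !iter_plus.
      assert (A := HT1 q' (iter F (q' - i) (iter F i c)) (le_n _)).
      assert (B := HT1 (q' - i)%nat (iter F i c) ltac:(lia)).
      assert (E * T (iter F (q' - i) (iter F i c)) <= E * (E * T (iter F i c)))
        by (apply Rmult_le_compat_l; lra). lra.
    - replace (q' + q')%nat with ((q' + q' - i) + i)%nat by lia.
      rewrite !iter_plus.
      assert (B := HT1 (q' + q' - i)%nat (iter F i c) ltac:(lia)).
      assert (P := HTpos (iter F i c)).
      apply Rle_trans with (1 := B). apply Rmult_le_compat_r; nra. }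
  assert (Hlow : 1 / ((1 + A2) * (1 + C)) <= T Y).
  { apply cross_ratio_lower; auto; try lra.
    assert (B := proj1 (CG Y) : Rabs (G Y - Y) <= C * Rabs (G (G Y) - G Y)).
    assert (B1 := HG Y). assert (B2 := HG (G Y)).
    rewrite !Rabs_pos_eq in B by lra. exact B. }
  assert (P : 0 < (1 + A2) * (1 + C)) by (apply Rmult_lt_0_compat; lra).
  assert (Hlow' := Rle_trans _ _ _ Hlow HT).
  apply (Rle_div_l _ _ _ P) in Hlow'.
  assert (Hup := cross_ratio_le_left _ _ _ _ (HH y) (HG y) (HG (G y))).
  fold (T y) in Hup.
  unfold transport_bound; fold A2.
  assert (B1 := HG y).
  apply Rle_trans with (E ^ 2 * (1 + A2) * (1 + C) * (T y * (G y - y))).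
  - rewrite <- (Rmult_1_l (G y - y)) at 1. rewrite <- Rmult_assoc.
    apply Rmult_le_compat_r; lra.
  - apply Rmult_le_compat_l; [|exact Hup].
    apply Rmult_le_pos; [apply Rmult_le_pos|]; nra.
Qed.

(** * Reflection of the line *)

Definition reflect (F : R -> R) (x : R) : R := - F (- x).

Lemma iter_reflect F k x : iter (reflect F) k x = - iter F k (- x).
Proof.
  induction k as [|k IH]; [rewrite !iter_0; ring|].
  rewrite !iter_S, IH; unfold reflect; rewrite Ropp_involutive; reflexivity.
Qed.

Lemma step_reflect F q p x : step (reflect F) q (- p) x = - step F q p (- x).
Proof. unfold step; rewrite iter_reflect, opp_IZR; ring. Qed.

Lemma degree_one_reflect F : degree_one F -> degree_one (reflect F).
Proof.
  intros [H1 H1']; split.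
  - intros x y Hxy; unfold reflect; apply Ropp_lt_contravar, H1; lra.
  - intros x; unfold reflect. assert (E := H1' (- (x + 1))).
    replace (- (x + 1) + 1) with (- x) in E by ring. lra.
Qed.

Lemma irrational_lift_reflect F rho :
  irrational_lift F rho -> irrational_lift (reflect F) (- rho).
Proof.
  intros (H1 & H2 & H3 & H4); split; [apply degree_one_reflect, H1|split; [|split]].
  - intros x. unfold reflect. apply continuity_pt_opp.
    apply (continuity_pt_comp Ropp F x); [apply continuity_pt_opp, continuity_pt_id|apply H2].
  - intros k k' m m' x H. rewrite !iter_reflect.
    assert (E := H3 k' k (- m')%Z (- m)%Z (- x)). rewrite !opp_IZR in E. lra.
  - intros k m H. apply (H4 k (- m)%Z). rewrite opp_IZR; lra.
Qed.

Lemma controlled_reflect F V v eta :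
  controlled F V v eta -> controlled (reflect F) (reflect V) v eta.
Proof.
  intros (H1 & H2 & H3); split; [|split].
  - intros x y Hxy; unfold reflect. assert (V (- y) <= V (- x)) by (apply H1; lra). lra.
  - intros x; unfold reflect. assert (E := H2 (- (x + 1))).
    replace (- (x + 1) + 1) with (- x) in E by ring. lra.
  - intros a b c d Hab Hbc Hcd Hda; unfold reflect.
    rewrite cross_ratio_reflect, <- (cross_ratio_reflect a b c d).
    replace (- V (- d) - - V (- a)) with (V (- a) - V (- d)) by ring.
    apply H3; lra.
Qed.

Lemma comparable_steps_reflect F q p C :
  comparable_steps F q p C -> comparable_steps (reflect F) q (- p) C.
Proof.
  intros H x; cbv zeta. destruct (H (- x)) as [A B]; cbv zeta in A, B.
  rewrite !step_reflect, Ropp_involutive.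
  replace (- step F q p (step F q p (- x)) - - step F q p (- x))
    with (- (step F q p (step F q p (- x)) - step F q p (- x))) by ring.
  replace (- step F q p (- x) - x) with (- (step F q p (- x) - - x)) by ring.
  rewrite !Rabs_Ropp; split; assumption.
Qed.

Lemma quadratic_at_reflect F c e :
  quadratic_at F c e -> quadratic_at (reflect F) (- c) e.
Proof.
  intros H s t H1 H2 H3; destruct (H s t H1 H2 H3) as [A B]; unfold reflect.
  replace (- (- c - s)) with (c + s) by ring.
  replace (- (- c + s)) with (c - s) by ring.
  replace (- (- c + t)) with (c - t) by ring.
  replace (- (- c - t)) with (c + t) by ring.
  rewrite Ropp_involutive. split; lra.
Qed.

(** * Continued fractions and closest returns *)

(** [return_time a n] and [numer a n] are the denominator and the numerator of
    the [n]-th convergent. *)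
Fixpoint numer (a : nat -> nat) (n : nat) : Z :=
  match n with
  | O => 0
  | S O => 1
  | S (S m as k) => Z.of_nat (a k) * numer a k + numer a m
  end%Z.

Lemma return_time_SS a n :
  return_time a (S (S n)) = (a (S n) * return_time a (S n) + return_time a n)%nat.
Proof. reflexivity. Qed.

Lemma numer_SS a n :
  numer a (S (S n)) = (Z.of_nat (a (S n)) * numer a (S n) + numer a n)%Z.
Proof. reflexivity. Qed.

Lemma return_time_mono a n : (forall k, (1 <= a k)%nat) ->
  (1 <= return_time a n <= return_time a (S n))%nat.
Proof.
  intros Ha; induction n as [|n IH].
  - simpl. specialize (Ha 0%nat). lia.
  - rewrite return_time_SS. specialize (Ha (S n)). nia.
Qed.

Lemma return_time_add a n : (forall k, (1 <= a k)%nat) ->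
  (return_time a n + return_time a (S n) <= return_time a (S (S n)))%nat.
Proof. intros Ha; rewrite return_time_SS. specialize (Ha (S n)). nia. Qed.

Lemma return_time_ge a n : (forall k, (1 <= a k)%nat) -> (n < return_time a (S n))%nat.
Proof.
  intros Ha; induction n as [|n IH].
  - simpl; specialize (Ha 0%nat); lia.
  - assert (A := return_time_add a n Ha). assert (B := return_time_mono a n Ha). lia.
Qed.

Lemma convergents_det a n :
  (numer a (S n) * Z.of_nat (return_time a n)
   - numer a n * Z.of_nat (return_time a (S n)) = (-1) ^ Z.of_nat n)%Z.
Proof.
  induction n as [|n IH]; [reflexivity|].
  rewrite Nat2Z.inj_succ, Z.pow_succ_r, <- IH by lia.
  rewrite return_time_SS, numer_SS, Nat2Z.inj_add, Nat2Z.inj_mul. ring.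
Qed.

Lemma cfrac_bounds n : forall a, (forall k, (1 <= a k)%nat) ->
  1 / (INR (a 0%nat) + 1) <= cfrac a n <= 1.
Proof.
  induction n as [|n IH]; intros a Ha; assert (H1 : 1 <= INR (a 0%nat)) by (apply (le_INR 1), Ha).
  - simpl cfrac. split.
    + unfold Rdiv; rewrite !Rmult_1_l. apply Rinv_le_contravar; lra.
    + apply Rle_div_l; lra.
  - simpl cfrac. destruct (IH (fun k => a (S k)) (fun k => Ha (S k))) as [A B].
    assert (0 < 1 / (INR (a 1%nat) + 1)).
    { apply Rdiv_lt_0_compat; [lra|]. assert (0 <= INR (a 1%nat)) by apply pos_INR. lra. }
    split.
    + unfold Rdiv; rewrite !Rmult_1_l. apply Rinv_le_contravar; lra.
    + apply Rle_div_l; lra.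
Qed.

Lemma cf_expansion_tail rho a : cf_expansion rho a ->
  0 < rho /\ cf_expansion (1 / rho - INR (a 0%nat)) (fun k => a (S k)).
Proof.
  intros [Ha Hl].
  assert (H1 : 1 <= INR (a 0%nat)) by (apply (le_INR 1), Ha).
  assert (Hpos : 0 < rho).
  { assert (A := is_lim_seq_le (fun _ => 1 / (INR (a 0%nat) + 1)) (cfrac a)
      (1 / (INR (a 0%nat) + 1)) rho (fun n => proj1 (cfrac_bounds n a Ha))
      (is_lim_seq_const _) Hl).
    simpl in A. assert (0 < 1 / (INR (a 0%nat) + 1)) by (apply Rdiv_lt_0_compat; lra). lra. }
  split; [exact Hpos|split; [intros k; apply Ha|]].
  apply is_lim_seq_ext with (fun n => 1 * / cfrac a (S n) - INR (a 0%nat)).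
  - intros n. simpl cfrac.
    assert (B := cfrac_bounds n (fun k => a (S k)) (fun k => Ha (S k))).
    assert (0 < 1 / (INR (a 1%nat) + 1)).
    { apply Rdiv_lt_0_compat; [lra|]. assert (0 <= INR (a 1%nat)) by apply pos_INR. lra. }
    field; lra.
  - apply is_lim_seq_minus'; [|apply is_lim_seq_const].
    unfold Rdiv. apply is_lim_seq_mult'; [apply is_lim_seq_const|].
    apply (is_lim_seq_inv (fun n => cfrac a (S n)) rho).
    + apply is_lim_seq_incr_1 in Hl; exact Hl.
    + intros E; injection E; lra.
Qed.

Fixpoint cf_tail (rho : R) (a : nat -> nat) (n : nat) : R :=
  match n with
  | O => rho
  | S m => cf_tail (1 / rho - INR (a 0%nat)) (fun k => a (S k)) m
  end.

Lemma cf_tail_S n : forall rho a,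
  cf_tail rho a (S n) = 1 / cf_tail rho a n - INR (a n).
Proof.
  induction n as [|n IH]; intros rho a; [reflexivity|].
  change (cf_tail (1 / rho - INR (a 0%nat)) (fun k => a (S k)) (S n)
    = 1 / cf_tail (1 / rho - INR (a 0%nat)) (fun k => a (S k)) n - INR (a (S n))).
  apply IH.
Qed.

Lemma cf_tail_pos n : forall rho a, cf_expansion rho a -> 0 < cf_tail rho a n.
Proof.
  induction n as [|n IH]; intros rho a H; destruct (cf_expansion_tail rho a H) as [A B].
  - exact A.
  - apply (IH _ _ B).
Qed.

Lemma cf_tail_lt_1 n rho a : cf_expansion rho a -> 0 < cf_tail rho a n < 1.
Proof.
  intros H; split; [apply cf_tail_pos, H|].
  assert (A := cf_tail_pos n rho a H). assert (B := cf_tail_pos (S n) rho a H).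
  rewrite cf_tail_S in B.
  assert (C : 1 <= INR (a n)) by (apply (le_INR 1), H).
  assert (1 < 1 / cf_tail rho a n) by lra.
  apply Rlt_div_r in H0; [lra|exact A].
Qed.

Definition closeness (rho : R) (a : nat -> nat) (n : nat) : R :=
  INR (return_time a n) * rho - IZR (numer a n).

(** Consecutive closest returns lie on opposite sides, and their ratio is a tail
    of the continued fraction. *)
Lemma closeness_S rho a n : cf_expansion rho a ->
  closeness rho a (S n) = - cf_tail rho a (S n) * closeness rho a n.
Proof.
  intros H; induction n as [|n IH].
  - assert (A := cf_tail_pos 0 rho a H). rewrite cf_tail_S. unfold closeness; simpl in *.
    field. lra.
  - assert (A := cf_tail_pos (S n) rho a H). rewrite cf_tail_S.
    assert (E : closeness rho a (S (S n)) =
      INR (a (S n)) * closeness rho a (S n) + closeness rho a n).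
    { unfold closeness; rewrite return_time_SS, numer_SS, plus_INR, mult_INR, plus_IZR,
        mult_IZR, <- INR_IZR_INZ; ring. }
    rewrite E. 
    replace (closeness rho a n) with (- (closeness rho a (S n) / cf_tail rho a (S n)))
      by (rewrite IH; field; lra).
    field. lra.
Qed.

Lemma closeness_sign rho a n : cf_expansion rho a ->
  0 < (-1) ^ n * closeness rho a n < 1.
Proof.
  intros H; induction n as [|n IH].
  - assert (A := cf_tail_lt_1 0 rho a H). unfold closeness; simpl in *. lra.
  - rewrite closeness_S by exact H. assert (A := cf_tail_lt_1 (S n) rho a H).
    simpl ((-1) ^ S n). split; nra.
Qed.

Lemma closeness_decr rho a n : cf_expansion rho a ->
  Rabs (closeness rho a (S n)) < Rabs (closeness rho a n).
Proof.
  intros H. rewrite closeness_S by exact H. assert (A := cf_tail_lt_1 (S n) rho a H).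
  assert (B := closeness_sign rho a n H).
  rewrite Rabs_mult, Rabs_Ropp, (Rabs_pos_eq (cf_tail _ _ _)) by lra.
  assert (P : 0 < Rabs (closeness rho a n)).
  { apply Rabs_pos_lt; intros E; rewrite E in B; lra. }
  nra.
Qed.

(** The vector [(k, l)] is an integer combination of two consecutive convergents. If
    both coefficients are nonzero they have opposite signs, because [|k|] is
    small, and then the two error terms have equal signs and add up. *)
Lemma best_approximation rho (q p q' p' : Z) :
  (0 < q)%Z -> (0 < q')%Z -> (p' * q - p * q' = 1 \/ p' * q - p * q' = -1)%Z ->
  (IZR q * rho - IZR p) * (IZR q' * rho - IZR p') < 0 ->
  forall k l : Z, (k <> 0 \/ l <> 0)%Z -> (Z.abs k < q')%Z ->
    Rabs (IZR q * rho - IZR p) <= Rabs (IZR k * rho - IZR l).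
Proof.
  intros Hq Hq' Hdet Hopp k l Hne Hk.
  assert (Huv : exists u w : Z, (k = u * q + w * q' /\ l = u * p + w * p')%Z).
  { destruct Hdet as [D|D].
    - exists (k * p' - l * q')%Z, (l * q - k * p)%Z. split.
      + replace k with (k * (p' * q - p * q'))%Z at 1 by (rewrite D; ring). ring.
      + replace l with (l * (p' * q - p * q'))%Z at 1 by (rewrite D; ring). ring.
    - exists (- (k * p' - l * q'))%Z, (- (l * q - k * p))%Z. split.
      + replace k with (- (k * (p' * q - p * q')))%Z at 1 by (rewrite D; ring). ring.
      + replace l with (- (l * (p' * q - p * q')))%Z at 1 by (rewrite D; ring). ring. }
  destruct Huv as (u & w & Ek & El).
  set (th := IZR q * rho - IZR p) in *. set (th' := IZR q' * rho - IZR p') in *.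
  replace (IZR k * rho - IZR l) with (IZR u * th + IZR w * th').
  2:{ rewrite Ek, El, !plus_IZR, !mult_IZR; unfold th, th'; ring. }
  assert (Hu : u <> 0%Z).
  { intros ->. assert (w = 0)%Z by nia. subst w. lia. }
  assert (Hu1 : 1 <= Rabs (IZR u)).
  { rewrite <- abs_IZR. apply IZR_le. lia. }
  assert (Hge : Rabs th <= Rabs (IZR u * th)).
  { rewrite Rabs_mult. assert (P := Rabs_pos th). nra. }
  apply Rle_trans with (1 := Hge).
  assert (Hs : 0 <= (IZR u * th) * (IZR w * th')).
  { assert (Huw : (u * w <= 0)%Z).
    { destruct (Z_lt_le_dec 0 u); destruct (Z_lt_le_dec 0 w); try nia.
      destruct (Z_lt_le_dec w 0); nia. }
    apply IZR_le in Huw. rewrite mult_IZR in Huw.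
    replace ((IZR u * th) * (IZR w * th')) with ((- (IZR u * IZR w)) * (- (th * th'))) by ring.
    apply Rmult_le_pos; lra. }
  set (x := IZR u * th) in *. set (y := IZR w * th') in *.
  unfold Rabs; destruct (Rcase_abs x); destruct (Rcase_abs (x + y)); nra.
Qed.

Lemma no_closer_return_convergent rho a n : cf_expansion rho a ->
  no_closer_return rho (return_time a (S n)) (Rabs (closeness rho a n)).
Proof.
  intros H k l Hne Hk. unfold closeness. rewrite INR_IZR_INZ.
  assert (M := return_time_mono a n (proj1 H)).
  apply (best_approximation rho _ _ (Z.of_nat (return_time a (S n))) (numer a (S n))); auto; try lia.
  - rewrite convergents_det.
    destruct (Nat.Even_or_Odd n) as [[m E]|[m E]]; [left|right]; rewrite E.
    + rewrite Nat2Z.inj_mul, Z.pow_mul_r by lia. apply Z.pow_1_l; lia.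
    + rewrite Nat2Z.inj_add, Nat2Z.inj_mul, Z.pow_add_r, Z.pow_mul_r by lia.
      change ((-1) ^ Z.of_nat 2)%Z with 1%Z. rewrite Z.pow_1_l by lia. reflexivity.
  - rewrite <- !INR_IZR_INZ. fold (closeness rho a n) (closeness rho a (S n)).
    rewrite closeness_S by exact H. assert (A := cf_tail_lt_1 (S n) rho a H).
    assert (B := closeness_sign rho a n H).
    assert (0 < closeness rho a n * closeness rho a n).
    { assert (closeness rho a n <> 0) by (intros E; rewrite E in B; lra).
      apply Rsqr_pos_lt in H0; exact H0. }
    nra.
Qed.

Lemma cf_irrational rho a (k : nat) (m : Z) : cf_expansion rho a ->
  INR k * rho = IZR m -> k = 0%nat.
Proof.
  intros H E. destruct (Nat.eq_dec k 0) as [|Hk]; [assumption|exfalso].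
  assert (A := return_time_ge a k (proj1 H)).
  assert (B := no_closer_return_convergent rho a k H (Z.of_nat k) m ltac:(lia) ltac:(lia)).
  assert (C := closeness_sign rho a k H).
  rewrite <- INR_IZR_INZ, E, Rminus_diag, Rabs_R0 in B.
  assert (closeness rho a k = 0).
  { destruct (Req_dec (closeness rho a k) 0) as [|N]; [assumption|].
    apply Rabs_pos_lt in N; lra. }
  rewrite H0 in C; lra.
Qed.

Lemma no_closer_return_le rho r r' g :
  no_closer_return rho r g -> (r' <= r)%nat -> no_closer_return rho r' g.
Proof. intros H Hr k l Hne Hk; apply H; [exact Hne|lia]. Qed.

Lemma no_closer_return_opp rho r g :
  no_closer_return rho r g -> no_closer_return (- rho) r g.
Proof.
  intros H k l Hne Hk. assert (A := H k (- l)%Z ltac:(lia) Hk).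
  rewrite opp_IZR in A.
  replace (IZR k * - rho - IZR l) with (- (IZR k * rho - - IZR l)) by ring.
  rewrite Rabs_Ropp; exact A.
Qed.

Lemma level_even rho a n : cf_expansion rho a -> Nat.Even n ->
  level rho (return_time a n) (numer a n) (return_time a (S n)) (numer a (S n)).
Proof.
  intros H [m Hm].
  assert (S0 := closeness_sign rho a n H). assert (S1 := closeness_sign rho a (S n) H).
  assert (D := closeness_decr rho a n H).
  assert (N0 := no_closer_return_convergent rho a n H).
  assert (N1 := no_closer_return_convergent rho a (S n) H).
  assert (P : (-1) ^ n = 1) by (rewrite Hm; apply pow_1_even).
  simpl ((-1) ^ S n) in S1. rewrite P in S0, S1.
  rewrite (Rabs_pos_eq (closeness rho a n)) in D, N0 by lra.
  rewrite (Rabs_left (closeness rho a (S n))) in D, N1 by lra.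
  unfold closeness in *.
  split; [apply return_time_mono, H|lra|lra|exact N0|].
  apply (no_closer_return_le _ (return_time a (S (S n)))); [|apply return_time_add, H].
  intros k l Hne Hk; specialize (N1 k l Hne Hk); lra.
Qed.

Lemma level_odd rho a n : cf_expansion rho a -> Nat.Odd n ->
  level (- rho) (return_time a n) (- numer a n) (return_time a (S n)) (- numer a (S n)).
Proof.
  intros H [m Hm].
  assert (S0 := closeness_sign rho a n H). assert (S1 := closeness_sign rho a (S n) H).
  assert (D := closeness_decr rho a n H).
  assert (N0 := no_closer_return_opp _ _ _ (no_closer_return_convergent rho a n H)).
  assert (N1 := no_closer_return_opp _ _ _ (no_closer_return_convergent rho a (S n) H)).
  assert (P : (-1) ^ n = -1).
  { rewrite Hm, Nat.add_1_r. apply pow_1_odd. }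
  simpl ((-1) ^ S n) in S1. rewrite P in S0, S1.
  rewrite (Rabs_left (closeness rho a n)) in D, N0 by lra.
  rewrite (Rabs_pos_eq (closeness rho a (S n))) in D, N1 by lra.
  unfold closeness in *.
  split; [apply return_time_mono, H|rewrite opp_IZR; lra|rewrite !opp_IZR; lra| |].
  - intros k l Hne Hk; specialize (N0 k l Hne Hk); rewrite opp_IZR; lra.
  - apply (no_closer_return_le _ (return_time a (S (S n)))); [|apply return_time_add, H].
    intros k l Hne Hk; specialize (N1 k l Hne Hk); rewrite opp_IZR; lra.
Qed.

Lemma closeness_lt_1 rho a n : cf_expansion rho a -> Rabs (closeness rho a n) < 1.
Proof.
  intros Ha. assert (H := closeness_sign rho a n Ha).
  assert (E : Rabs (closeness rho a n) = Rabs ((-1) ^ n * closeness rho a n))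
    by (rewrite Rabs_mult, pow_1_abs; ring).
  rewrite E, Rabs_pos_eq; lra.
Qed.

(** * The order of orbits from the rotation number *)

Lemma iter_multiple F k (m : Z) x : degree_one F ->
  iter F k x <= x + IZR m -> forall n, iter F (n * k) x <= x + INR n * IZR m.
Proof.
  intros HF H n; induction n as [|n IH]; [rewrite Nat.mul_0_l, iter_0; simpl; lra|].
  replace (S n * k)%nat with (n * k + k)%nat by lia.
  rewrite iter_plus, S_INR.
  apply Rle_trans with (iter F (n * k) (x + IZR m)); [apply iter_le; auto|].
  rewrite iter_shift by exact HF. lra.
Qed.

Lemma rotation_number_le F (rho : R) k (m : Z) x : degree_one F ->
  is_lim_seq (fun n : nat => (iter F n x - x) / INR n) rho ->
  (1 <= k)%nat -> iter F k x <= x + IZR m -> INR k * rho <= IZR m.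
Proof.
  intros HF Hl Hk H.
  assert (Hk' : 1 <= INR k) by (apply (le_INR 1); exact Hk).
  assert (Hphi : filterlim (fun n => (S n * k)%nat) Hierarchy.eventually Hierarchy.eventually).
  { intros P [N0 HP]; exists N0; intros n Hn; apply HP; nia. }
  assert (Hs := is_lim_seq_subseq _ rho _ Hphi Hl).
  assert (B : Rbar_le rho (IZR m / INR k)).
  { refine (is_lim_seq_le _ (fun _ => IZR m / INR k) _ _ _ Hs (is_lim_seq_const _)).
    intros n. assert (C := iter_multiple F k m x HF H (S n)).
    assert (P : 0 < INR (S n)) by (apply lt_0_INR; lia).
    rewrite mult_INR. apply Rle_div_l; [apply Rmult_lt_0_compat; lra|].
    replace (IZR m / INR k * (INR (S n) * INR k)) with (INR (S n) * IZR m) by (field; lra).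
    lra. }
  simpl in B. apply Rle_div_r in B; [lra|lra].
Qed.

Lemma is_lim_seq_reflect F (rho : R) x :
  is_lim_seq (fun n : nat => (iter F n (- x) - - x) / INR n) rho ->
  is_lim_seq (fun n : nat => (iter (reflect F) n x - x) / INR n) (- rho).
Proof.
  intros H.
  apply is_lim_seq_ext with (fun n => - ((iter F n (- x) - - x) / INR n)).
  - intros n; rewrite iter_reflect; unfold Rdiv; ring.
  - apply (is_lim_seq_opp _ rho); exact H.
Qed.

(** Only the sign of [k rho + m] matters. If one point satisfies [F^k x <= x + m],
    iteration gives [k rho <= m]; so [k rho > m] forces the opposite inequality at
    every point, and reflection gives the other sign. *)
Lemma irrational_lift_intro F (rho : R) :
  degree_one F -> continuity F ->
  (forall x, is_lim_seq (fun n : nat => (iter F n x - x) / INR n) rho) ->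
  (forall (k : nat) (m : Z), INR k * rho = IZR m -> k = 0%nat) ->
  irrational_lift F rho.
Proof.
  intros HF HC Hl Hirr; split; [exact HF|split; [exact HC|split; [|exact Hirr]]].
  assert (Hab : forall k (m : Z) x, 0 < INR k * rho + IZR m -> x < iter F k x + IZR m).
  { intros k m x H. destruct (Nat.eq_dec k 0) as [->|Hk].
    - simpl in H; rewrite iter_0; lra.
    - apply Rnot_le_lt; intros L.
      assert (A := rotation_number_le F rho k (- m) x HF (Hl x) ltac:(lia)).
      rewrite opp_IZR in A. lra. }
  assert (Hbe : forall k (m : Z) x, INR k * rho + IZR m < 0 -> iter F k x + IZR m < x).
  { intros k m x H. destruct (Nat.eq_dec k 0) as [->|Hk].
    - simpl in H; rewrite iter_0; lra.
    - apply Rnot_le_lt; intros L.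
      assert (A := rotation_number_le (reflect F) (- rho) k m (- x)
        (degree_one_reflect F HF)).
      rewrite iter_reflect in A. rewrite Ropp_involutive in A.
      assert (B := is_lim_seq_reflect F rho (- x)). rewrite Ropp_involutive in B.
      specialize (A (B (Hl x)) ltac:(lia) ltac:(lra)). lra. }
  intros k k' m m' x H. destruct (Nat.le_ge_cases k k') as [L|L].
  - assert (A := Hab (k' - k)%nat (m' - m)%Z (iter F k x)).
    rewrite <- iter_plus, minus_INR, minus_IZR in A by exact L.
    replace (k' - k + k)%nat with k' in A by lia. lra.
  - assert (A := Hbe (k - k')%nat (m - m')%Z (iter F k' x)).
    rewrite <- iter_plus, minus_INR, minus_IZR in A by exact L.
    replace (k - k' + k')%nat with k in A by lia. lra.
Qed.

(** * Bounds at all small scales *)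

Definition return_length (F : R -> R) (a : nat -> nat) (n : nat) (x : R) : R :=
  Rabs (step F (return_time a n) (numer a n) x - x).

Lemma return_length_reflect F a n x :
  Rabs (step (reflect F) (return_time a n) (- numer a n) x - x)
    = return_length F a n (- x).
Proof.
  unfold return_length; rewrite step_reflect, <- Rabs_Ropp; f_equal; ring.
Qed.

Lemma comparable_steps_reflect_inv F q p C :
  comparable_steps (reflect F) q (- p) C -> comparable_steps F q p C.
Proof.
  intros H. apply comparable_steps_reflect in H. rewrite Z.opp_involutive in H.
  intros x. assert (E : forall y, step (reflect (reflect F)) q p y = step F q p y).
  { intros y; unfold step; rewrite !iter_reflect, !Ropp_involutive; reflexivity. }
  specialize (H x). cbv zeta in *. rewrite !E in H. exact H.
Qed.

Lemma return_lengths_comparable F rho a V v eta n :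
  irrational_lift F rho -> cf_expansion rho a -> controlled F V v eta ->
  (forall x, return_length F a n x <= eta / 3) ->
  comparable_steps F (return_time a n) (numer a n) (step_bound v).
Proof.
  intros HF Ha HV Hsz.
  destruct (Nat.Even_or_Odd n) as [Hn|Hn].
  - apply (steps_comparable F rho V v eta _ _ _ _ HF HV (level_even rho a n Ha Hn)).
    intros x. apply Rle_trans with (1 := Rle_abs _), Hsz.
  - apply comparable_steps_reflect_inv.
    apply (steps_comparable _ _ _ v eta _ _ _ _ (irrational_lift_reflect F rho HF)
      (controlled_reflect F V v eta HV) (level_odd rho a n Ha Hn)).
    intros x. apply Rle_trans with (1 := Rle_abs _).
    rewrite return_length_reflect; apply Hsz.
Qed.

Lemma return_length_le_1 F rho a n x :
  irrational_lift F rho -> cf_expansion rho a -> return_length F a n x <= 1.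
Proof.
  intros HF Ha. assert (HB := closeness_lt_1 rho a n Ha).
  apply Rabs_def2 in HB. unfold closeness in HB.
  assert (A := orbit_above F rho (return_time a n) (1 - numer a n) x HF).
  assert (B := orbit_below F rho (return_time a n) (- 1 - numer a n) x HF).
  rewrite minus_IZR in A, B. unfold return_length, step. apply Rabs_le. lra.
Qed.

Lemma step_bound_ge_1 F V v eta : controlled F V v eta -> 1 <= step_bound v.
Proof.
  intros H. apply weight_factor_ge_1 in H. unfold step_bound.
  set (E := exp (3 * v)) in *.
  assert (A : 1 <= E ^ 2) by nra. assert (B : 1 <= E ^ 3) by nra.
  assert (1 <= (1 + 20 * E ^ 3) ^ 2) by nra. nra.
Qed.

Lemma return_length_contracts F rho a C n x :
  irrational_lift F rho -> cf_expansion rho a -> 0 <= C ->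
  comparable_steps F (return_time a (S n)) (numer a (S n)) C ->
  (1 + C) * return_length F a (S (S n)) x <= C * return_length F a n x.
Proof.
  intros HF Ha HC Hcmp.
  assert (Ha1 := proj1 Ha (S n)).
  assert (S1 := closeness_sign rho a (S n) Ha).
  assert (S2 := closeness_sign rho a (S (S n)) Ha).
  assert (D := closeness_decr rho a (S n) Ha).
  destruct (Nat.Even_or_Odd n) as [Hn|Hn].
  - apply (displacement_contracts F rho C _ _ _ _ (a (S n)) x HF
      (level_even rho a n Ha Hn) HC Hcmp Ha1).
    assert (P : (-1) ^ n = 1) by (destruct Hn as [k ->]; apply pow_1_even).
    simpl ((-1) ^ S _) in S1, S2. rewrite P in S1, S2.
    rewrite (Rabs_pos_eq (closeness rho a (S (S n)))) in D by lra.
    rewrite (Rabs_left (closeness rho a (S n))) in D by lra.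
    unfold closeness in S2, D. rewrite return_time_SS, numer_SS in S2, D. lra.
  - assert (H := displacement_contracts (reflect F) (- rho) C _ _ _ _ (a (S n)) (- x)
      (irrational_lift_reflect F rho HF) (level_odd rho a n Ha Hn) HC
      (comparable_steps_reflect _ _ _ _ Hcmp) Ha1).
    replace (Z.of_nat (a (S n)) * - numer a (S n) + - numer a n)%Z
      with (- (numer a (S (S n))))%Z in H by (rewrite numer_SS; ring).
    rewrite <- return_time_SS, !return_length_reflect, Ropp_involutive in H.
    apply H.
    assert (P : (-1) ^ n = -1)
      by (destruct Hn as [k ->]; rewrite Nat.add_1_r; apply pow_1_odd).
    simpl ((-1) ^ S _) in S1, S2. rewrite P in S1, S2.
    rewrite (Rabs_left (closeness rho a (S (S n)))) in D by lra.
    rewrite (Rabs_pos_eq (closeness rho a (S n))) in D by lra.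
    unfold closeness in S2, D. rewrite !opp_IZR. lra.
Qed.

(** A cross-ratio inequality with any constant makes the return lengths decrease
    geometrically, uniformly on the circle; in particular there are no wandering
    intervals. The bound 3 suffices because three return arcs of the same level have total
    length at most 3. *)
Lemma return_length_vanishes F rho a V v :
  irrational_lift F rho -> cf_expansion rho a -> controlled F V v 3 ->
  forall e, 0 < e -> exists n0, forall n, (n0 <= n)%nat -> forall x,
    return_length F a n x <= e.
Proof.
  intros HF Ha HV e He.
  set (C := step_bound v).
  assert (HC : 1 <= C) by (apply (step_bound_ge_1 F V v 3 HV)).
  set (l := C / (1 + C)).
  assert (Hl : 0 <= l < 1).
  { unfold l; split; [apply Rdiv_le_0_compat; lra|].
    apply Rlt_div_l; lra. }
  assert (Hstep : forall n x, return_length F a (S (S n)) x <= l * return_length F a n x).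
  { intros n x.
    assert (Hcmp : comparable_steps F (return_time a (S n)) (numer a (S n)) C).
    { apply (return_lengths_comparable F rho a V v 3); auto.
      intros y; assert (B := return_length_le_1 F rho a (S n) y HF Ha); lra. }
    assert (H := return_length_contracts F rho a C n x HF Ha ltac:(lra) Hcmp).
    apply Rmult_le_reg_l with (1 + C); [lra|].
    replace ((1 + C) * (l * return_length F a n x)) with (C * return_length F a n x)
      by (unfold l; field; lra). exact H. }
  assert (Hpow : forall k n x, return_length F a (2 * k + n) x <= l ^ k).
  { induction k as [|k IH]; intros n x.
    - simpl; apply (return_length_le_1 F rho); assumption.
    - replace (2 * S k + n)%nat with (S (S (2 * k + n))) by lia.
      apply Rle_trans with (1 := Hstep _ _). simpl.
      apply Rmult_le_compat_l; [lra|apply IH]. }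
  destruct (pow_lt_1_zero l) with (y := e) as [k Hk]; [rewrite Rabs_pos_eq; lra|exact He|].
  exists (2 * k)%nat; intros n Hn x.
  replace n with (2 * k + (n - 2 * k))%nat by lia.
  apply Rle_trans with (1 := Hpow _ _ _).
  specialize (Hk k (le_n _)). apply Rle_trans with (1 := Rle_abs _). lra.
Qed.

Definition ratio_bound (v : R) : R :=
  transport_bound (exp (3 * v)) (step_bound v)
    (critical_bound (exp (3 * v)) (step_bound v)).

Lemma critical_bound_pos E C : 1 <= E -> 1 <= C -> 0 <= critical_bound E C.
Proof.
  intros HE HC; unfold critical_bound, critical_factor.
  apply Rmult_le_pos; nra.
Qed.

(** The time [2 q_(n+1)] covers the common endpoints of all pairs of adjacent
    intervals of different levels. *)
Lemma consecutive_levels F rho a V v eta c e n :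
  irrational_lift F rho -> cf_expansion rho a -> controlled F V v eta ->
  quadratic_at F c e ->
  (forall x, return_length F a n x <= eta / 3 /\ return_length F a n x < e) ->
  (forall x, return_length F a (S n) x <= eta / 3) ->
  forall i, (i <= return_time a (S n) + return_time a (S n))%nat ->
    return_length F a n (iter F i c) <= ratio_bound v * return_length F a (S n) (iter F i c)
    /\ return_length F a (S n) (iter F i c)
         <= step_bound v * return_length F a n (iter F i c).
Proof.
  intros HF Ha HV Hc Hn1 Hn2 i Hi.
  assert (C1 := return_lengths_comparable F rho a V v eta n HF Ha HV
    (fun x => proj1 (Hn1 x))).
  assert (C2 := return_lengths_comparable F rho a V v eta (S n) HF Ha HV Hn2).
  assert (HC := step_bound_ge_1 F V v eta HV).
  assert (HE := weight_factor_ge_1 F V v eta HV).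
  assert (HB := critical_bound_pos _ _ HE HC).
  (* stated for any map, so that reflection reduces odd levels to it *)
  assert (Main : forall F V rho p p' c,
    irrational_lift F rho -> controlled F V v eta ->
    level rho (return_time a n) p (return_time a (S n)) p' ->
    comparable_steps F (return_time a n) p (step_bound v) ->
    comparable_steps F (return_time a (S n)) p' (step_bound v) ->
    quadratic_at F c e ->
    (forall x, Rabs (step F (return_time a n) p x - x) <= eta / 3 /\
       Rabs (step F (return_time a n) p x - x) < e) ->
    (forall x, Rabs (step F (return_time a (S n)) p' x - x) <= eta / 3) ->
    let y := iter F i c in
    Rabs (step F (return_time a n) p y - y) <=
      ratio_bound v * Rabs (step F (return_time a (S n)) p' y - y) /\
    Rabs (step F (return_time a (S n)) p' y - y) <=
      step_bound v * Rabs (step F (return_time a n) p y - y)).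
  { clear F V rho c HF Ha HV Hc Hn1 Hn2 C1 C2.
    intros F V rho p p' c HF HV HL C1 C2 Hc Hn1 Hn2 y.
    assert (L1 := level_left _ _ _ _ _ HL). assert (L2 := level_decr _ _ _ _ _ HL).
    assert (HG := fun x => step_right F rho (return_time a n) p x HF ltac:(lra)).
    assert (HH := fun x => step_left F rho (return_time a (S n)) p' x HF ltac:(lra)).
    assert (S1 : forall x, step F (return_time a n) p x - x <= eta / 3).
    { intros x; apply Rle_trans with (1 := Rle_abs _), Hn1. }
    assert (S2 : forall x, x - step F (return_time a (S n)) p' x <= eta / 3).
    { intros x; specialize (Hn2 x). rewrite Rabs_left in Hn2 by (specialize (HH x); lra). lra. }
    rewrite Rabs_pos_eq by (specialize (HG y); lra).
    rewrite Rabs_left by (specialize (HH y); lra).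
    split.
    - replace (- (step F (return_time a (S n)) p' y - y))
        with (y - step F (return_time a (S n)) p' y) by ring.
      apply (right_le_left_orbit F rho V v eta); auto.
      apply (right_le_left_critical F rho V v eta _ e); auto.
      apply Rle_lt_trans with (1 := Rle_abs _), Hn1.
    - replace (- (step F (return_time a (S n)) p' y - y))
        with (y - step F (return_time a (S n)) p' y) by ring.
      apply (left_le_right F rho _ _ _ _ _ _ HF HL); [lra|exact C2]. }
  destruct (Nat.Even_or_Odd n) as [Hn|Hn].
  - apply (Main F V rho); auto. apply level_even; assumption.
  - assert (H := Main (reflect F) (reflect V) (- rho) (- numer a n)%Z (- numer a (S n))%Z (- c)
      (irrational_lift_reflect F rho HF) (controlled_reflect F V v eta HV)
      (level_odd rho a n Ha Hn) (comparable_steps_reflect _ _ _ _ C1)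
      (comparable_steps_reflect _ _ _ _ C2) (quadratic_at_reflect F c e Hc)).
    cbv zeta in H. rewrite !return_length_reflect, iter_reflect, !Ropp_involutive in H.
    apply H; intros x; rewrite return_length_reflect; [apply Hn1|apply Hn2].
Qed.

(** * Odd power functions *)

Lemma is_derive_continuity_pt f x l : is_derive f x l -> continuity_pt f x.
Proof.
  intros H; apply derivable_continuous_pt; exists l; apply is_derive_Reals, H.
Qed.

Definition odd_power (delta u : R) : R := u * Rpower (Rabs u) (delta - 1).

Lemma odd_power_pos delta u : 0 < u -> odd_power delta u = Rpower u delta.
Proof.
  intros H; unfold odd_power; rewrite Rabs_pos_eq by lra.
  rewrite <- (Rpower_1 u) at 1 by exact H. rewrite <- Rpower_plus; f_equal; ring.
Qed.

Lemma odd_power_opp delta u : odd_power delta (- u) = - odd_power delta u.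
Proof. unfold odd_power; rewrite Rabs_Ropp; ring. Qed.

Lemma odd_power_0 delta : odd_power delta 0 = 0.
Proof. unfold odd_power; ring. Qed.

Lemma odd_power_1 u : odd_power 1 u = u.
Proof.
  destruct (Req_dec u 0) as [->|H]; [apply odd_power_0|].
  unfold odd_power; rewrite Rminus_diag, Rpower_O; [ring|apply Rabs_pos_lt, H].
Qed.

Lemma Rpower_pos x y : 0 < Rpower x y.
Proof. apply exp_pos. Qed.

Lemma is_derive_odd_power delta u : u <> 0 ->
  is_derive (odd_power delta) u (delta * Rpower (Rabs u) (delta - 1)).
Proof.
  intros Hu.
  assert (Hp : forall x, 0 < x -> is_derive (odd_power delta) x (delta * Rpower x (delta - 1))).
  { intros x Hx. apply is_derive_ext_loc with (fun y => Rpower y delta).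
    - exists (mkposreal x Hx); intros y Hy; symmetry; apply odd_power_pos.
      apply Rabs_lt_between' in Hy; simpl in Hy; lra.
    - apply is_derive_Reals, derivable_pt_lim_power, Hx. }
  destruct (Rlt_le_dec 0 u) as [H|H].
  - rewrite Rabs_pos_eq by lra. apply Hp, H.
  - rewrite Rabs_left by lra.
    apply is_derive_ext with (fun y => - odd_power delta (- y)).
    + intros y; rewrite odd_power_opp, Ropp_involutive; reflexivity.
    + replace (delta * Rpower (- u) (delta - 1))
        with (- (-1 * (delta * Rpower (- u) (delta - 1)))) by ring.
      apply (is_derive_opp (fun y => odd_power delta (- y))).
      apply (is_derive_comp (odd_power delta) Ropp u).
      * apply Hp; lra.
      * auto_derive; [exact I|ring].
Qed.

Lemma odd_power_upper_pos delta u v : 1 <= delta -> 0 <= u -> u <= v -> 0 < v ->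
  odd_power delta v - odd_power delta u <= delta * Rpower v (delta - 1) * (v - u).
Proof.
  intros Hd Hu Huv Hv. assert (P := Rpower_pos v (delta - 1)).
  destruct Hu as [Hu| <-].
  - destruct Huv as [Huv| ->]; [|lra].
    destruct (MVT_gen (odd_power delta) u v
      (fun x => delta * Rpower (Rabs x) (delta - 1))) as [c [Hc E]].
    + intros x Hx. apply is_derive_odd_power. rewrite Rmin_left in Hx by lra. lra.
    + intros x Hx. rewrite Rmin_left in Hx by lra.
      eapply is_derive_continuity_pt, is_derive_odd_power; lra.
    + rewrite Rmin_left, Rmax_right in Hc by lra. rewrite E.
      apply Rmult_le_compat_r; [lra|]. apply Rmult_le_compat_l; [lra|].
      rewrite Rabs_pos_eq by lra. apply Rle_Rpower_l; lra.
  - rewrite odd_power_0. unfold odd_power; rewrite Rabs_pos_eq by lra.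
    assert (0 <= v * Rpower v (delta - 1)) by (apply Rmult_le_pos; lra). nra.
Qed.

Lemma odd_power_upper delta A u v : 1 <= delta -> - A <= u -> u <= v -> v <= A -> 0 < A ->
  odd_power delta v - odd_power delta u <= delta * Rpower A (delta - 1) * (v - u).
Proof.
  intros Hd Hu Huv Hv HA.
  assert (Hpos : forall u v, 0 <= u -> u <= v -> v <= A ->
    odd_power delta v - odd_power delta u <= delta * Rpower A (delta - 1) * (v - u)).
  { clear u v Hu Huv Hv. intros u v Hu Huv Hv.
    destruct (Req_dec v 0) as [->|Hv0]; [replace u with 0 by lra; lra|].
    apply Rle_trans with (1 := odd_power_upper_pos delta u v Hd Hu Huv ltac:(lra)).
    apply Rmult_le_compat_r; [lra|]. apply Rmult_le_compat_l; [lra|].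
    apply Rle_Rpower_l; lra. }
  destruct (Rle_lt_dec 0 u) as [H0|H0]; [apply Hpos; assumption|].
  assert (H1 : forall u, - A <= u -> u < 0 ->
    - odd_power delta u <= delta * Rpower A (delta - 1) * (- u)).
  { intros x Hx Hx0. assert (H := Hpos 0 (- x) ltac:(lra) ltac:(lra) ltac:(lra)).
    rewrite odd_power_0, odd_power_opp in H. lra. }
  destruct (Rle_lt_dec 0 v) as [Hv0|Hv0].
  - assert (A1 := H1 u Hu H0). assert (A2 := Hpos 0 v ltac:(lra) ltac:(lra) ltac:(lra)).
    rewrite odd_power_0 in A2. lra.
  - assert (H := Hpos (- v) (- u) ltac:(lra) ltac:(lra) ltac:(lra)).
    rewrite !odd_power_opp in H. lra.
Qed.

Lemma odd_power_lower delta u w : 1 <= delta -> u < w ->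
  Rpower (Rmax (Rabs u) (Rabs w)) (delta - 1) * (w - u)
    <= 2 * (odd_power delta w - odd_power delta u).
Proof.
  intros Hd Huw.
  (* by symmetry the endpoint of larger modulus may be taken to be [w] *)
  assert (Main : forall u w, u < w -> Rabs u <= w ->
    Rpower w (delta - 1) * (w - u) <= 2 * (odd_power delta w - odd_power delta u)).
  { clear u w Huw. intros u w Huw Hle.
    assert (Hw : 0 < w).
    { destruct (Rabs_pos u) as [|E]; [lra|]. symmetry in E.
      destruct (Req_dec u 0) as [->|N]; [lra|apply Rabs_pos_lt in N; lra]. }
    assert (P := Rpower_pos w (delta - 1)).
    assert (E : odd_power delta w = w * Rpower w (delta - 1))
      by (unfold odd_power; rewrite Rabs_pos_eq by lra; reflexivity).
    destruct (Rle_lt_dec u 0) as [Hu|Hu].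
    - assert (odd_power delta u <= 0).
      { unfold odd_power. assert (Q := Rpower_pos (Rabs u) (delta - 1)). nra. }
      rewrite E. rewrite Rabs_left1 in Hle by lra. nra.
    - rewrite Rabs_pos_eq in Hle by lra.
      assert (Q : Rpower u (delta - 1) <= Rpower w (delta - 1)) by (apply Rle_Rpower_l; lra).
      assert (E' : odd_power delta u = u * Rpower u (delta - 1))
        by (unfold odd_power; rewrite Rabs_pos_eq by lra; reflexivity).
      rewrite E, E'.
      assert (u * Rpower u (delta - 1) <= u * Rpower w (delta - 1))
        by (apply Rmult_le_compat_l; lra). nra. }
  destruct (Rle_lt_dec (Rabs u) (Rabs w)) as [H|H].
  - rewrite Rmax_right by exact H.
    destruct (Rle_lt_dec 0 w) as [Hw|Hw].
    + rewrite (Rabs_pos_eq w) in H |- * by exact Hw. apply Main; assumption.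
    + rewrite (Rabs_left w) in H by exact Hw. rewrite Rabs_left in H by lra. lra.
  - rewrite Rmax_left by lra.
    destruct (Rle_lt_dec 0 u) as [Hu|Hu].
    + rewrite (Rabs_pos_eq u) in H by exact Hu. rewrite Rabs_pos_eq in H by lra. lra.
    + rewrite (Rabs_left u) in H |- * by exact Hu.
      assert (M := Main (- w) (- u) ltac:(lra)). rewrite Rabs_Ropp, !odd_power_opp in M.
      specialize (M ltac:(lra)). lra.
Qed.

(** The endpoint of larger modulus [A] decides: all slopes are at most
    [delta A^(delta-1)], and the mean slope on the whole interval is at least half of
    [A^(delta-1)], wherever the critical point lies. *)
Lemma odd_power_slope delta u w u' v' : 1 <= delta ->
  u < w -> u <= u' -> u' <= v' -> v' <= w ->
  (odd_power delta v' - odd_power delta u') * (w - u)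
    <= 2 * delta * ((odd_power delta w - odd_power delta u) * (v' - u')).
Proof.
  intros Hd Huw H1 H2 H3.
  set (A := Rmax (Rabs u) (Rabs w)).
  assert (HA1 : Rabs u <= A) by apply Rmax_l. assert (HA2 : Rabs w <= A) by apply Rmax_r.
  assert (HA : 0 < A).
  { destruct (Rle_lt_dec A 0); [|assumption].
    assert (Rabs u = 0) by (assert (B := Rabs_pos u); lra).
    assert (Rabs w = 0) by (assert (B := Rabs_pos w); lra).
    assert (u = 0) by (apply Rabs_eq_0; assumption).
    assert (w = 0) by (apply Rabs_eq_0; assumption). lra. }
  apply Rabs_le_between in HA1. apply Rabs_le_between in HA2.
  assert (U := odd_power_upper delta A u' v' Hd ltac:(lra) H2 ltac:(lra) HA).
  assert (L := odd_power_lower delta u w Hd Huw). fold A in L.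
  apply Rle_trans with (delta * Rpower A (delta - 1) * (v' - u') * (w - u)).
  - apply Rmult_le_compat_r; lra.
  - replace (delta * Rpower A (delta - 1) * (v' - u') * (w - u))
      with (delta * (v' - u') * (Rpower A (delta - 1) * (w - u))) by ring.
    replace (2 * delta * ((odd_power delta w - odd_power delta u) * (v' - u')))
      with (delta * (v' - u') * (2 * (odd_power delta w - odd_power delta u))) by ring.
    apply Rmult_le_compat_l; [apply Rmult_le_pos; lra|exact L].
Qed.

Lemma odd_power_scale delta r u : 0 < r -> 
  odd_power delta (r * u) = Rpower r delta * odd_power delta u.
Proof.
  intros Hr. destruct (Req_dec u 0) as [->|Hu].
  - rewrite Rmult_0_r, odd_power_0; ring.
  - rewrite <- (odd_power_pos delta r Hr). unfold odd_power.
    rewrite Rabs_mult, (Rabs_pos_eq r) by lra.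
    rewrite <- Rpower_mult_distr by (try apply Rabs_pos_lt; assumption). ring.
Qed.

Lemma odd_power_le delta u v : 1 <= delta -> u <= v -> odd_power delta u <= odd_power delta v.
Proof.
  intros Hd [H| ->]; [|lra].
  assert (L := odd_power_lower delta u v Hd H).
  assert (0 < Rpower (Rmax (Rabs u) (Rabs v)) (delta - 1)) by apply Rpower_pos. nra.
Qed.

Lemma sinh_superlinear delta s : 1 <= delta -> 0 <= s ->
  delta * (exp s - exp (- s)) <= exp (delta * s) - exp (- (delta * s)).
Proof.
  intros Hd [Hs| <-].
  2:{ rewrite Rmult_0_r, Ropp_0, exp_0; lra. }
  set (g := fun x => exp (delta * x) - exp (- (delta * x)) - delta * (exp x - exp (- x))).
  destruct (MVT_gen g 0 s (fun x =>
     delta * (exp (delta * x) + exp (- (delta * x)) - (exp x + exp (- x))))) as [c [Hc E]].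
  - intros x _. unfold g. auto_derive; [exact I|ring].
  - intros x _. eapply is_derive_continuity_pt. unfold g. auto_derive; [exact I|reflexivity].
  - rewrite Rmin_left, Rmax_right in Hc by lra.
    assert (G0 : g 0 = 0) by (unfold g; rewrite Rmult_0_r, Ropp_0, exp_0; ring).
    rewrite G0 in E. unfold g in E.
    assert (0 <= delta * (exp (delta * c) + exp (- (delta * c)) - (exp c + exp (- c)))).
    { apply Rmult_le_pos; [lra|]. rewrite !exp_Ropp.
      assert (X1 : 1 <= exp c) by (rewrite <- exp_0; destruct (Req_dec c 0) as [->|];
        [lra|left; apply exp_increasing; lra]).
      assert (X2 : exp c <= exp (delta * c)).
      { destruct (Req_dec c (delta * c)) as [<-|]; [lra|left; apply exp_increasing; nra]. }
      set (X := exp c) in *. set (Y := exp (delta * c)) in *.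
      replace (Y + / Y - (X + / X)) with ((Y - X) * (X * Y - 1) / (X * Y)) by (field; lra).
      apply Rdiv_le_0_compat; [apply Rmult_le_pos; nra|nra]. }
    assert (0 <= delta * (exp (delta * c) + exp (- (delta * c)) - (exp c + exp (- c))) * (s - 0))
      by (apply Rmult_le_pos; lra). lra.
Qed.

(** The infinitesimal form of the fact that power functions do not expand
    cross-ratios. With [u = exp (a - s)] and [v = exp (a + s)] it reduces to
    [delta sinh s <= sinh (delta s)]. *)
Lemma odd_power_schwarz delta u v : 1 <= delta -> 0 < u * v -> u <= v ->
  (delta * Rpower (Rabs u) (delta - 1)) * (delta * Rpower (Rabs v) (delta - 1)) * (v - u) ^ 2
    <= (odd_power delta v - odd_power delta u) ^ 2.
Proof.
  intros Hd.
  assert (Main : forall u v, 0 < u -> u <= v ->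
    (delta * Rpower u (delta - 1)) * (delta * Rpower v (delta - 1)) * (v - u) ^ 2
    <= (Rpower v delta - Rpower u delta) ^ 2).
  { clear u v; intros u v Hu Huv.
    set (a := (ln v + ln u) / 2). set (s := (ln v - ln u) / 2).
    assert (Hs : 0 <= s).
    { unfold s. assert (ln u <= ln v); [|lra].
      destruct Huv as [H| ->]; [left; apply ln_increasing; assumption|lra]. }
    assert (Ev : v = exp a * exp s)
      by (rewrite <- exp_plus; unfold a, s; rewrite <- (exp_ln v) at 1 by lra; f_equal; field).
    assert (Eu : u = exp a * exp (- s))
      by (rewrite <- exp_plus; unfold a, s; rewrite <- (exp_ln u) at 1 by lra; f_equal; field).
    assert (Lv : ln v = a + s) by (unfold a, s; field).
    assert (Lu : ln u = a - s) by (unfold a, s; field).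
    assert (Pv : Rpower v delta = exp (delta * a) * exp (delta * s))
      by (unfold Rpower; rewrite Lv, <- exp_plus; f_equal; ring).
    assert (Pu : Rpower u delta = exp (delta * a) * exp (- (delta * s)))
      by (unfold Rpower; rewrite Lu, <- exp_plus; f_equal; ring).
    assert (Puv : Rpower u (delta - 1) * Rpower v (delta - 1) * exp a ^ 2 = exp (delta * a) ^ 2).
    { unfold Rpower; rewrite Lv, Lu. simpl; rewrite !Rmult_1_r, <- !exp_plus; f_equal; ring. }
    replace ((delta * Rpower u (delta - 1)) * (delta * Rpower v (delta - 1)) * (v - u) ^ 2)
      with ((delta * exp (delta * a) * (exp s - exp (- s))) ^ 2).
    2:{ rewrite Eu at 2. rewrite Ev at 2. 
        replace ((delta * exp (delta * a) * (exp s - exp (- s))) ^ 2) with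
          (delta ^ 2 * (exp s - exp (- s)) ^ 2 * exp (delta * a) ^ 2) by ring.
        rewrite <- Puv; ring. }
    rewrite Pu, Pv.
    replace (exp (delta * a) * exp (delta * s) - exp (delta * a) * exp (- (delta * s)))
      with (exp (delta * a) * (exp (delta * s) - exp (- (delta * s)))) by ring.
    assert (S := sinh_superlinear delta s Hd Hs).
    assert (Q : 0 <= exp s - exp (- s)).
    { assert (exp (- s) <= exp s); [|lra].
      destruct Hs as [Hs| <-]; [left; apply exp_increasing; lra|rewrite Ropp_0; lra]. }
    assert (P := exp_pos (delta * a)).
    apply pow_incr; split.
    - apply Rmult_le_pos; [apply Rmult_le_pos; lra|exact Q].
    - replace (delta * exp (delta * a) * (exp s - exp (- s)))
        with (exp (delta * a) * (delta * (exp s - exp (- s)))) by ring.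
      apply Rmult_le_compat_l; lra. }
  intros Huv Hle. destruct (Rlt_le_dec 0 u) as [Hu|Hu].
  - assert (Hv : 0 < v) by lra. rewrite !odd_power_pos, !Rabs_pos_eq by lra. apply Main; lra.
  - assert (Hu' : u < 0) by nra. assert (Hv : v < 0) by nra.
    assert (M := Main (- v) (- u) ltac:(lra) ltac:(lra)).
    rewrite <- (odd_power_pos delta (- u)), <- (odd_power_pos delta (- v)), !odd_power_opp in M by lra.
    rewrite !Rabs_left by lra. lra.
Qed.

(** * Local behaviour of smooth maps *)

Lemma continuous_near (f : R -> R) t eps : continuous f t -> 0 < eps ->
  exists e, 0 < e /\ forall y, Rabs (y - t) < e -> Rabs (f y - f t) < eps.
Proof.
  intros H He.
  destruct (H (fun z => Rabs (z - f t) < eps)) as [e Hy].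
  - exists (mkposreal eps He); intros z Hz; exact Hz.
  - exists e; split; [apply cond_pos|]. intros y Hy'. apply Hy, Hy'.
Qed.

Lemma C3_at_Derive f x : C3_at f x -> is_derive f x (Derive f x).
Proof. intros [H _]; apply Derive_correct, (H 1%nat); lia. Qed.

Lemma mean_value f x y : x < y -> (forall z, x <= z <= y -> ex_derive f z) ->
  exists z, x <= z <= y /\ f y - f x = Derive f z * (y - x).
Proof.
  intros Hxy Hd.
  destruct (MVT_gen f x y (Derive f)) as [z [Hz E]].
  - intros z Hz; rewrite Rmin_left, Rmax_right in Hz by lra.
    apply Derive_correct, Hd; lra.
  - intros z Hz; rewrite Rmin_left, Rmax_right in Hz by lra.
    eapply is_derive_continuity_pt, Derive_correct, Hd; lra.
  - rewrite Rmin_left, Rmax_right in Hz by lra. exists z; auto.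
Qed.

Lemma C3_bounds phi t e0 : 0 < e0 -> (forall y, Rabs (y - t) < e0 -> C3_at phi y) ->
  0 < Derive phi t ->
  exists e M, 0 < e <= e0 /\ e <= 1 / 2 /\ 0 < M /\ forall y, Rabs (y - t) < e ->
    C3_at phi y /\ 3 / 4 * Derive phi t <= Derive phi y <= 5 / 4 * Derive phi t /\
    Rabs (Derive_n phi 3 y) <= M.
Proof.
  intros He0 HC Hm.
  assert (Ht : C3_at phi t) by (apply HC; rewrite Rminus_diag, Rabs_R0; exact He0).
  destruct Ht as [H1 H2].
  assert (Hc1 : continuous (Derive phi) t).
  { apply (ex_derive_continuous (Derive phi)), (H1 2%nat); lia. }
  destruct (continuous_near _ t (Derive phi t / 4) Hc1 ltac:(lra)) as (e1 & He1 & B1).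
  destruct (continuous_near _ t 1 H2 ltac:(lra)) as (e2 & He2 & B2).
  exists (Rmin (Rmin e0 (1 / 2)) (Rmin e1 e2)), (Rabs (Derive_n phi 3 t) + 1).
  assert (A1 := Rmin_l e0 (1 / 2)). assert (A2 := Rmin_r e0 (1 / 2)).
  assert (A3 := Rmin_l e1 e2). assert (A4 := Rmin_r e1 e2).
  assert (A5 := Rmin_l (Rmin e0 (1 / 2)) (Rmin e1 e2)).
  assert (A6 := Rmin_r (Rmin e0 (1 / 2)) (Rmin e1 e2)).
  assert (P := Rabs_pos (Derive_n phi 3 t)).
  repeat split; try lra; try (apply HC; lra).
  - repeat apply Rmin_glb_lt; lra.
  - specialize (B1 y ltac:(lra)). apply Rabs_def2 in B1. lra.
  - specialize (B1 y ltac:(lra)). apply Rabs_def2 in B1. lra.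
  - specialize (B2 y ltac:(lra)). assert (T := Rabs_triang_inv (Derive_n phi 3 y) (Derive_n phi 3 t)). lra.
Qed.

(** The mixed second derivative of [ln ((F y - F x) / (y - x))] is at most [K]; this
    is what controls cross-ratios. *)
Definition schwarz (F : R -> R) (K x y : R) : Prop :=
  Derive F x * Derive F y * (y - x) ^ 2 <= (1 + K * (y - x) ^ 2) * (F y - F x) ^ 2.

(** Both sides have Taylor expansions in [y - x] that agree below order 4. At order 4
    the second derivative contributes only a negative square, so that bounds on the
    first and third derivatives suffice. *)
Lemma C3_schwarz phi m M x y : 0 < m -> 0 < M -> x < y <= x + 1 ->
  (forall z, x <= z <= y -> C3_at phi z /\ 3 / 4 * m <= Derive phi z <= 5 / 4 * m /\
     Rabs (Derive_n phi 3 z) <= M) ->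
  schwarz phi (2 * (2 * m * M + M ^ 2) / m ^ 2) x y.
Proof.
  intros Hm HM Hxy Hz. unfold schwarz.
  destruct (Taylor_Lagrange phi 2 x y) as (z1 & Hz1 & E1); [lra| |].
  { intros z Hin k Hk. apply (Hz z Hin); lia. }
  destruct (Taylor_Lagrange (Derive phi) 1 x y) as (z2 & Hz2 & E2); [lra| |].
  { intros z Hin k Hk. destruct (Hz z Hin) as [[A _] _].
    destruct k as [|[|[|k]]]; [exact I|apply (A 2%nat); lia|apply (A 3%nat); lia|lia]. }
  destruct (Hz x ltac:(lra)) as (_ & Bx & _).
  destruct (Hz z1 ltac:(lra)) as (_ & _ & T1).
  destruct (Hz z2 ltac:(lra)) as (_ & _ & T2).
  destruct (mean_value phi x y) as (z3 & Hz3 & E3); [lra| |].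
  { intros z Hin. eexists; apply C3_at_Derive, Hz, Hin. }
  destruct (Hz z3 ltac:(lra)) as (_ & B3 & _).
  change (Derive_n (Derive phi) 2 z2) with (Derive_n phi 3 z2) in E2.
  simpl sum_f_R0 in E1, E2. simpl Factorial.fact in E1, E2.
  change (Derive (fun z : R => Derive phi z) x) with (Derive_n phi 2 x) in E2.
  change (Derive (fun z : R => Derive (fun z : R => phi z) z) x) with (Derive_n phi 2 x) in E1.
  set (A := Derive phi x) in *. set (B := Derive_n phi 2 x) in *.
  set (t1 := Derive_n phi 3 z1) in *. set (t2 := Derive_n phi 3 z2) in *.
  set (h := y - x) in *. set (S := phi y - phi x) in *.
  assert (ES : S = A * h + B * h ^ 2 / 2 + t1 * h ^ 3 / 6).
  { unfold S; rewrite E1; simpl; field. }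
  assert (ED : Derive phi y = A + B * h + t2 * h ^ 2 / 2).
  { rewrite E2; simpl; field. }
  assert (Hh : 0 < h <= 1) by (unfold h; lra).
  assert (HS : 3 / 4 * m * h <= S <= 5 / 4 * m * h) by (rewrite E3; split; nra).
  apply Rabs_le_between in T1. apply Rabs_le_between in T2.
  rewrite ED.
  set (r := t1 * h ^ 3 / 6).
  assert (Hid : A * (A + B * h + t2 * h ^ 2 / 2) * h ^ 2 =
     S ^ 2 - 2 * S * r + r ^ 2 + A * t2 * h ^ 4 / 2 - B ^ 2 * h ^ 4 / 4).
  { assert (E : A * h + B * h ^ 2 / 2 = S - r) by (rewrite ES; unfold r; ring).
    replace (S ^ 2 - 2 * S * r + r ^ 2) with ((S - r) ^ 2) by ring.
    rewrite <- E; field. }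
  rewrite Hid.
  assert (H3 : 0 < h ^ 3) by (apply pow_lt; lra).
  assert (H4 : 0 < h ^ 4) by (apply pow_lt; lra).
  assert (Hr : - (M * h ^ 3 / 6) <= r <= M * h ^ 3 / 6) by (unfold r; split; nra).
  assert (HSr : - (S * r) <= 5 / 4 * m * M * h ^ 4 / 6).
  { assert (0 <= S) by nra.
    apply Rle_trans with (S * (M * h ^ 3 / 6)); [nra|].
    replace (5 / 4 * m * M * h ^ 4 / 6) with (5 / 4 * m * h * (M * h ^ 3 / 6)) by field.
    apply Rmult_le_compat_r; [|lra]. apply Rmult_le_pos; [nra|lra]. }
  assert (Hr2 : r ^ 2 <= M ^ 2 * h ^ 4 / 36).
  { apply Rle_trans with ((M * h ^ 3 / 6) ^ 2).
    - rewrite <- !Rsqr_pow2. apply Rsqr_le_abs_1.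
      rewrite (Rabs_pos_eq (M * h ^ 3 / 6)) by nra. apply Rabs_le; lra.
    - replace ((M * h ^ 3 / 6) ^ 2) with (M ^ 2 / 36 * h ^ 4 * h ^ 2) by field.
      replace (M ^ 2 * h ^ 4 / 36) with (M ^ 2 / 36 * h ^ 4 * 1) by field.
      apply Rmult_le_compat_l; [|nra].
      apply Rmult_le_pos; [|lra]. assert (0 <= M ^ 2) by apply pow2_ge_0. lra. }
  assert (HA : A * t2 * h ^ 4 / 2 <= 5 / 4 * m * M * h ^ 4 / 2).
  { assert (A * t2 <= 5 / 4 * m * M) by nra.
    apply Rmult_le_compat_r; [lra|]. apply Rmult_le_compat_r; lra. }
  assert (HB : 0 <= B ^ 2 * h ^ 4 / 4).
  { assert (0 <= B ^ 2) by apply pow2_ge_0. nra. }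
  assert (HS2 : m ^ 2 * h ^ 2 <= 2 * S ^ 2).
  { assert ((3 / 4 * m * h) ^ 2 <= S ^ 2) by (apply pow_incr; split; [nra|lra]).
    assert (0 <= m ^ 2 * h ^ 2) by (apply Rmult_le_pos; apply pow2_ge_0). nra. }
  assert (HK : (2 * m * M + M ^ 2) * h ^ 4 <= 2 * (2 * m * M + M ^ 2) / m ^ 2 * h ^ 2 * S ^ 2).
  { replace (2 * (2 * m * M + M ^ 2) / m ^ 2 * h ^ 2 * S ^ 2)
      with ((2 * m * M + M ^ 2) * h ^ 2 / m ^ 2 * (2 * S ^ 2)) by (field; lra).
    replace ((2 * m * M + M ^ 2) * h ^ 4)
      with ((2 * m * M + M ^ 2) * h ^ 2 / m ^ 2 * (m ^ 2 * h ^ 2)) by (field; lra).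
    apply Rmult_le_compat_l; [|exact HS2].
    apply Rdiv_le_0_compat; [|apply pow_lt; lra].
    apply Rmult_le_pos; [nra|apply pow2_ge_0]. }
  assert (Hm4 : 0 <= m * M * h ^ 4) by (apply Rmult_le_pos; [nra|lra]).
  assert (HM4 : 0 <= M ^ 2 * h ^ 4) by (apply Rmult_le_pos; [apply pow2_ge_0|lra]).
  lra.
Qed.

Definition bounded_slopes (F : R -> R) (S u w : R) : Prop :=
  forall u' v', u <= u' -> u' <= v' -> v' <= w ->
    (F v' - F u') * (w - u) <= S * ((F w - F u) * (v' - u')).

Definition critical_free (F : R -> R) (x y : R) : Prop :=
  forall z, x < z < y -> Derive F z <> 0.

Definition tame (F : R -> R) (d K x y : R) : Prop :=
  bounded_slopes F (4 * d) x y /\ (critical_free F x y -> schwarz F K x y).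

Lemma is_derive_power_form F phi delta t e x :
  (forall y, Rabs (y - t) < e -> F y = F t + odd_power delta (phi y)) ->
  Rabs (x - t) < e -> ex_derive phi x -> phi x <> 0 ->
  Derive F x = delta * Rpower (Rabs (phi x)) (delta - 1) * Derive phi x.
Proof.
  intros HF Hx Hd Hne. apply is_derive_unique.
  apply is_derive_ext_loc with (fun y => F t + odd_power delta (phi y)).
  - assert (Hp : 0 < e - Rabs (x - t)) by lra.
    exists (mkposreal _ Hp); intros y Hy. symmetry; apply HF.
    change (Rabs (y - x) < e - Rabs (x - t)) in Hy.
    replace (y - t) with ((y - x) + (x - t)) by ring.
    apply Rle_lt_trans with (1 := Rabs_triang _ _). lra.
  - replace (delta * Rpower (Rabs (phi x)) (delta - 1) * Derive phi x)
      with (0 + Derive phi x * (delta * Rpower (Rabs (phi x)) (delta - 1))) by ring.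
    apply (is_derive_plus (fun _ => F t) (fun y => odd_power delta (phi y)));
      [apply (is_derive_const (F t) x)|].
    apply (is_derive_comp (odd_power delta) phi).
    + apply is_derive_odd_power, Hne.
    + apply Derive_correct, Hd.
Qed.

(** In the coordinate [phi] the map is an odd power, and [phi] is almost affine and
    satisfies [schwarz]. A regular point is the case [delta = 1],
    where [phi] is the map itself; for [delta > 1] the odd power has to be
    applied on one side of its critical point only. *)
Lemma power_form_tame F d t phi delta e0 :
  0 < e0 -> 1 <= delta <= d ->
  (forall y, Rabs (y - t) < e0 -> C3_at phi y) ->
  (forall y, Rabs (y - t) < e0 -> F y = F t + odd_power delta (phi y)) ->
  phi t = 0 -> 0 < Derive phi t -> (delta = 1 \/ Derive F t = 0) ->
  exists e, 0 < e /\ forall x y, t - e < x -> x < y -> y < t + e -> tame F d (/ e) x y.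
Proof.
  intros He0 Hd HC HF Hphi Hm Hcrit.
  destruct (C3_bounds phi t e0 He0 HC Hm) as (e1 & M & He1 & He1' & HM & HB).
  set (m := Derive phi t) in *.
  set (K := 2 * (2 * m * M + M ^ 2) / m ^ 2).
  assert (HK : 0 < K).
  { unfold K. apply Rdiv_lt_0_compat; [|apply pow_lt; lra].
    assert (0 < M ^ 2) by (apply pow_lt; lra). nra. }
  set (e := Rmin e1 (/ K)).
  assert (Hinv : 0 < / K) by (apply Rinv_0_lt_compat, HK).
  assert (He : 0 < e) by (apply Rmin_glb_lt; lra).
  assert (Hee : e <= e1) by apply Rmin_l.
  assert (HeK : K <= / e).
  { rewrite <- (Rinv_inv K). apply Rinv_le_contravar; [exact He|apply Rmin_r]. }
  exists e; split; [exact He|]. intros x y Hx Hxy Hy.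
  assert (Hin : forall z, x <= z <= y -> Rabs (z - t) < e1) by (intros z Hz; apply Rabs_def1; lra).
  assert (Hin0 : forall z, x <= z <= y -> Rabs (z - t) < e0)
    by (intros z Hz; specialize (Hin z Hz); lra).
  assert (Hslope : forall u v, t - e < u -> u <= v -> v < t + e ->
    3 / 4 * m * (v - u) <= phi v - phi u <= 5 / 4 * m * (v - u)).
  { intros u v Hu Huv Hv. destruct Huv as [Huv| ->]; [|lra].
    assert (Hin' : forall z, u <= z <= v -> Rabs (z - t) < e1)
      by (intros z Hz; apply Rabs_def1; lra).
    destruct (mean_value phi u v Huv) as (z & Hz & E).
    { intros z Hz. eexists; apply C3_at_Derive, HB, Hin', Hz. }
    destruct (HB z (Hin' z Hz)) as (_ & B & _). rewrite E.
    split; apply Rmult_le_compat_r; lra. }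
  split.
  - intros u' v' H1 H2 H3.
    rewrite (HF v'), (HF u'), (HF y), (HF x) by (apply Hin0; lra).
    replace (F t + odd_power delta (phi v') - (F t + odd_power delta (phi u')))
      with (odd_power delta (phi v') - odd_power delta (phi u')) by ring.
    replace (F t + odd_power delta (phi y) - (F t + odd_power delta (phi x)))
      with (odd_power delta (phi y) - odd_power delta (phi x)) by ring.
    assert (S1 := Hslope x y Hx ltac:(lra) Hy).
    assert (S2 := Hslope x u' Hx H1 ltac:(lra)).
    assert (S3 := Hslope u' v' ltac:(lra) H2 ltac:(lra)).
    assert (S4 := Hslope v' y ltac:(lra) H3 Hy).
    assert (0 < phi y - phi x) by nra.
    assert (Q := odd_power_slope delta (phi x) (phi y) (phi u') (phi v')
      (proj1 Hd) ltac:(lra) ltac:(nra) ltac:(nra) ltac:(nra)).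
    assert (P1 : 0 <= odd_power delta (phi v') - odd_power delta (phi u')).
    { assert (L := odd_power_le delta (phi u') (phi v') (proj1 Hd) ltac:(nra)). lra. }
    assert (P2 : 0 <= odd_power delta (phi y) - odd_power delta (phi x)).
    { assert (L := odd_power_le delta (phi x) (phi y) (proj1 Hd) ltac:(nra)). lra. }
    set (X := odd_power delta (phi v') - odd_power delta (phi u')) in *.
    set (Y := odd_power delta (phi y) - odd_power delta (phi x)) in *.
    apply Rmult_le_reg_l with (3 / 4 * m); [lra|].
    apply Rle_trans with (X * (phi y - phi x)).
    + replace (3 / 4 * m * (X * (y - x))) with (X * (3 / 4 * m * (y - x))) by ring.
      apply Rmult_le_compat_l; lra.
    + apply Rle_trans with (1 := Q).
      apply Rle_trans with (2 * delta * (Y * (5 / 4 * m * (v' - u')))).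
      * apply Rmult_le_compat_l; [lra|]. apply Rmult_le_compat_l; lra.
      * replace (3 / 4 * m * (4 * d * (Y * (v' - u')))) with (3 * d * (m * Y * (v' - u'))) by field.
        replace (2 * delta * (Y * (5 / 4 * m * (v' - u'))))
          with (5 / 2 * delta * (m * Y * (v' - u'))) by field.
        apply Rmult_le_compat_r; [|lra]. apply Rmult_le_pos; [nra|lra].
  - intros Hfree.
    assert (SP : schwarz phi K x y).
    { apply C3_schwarz; try lra. intros z Hz. apply HB, Hin, Hz. }
    assert (SPe : Derive phi x * Derive phi y * (y - x) ^ 2
       <= (1 + / e * (y - x) ^ 2) * (phi y - phi x) ^ 2).
    { apply Rle_trans with (1 := SP). apply Rmult_le_compat_r; [apply pow2_ge_0|].
      apply Rplus_le_compat_l, Rmult_le_compat_r; [apply pow2_ge_0|exact HeK]. }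
    assert (Hpos : 0 <= 1 + / e * (y - x) ^ 2).
    { assert (0 <= / e * (y - x) ^ 2); [|lra].
      apply Rmult_le_pos; [lra|apply pow2_ge_0]. }
    unfold schwarz.
    destruct Hcrit as [Hcrit|Hcrit].
    + assert (EF : forall z, Rabs (z - t) < e0 -> F z = F t + phi z).
      { intros z Hz; rewrite HF, Hcrit, odd_power_1 by exact Hz; reflexivity. }
      assert (ED : forall z, x <= z <= y -> Derive F z = Derive phi z).
      { intros z Hz. apply is_derive_unique.
        apply is_derive_ext_loc with (fun y => F t + phi y).
        - assert (Hp : 0 < e0 - Rabs (z - t)) by (specialize (Hin0 z Hz); lra).
          exists (mkposreal _ Hp); intros w Hw. symmetry; apply EF.
          change (Rabs (w - z) < e0 - Rabs (z - t)) in Hw.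
          replace (w - t) with ((w - z) + (z - t)) by ring.
          apply Rle_lt_trans with (1 := Rabs_triang _ _). lra.
        - replace (Derive phi z) with (0 + Derive phi z) by ring.
          apply (is_derive_plus (fun _ => F t) phi); [apply (is_derive_const (F t) z)|].
          apply C3_at_Derive, HB, Hin, Hz. }
      rewrite (ED x), (ED y), (EF x), (EF y) by (try apply Hin0; lra).
      replace (F t + phi y - (F t + phi x)) with (phi y - phi x) by ring. exact SPe.
    + destruct (Req_dec (Derive F x) 0) as [E|Nx].
      { rewrite E, !Rmult_0_l. apply Rmult_le_pos; [exact Hpos|apply pow2_ge_0]. }
      destruct (Req_dec (Derive F y) 0) as [E|Ny].
      { rewrite E, Rmult_0_r, Rmult_0_l. apply Rmult_le_pos; [exact Hpos|apply pow2_ge_0]. }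
      assert (Hxt : x <> t) by congruence. assert (Hyt : y <> t) by congruence.
      assert (Hside : ~ (x < t < y)) by (intros Ht; apply (Hfree t Ht Hcrit)).
      assert (Hsign : 0 < phi x * phi y).
      { destruct (Rlt_le_dec x t) as [L|L].
        - assert (A1 := Hslope x t Hx ltac:(lra) ltac:(lra)).
          assert (A2 := Hslope y t ltac:(lra) ltac:(lra) ltac:(lra)).
          rewrite Hphi in A1, A2. assert (0 < m * (t - x)) by (apply Rmult_lt_0_compat; lra).
          assert (0 < m * (t - y)) by (apply Rmult_lt_0_compat; lra). nra.
        - assert (A1 := Hslope t x ltac:(lra) ltac:(lra) ltac:(lra)).
          assert (A2 := Hslope t y ltac:(lra) ltac:(lra) ltac:(lra)).
          rewrite Hphi in A1, A2. assert (0 < m * (x - t)) by (apply Rmult_lt_0_compat; lra).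
          assert (0 < m * (y - t)) by (apply Rmult_lt_0_compat; lra). nra. }
      assert (Hn : phi x <> 0 /\ phi y <> 0) by (split; intros E; rewrite E in Hsign; lra).
      rewrite (is_derive_power_form F phi delta t e0 x), (is_derive_power_form F phi delta t e0 y);
        auto; try (apply Hin0; lra); try (eexists; apply C3_at_Derive, HB, Hin; lra);
        try apply Hn.
      rewrite (HF x), (HF y) by (apply Hin0; lra).
      replace (F t + odd_power delta (phi y) - (F t + odd_power delta (phi x)))
        with (odd_power delta (phi y) - odd_power delta (phi x)) by ring.
      assert (Sxy := Hslope x y Hx ltac:(lra) Hy).
      assert (0 <= m * (y - x)) by (apply Rmult_le_pos; lra).
      assert (Q := odd_power_schwarz delta (phi x) (phi y) (proj1 Hd) Hsign ltac:(lra)).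
      set (a := delta * Rpower (Rabs (phi x)) (delta - 1)) in *.
      set (b := delta * Rpower (Rabs (phi y)) (delta - 1)) in *.
      assert (Hab : 0 <= a * b).
      { unfold a, b. assert (R1 := Rpower_pos (Rabs (phi x)) (delta - 1)).
        assert (R2 := Rpower_pos (Rabs (phi y)) (delta - 1)).
        apply Rmult_le_pos; apply Rmult_le_pos; lra. }
      apply Rle_trans with ((1 + / e * (y - x) ^ 2) * (a * b * (phi y - phi x) ^ 2)).
      * replace (a * Derive phi x * (b * Derive phi y) * (y - x) ^ 2)
          with (a * b * (Derive phi x * Derive phi y * (y - x) ^ 2)) by ring.
        replace ((1 + / e * (y - x) ^ 2) * (a * b * (phi y - phi x) ^ 2))
          with (a * b * ((1 + / e * (y - x) ^ 2) * (phi y - phi x) ^ 2)) by ring.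
        apply Rmult_le_compat_l; assumption.
      * apply Rmult_le_compat_l; assumption.
Qed.

(** With [delta < 2] the increment of [F], of order [h^delta], would exceed the
    bound of order [h^2] that Taylor's formula gives where the derivative
    vanishes. So the contraction at critical points is at least quadratic,
    uniformly over all maps. *)
Lemma criticality_ge_2 F c phi delta e0 :
  0 < e0 -> 1 <= delta -> (forall y, C3_at F y) ->
  (forall y, Rabs (y - c) < e0 -> C3_at phi y) ->
  (forall y, Rabs (y - c) < e0 -> F y = F c + odd_power delta (phi y)) ->
  phi c = 0 -> 0 < Derive phi c -> Derive F c = 0 -> 2 <= delta.
Proof.
  intros He0 Hd HFC HC HF Hphi Hm Hcrit.
  destruct (C3_bounds phi c e0 He0 HC Hm) as (e1 & M & He1 & _ & _ & HB).
  destruct (continuous_near (Derive_n F 2) c 1) as (e2 & He2 & B2); [|lra|].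
  { apply (ex_derive_continuous (Derive_n F 2)), (proj1 (HFC c) 3%nat); lia. }
  set (L := Rabs (Derive_n F 2 c) + 1).
  assert (HL : 0 < L) by (unfold L; assert (P := Rabs_pos (Derive_n F 2 c)); lra).
  set (k := 3 / 4 * Derive phi c). assert (Hk : 0 < k) by (unfold k; lra).
  destruct (Rle_lt_dec 2 delta) as [|Hlt]; [assumption|exfalso].
  assert (Hkd := Rpower_pos k delta).
  (* compare [(k h)^delta <= F (c + h) - F c <= L h^2] *)
  assert (Hh : forall h, 0 < h < Rmin e1 e2 -> Rpower k delta <= L * Rpower h (2 - delta)).
  { intros h Hh. assert (A1 := Rmin_l e1 e2). assert (A2 := Rmin_r e1 e2).
    destruct (Taylor_Lagrange F 1 c (c + h)) as (z & Hz & E); [lra| |].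
    { intros z _ j Hj. apply HFC; lia. }
    simpl sum_f_R0 in E. simpl Factorial.fact in E.
    change (Derive (fun z : R => F z) c) with (Derive F c) in E.
    rewrite Hcrit in E.
    assert (Hz2 : Rabs (Derive_n F 2 z) <= L).
    { specialize (B2 z ltac:(apply Rabs_def1; lra)). unfold L.
      assert (T := Rabs_triang_inv (Derive_n F 2 z) (Derive_n F 2 c)). lra. }
    apply Rabs_le_between in Hz2.
    set (w := Derive_n F 2 z) in *.
    assert (Eup : F (c + h) - F c <= L * h ^ 2).
    { replace (F (c + h) - F c) with (w / 2 * h ^ 2) by (rewrite E; simpl; field).
      apply Rmult_le_compat_r; [apply pow2_ge_0|lra]. }
    destruct (mean_value phi c (c + h)) as (y & Hy & Ey); [lra| |].
    { intros y Hy. eexists; apply C3_at_Derive, HB, Rabs_def1; lra. }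
    destruct (HB y ltac:(apply Rabs_def1; lra)) as (_ & By & _).
    assert (Hphi2 : k * h <= phi (c + h)).
    { rewrite Hphi in Ey. replace (c + h - c) with h in Ey by ring. unfold k. nra. }
    assert (Elow : Rpower k delta * Rpower h delta <= F (c + h) - F c).
    { rewrite (HF (c + h)) by (apply Rabs_def1; lra).
      replace (F c + odd_power delta (phi (c + h)) - F c)
        with (odd_power delta (phi (c + h))) by ring.
      rewrite Rpower_mult_distr by lra.
      rewrite <- odd_power_pos by (apply Rmult_lt_0_compat; lra).
      apply odd_power_le; assumption. }
    assert (Eh : h ^ 2 = Rpower h (2 - delta) * Rpower h delta).
    { rewrite <- Rpower_plus. replace (2 - delta + delta) with (INR 2) by (simpl; ring).
      rewrite Rpower_pow by lra. reflexivity. }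
    rewrite Eh in Eup. apply Rmult_le_reg_r with (Rpower h delta); [apply Rpower_pos|].
    lra. }
  set (q := Rpower k delta / (2 * L)).
  assert (Hq : 0 < q) by (unfold q; apply Rdiv_lt_0_compat; lra).
  set (h := Rmin (Rmin e1 e2 / 2) (Rpower q (/ (2 - delta)))).
  assert (Hr := Rpower_pos q (/ (2 - delta))).
  assert (Hm12 : 0 < Rmin e1 e2) by (apply Rmin_glb_lt; lra).
  assert (Hh0 : 0 < h) by (apply Rmin_glb_lt; lra).
  assert (Hh1 : h < Rmin e1 e2).
  { apply Rle_lt_trans with (Rmin e1 e2 / 2); [apply Rmin_l|lra]. }
  assert (H := Hh h (conj Hh0 Hh1)).
  assert (Hp : Rpower h (2 - delta) <= q).
  { apply Rle_trans with (Rpower (Rpower q (/ (2 - delta))) (2 - delta)).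
    - apply Rle_Rpower_l; [lra|split; [exact Hh0|apply Rmin_r]].
    - rewrite Rpower_mult, Rinv_l, Rpower_1 by lra. lra. }
  assert (L * Rpower h (2 - delta) <= L * q) by (apply Rmult_le_compat_l; lra).
  assert (L * q = Rpower k delta / 2) by (unfold q; field; lra). lra.
Qed.

(** The factor [1/2] in [quadratic_at] leaves room for the distortion of [phi], whose
    slopes vary by at most [5/3]. *)
Lemma power_form_quadratic F c phi delta e0 :
  0 < e0 -> 2 <= delta ->
  (forall y, Rabs (y - c) < e0 -> C3_at phi y) ->
  (forall y, Rabs (y - c) < e0 -> F y = F c + odd_power delta (phi y)) ->
  phi c = 0 -> 0 < Derive phi c ->
  exists e, 0 < e /\ quadratic_at F c e.
Proof.
  intros He0 Hd HC HF Hphi Hm.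
  destruct (C3_bounds phi c e0 He0 HC Hm) as (e & M & He & _ & _ & HB).
  set (m := Derive phi c) in *.
  exists e; split; [apply He|]. intros s t Hs Hst Ht.
  assert (Hslope : forall u v, c - e < u -> u < v -> v < c + e ->
    3 / 4 * m * (v - u) <= phi v - phi u <= 5 / 4 * m * (v - u)).
  { intros u v Hu Huv Hv.
    assert (Hin' : forall z, u <= z <= v -> Rabs (z - c) < e)
      by (intros z Hz; apply Rabs_def1; lra).
    destruct (mean_value phi u v Huv) as (z & Hz & E).
    { intros z Hz. eexists; apply C3_at_Derive, HB, Hin', Hz. }
    destruct (HB z (Hin' z Hz)) as (_ & B & _). rewrite E.
    split; apply Rmult_le_compat_r; lra. }
  set (r := t / (2 * s)).
  assert (Hr : 1 <= r) by (unfold r; apply Rle_div_r; lra).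
  assert (Er : r * s = t / 2) by (unfold r; field; lra).
  assert (Hpow : r ^ 2 <= Rpower r delta).
  { rewrite <- Rpower_pow by lra. simpl INR.
    destruct Hr as [Hr| <-]; [apply Rle_Rpower; lra|].
    unfold Rpower; rewrite ln_1, !Rmult_0_r; lra. }
  assert (A1 := Hslope c (c + t) ltac:(lra) ltac:(lra) ltac:(lra)).
  assert (A2 := Hslope (c - s) c ltac:(lra) ltac:(lra) ltac:(lra)).
  assert (A3 := Hslope c (c + s) ltac:(lra) ltac:(lra) ltac:(lra)).
  assert (A4 := Hslope (c - t) c ltac:(lra) ltac:(lra) ltac:(lra)).
  rewrite Hphi in A1, A2, A3, A4.
  rewrite (HF (c - s)), (HF (c + t)), (HF (c + s)), (HF (c - t)) by (apply Rabs_def1; lra).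
  assert (Main : forall u v, 0 <= u -> r * u <= v ->
     r ^ 2 * odd_power delta u <= odd_power delta v).
  { intros u v Hu Huv.
    assert (0 <= odd_power delta u)
      by (rewrite <- (odd_power_0 delta); apply odd_power_le; lra).
    apply Rle_trans with (Rpower r delta * odd_power delta u);
      [apply Rmult_le_compat_r; assumption|].
    rewrite <- odd_power_scale by lra. apply odd_power_le; lra. }
  assert (Hms : 0 < m * s) by (apply Rmult_lt_0_compat; lra).
  assert (Hmt : r * (5 / 4 * m * s) <= 3 / 4 * m * t).
  { replace (r * (5 / 4 * m * s)) with (5 / 4 * m * (r * s)) by ring. rewrite Er.
    assert (0 < m * t) by (apply Rmult_lt_0_compat; lra). lra. }
  split.
  - assert (H := Main (- phi (c - s)) (phi (c + t)) ltac:(lra)).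
    rewrite odd_power_opp in H.
    assert (r * - phi (c - s) <= r * (5 / 4 * m * s)) by (apply Rmult_le_compat_l; lra).
    specialize (H ltac:(lra)). lra.
  - assert (H := Main (phi (c + s)) (- phi (c - t)) ltac:(lra)).
    rewrite odd_power_opp in H.
    assert (r * phi (c + s) <= r * (5 / 4 * m * s)) by (apply Rmult_le_compat_l; lra).
    specialize (H ltac:(lra)). lra.
Qed.

(** * The cross-ratio inequality for one iterate *)

Lemma Derive_shift F (m : Z) x : degree_one F -> (forall y, ex_derive F y) ->
  Derive F (x + IZR m) = Derive F x.
Proof.
  intros [_ HF] Hd. symmetry. apply is_derive_unique.
  apply is_derive_ext with (fun y => F (y + IZR m) - IZR m).
  - intros y. rewrite (shift_by_integers F 1 HF); simpl; lra.
  - replace (Derive F (x + IZR m)) with (1 * Derive F (x + IZR m) - 0) by ring.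
    apply (is_derive_minus (fun y => F (y + IZR m)) (fun _ => IZR m));
      [|apply (is_derive_const (IZR m) x)].
    apply (is_derive_comp F (fun y => y + IZR m)).
    + apply Derive_correct, Hd.
    + auto_derive; [exact I|ring].
Qed.

Lemma tame_shift F d K (m : Z) x y : degree_one F -> (forall y, ex_derive F y) ->
  tame F d K (x - IZR m) (y - IZR m) -> tame F d K x y.
Proof.
  intros HF Hd [H1 H2].
  assert (E : forall z, F (z - IZR m) = F z - IZR m) by (intros z; apply (iter_shift_minus F 1 m z HF)).
  assert (ED : forall z, Derive F (z - IZR m) = Derive F z).
  { intros z; unfold Rminus; rewrite <- opp_IZR; apply Derive_shift; assumption. }
  split.
  - intros u v Hu Huv Hv.
    specialize (H1 (u - IZR m) (v - IZR m) ltac:(lra) ltac:(lra) ltac:(lra)).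
    rewrite !E in H1. lra.
  - intros Hfree. unfold schwarz in *. rewrite !E, !ED in H2.
    replace (y - IZR m - (x - IZR m)) with (y - x) in H2 by ring.
    replace (F y - IZR m - (F x - IZR m)) with (F y - F x) in H2 by ring.
    apply H2. intros z Hz HD. apply (Hfree (z + IZR m)); [lra|].
    rewrite Derive_shift by assumption. exact HD.
Qed.

Lemma tame_weaken F d K K' x y : K <= K' -> tame F d K x y -> tame F d K' x y.
Proof.
  intros HK [H1 H2]; split; [exact H1|]. intros Hf; specialize (H2 Hf).
  unfold schwarz in *. apply Rle_trans with (1 := H2).
  apply Rmult_le_compat_r; [apply pow2_ge_0|].
  apply Rplus_le_compat_l, Rmult_le_compat_r; [apply pow2_ge_0|exact HK].
Qed.

Lemma uniformly_tame F d : degree_one F -> (forall y, ex_derive F y) ->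
  (forall t, exists e, 0 < e /\
     forall x y, t - e < x -> x < y -> y < t + e -> tame F d (/ e) x y) ->
  exists e, 0 < e /\ forall x y, x < y -> y - x < e -> tame F d (/ e) x y.
Proof.
  intros HF Hd Hloc.
  set (rad := fun t => constructive_indefinite_description _ (Hloc t)).
  assert (Hpos : forall t, 0 < proj1_sig (rad t) / 2).
  { intros t; destruct (proj2_sig (rad t)); lra. }
  destruct (compactness_value_1d 0 1 (fun t => mkposreal _ (Hpos t))) as [e He].
  exists e; split; [apply cond_pos|].
  intros x y Hxy Hyx. destruct (base_Int_part x) as [B1 B2].
  apply tame_shift with (Int_part x); [exact HF|exact Hd|].
  set (m := IZR (Int_part x)) in *.
  destruct (NNPP _ (He (x - m) ltac:(lra))) as (t & _ & Ht & Het); simpl in Ht, Het.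
  destruct (proj2_sig (rad t)) as [P Q]. set (r := proj1_sig (rad t)) in *.
  apply Rabs_def2 in Ht.
  apply tame_weaken with (/ r).
  - apply Rinv_le_contravar; [apply cond_pos|lra].
  - apply Q; lra.
Qed.

Lemma cross_ratio_slopes F S a b c d :
  (forall x y, x < y -> F x < F y) -> 0 <= S -> a < b -> b < c -> c < d ->
  bounded_slopes F S a c -> bounded_slopes F S b d ->
  cross_ratio (F a) (F b) (F c) (F d) <= S ^ 2 * cross_ratio a b c d.
Proof.
  intros HF HS Hab Hbc Hcd H1 H2.
  assert (Fab := HF _ _ Hab). assert (Fbc := HF _ _ Hbc). assert (Fcd := HF _ _ Hcd).
  specialize (H1 a b ltac:(lra) ltac:(lra) ltac:(lra)).
  specialize (H2 c d ltac:(lra) ltac:(lra) ltac:(lra)).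
  unfold cross_ratio.
  assert (P : 0 < (F c - F a) * (F d - F b)) by (apply Rmult_lt_0_compat; lra).
  assert (Q : 0 < (c - a) * (d - b)) by (apply Rmult_lt_0_compat; lra).
  apply Rle_div_l; [exact P|].
  replace (S ^ 2 * ((b - a) * (d - c) / ((c - a) * (d - b))) * ((F c - F a) * (F d - F b)))
    with ((S * ((F c - F a) * (b - a))) * (S * ((F d - F b) * (d - c))) / ((c - a) * (d - b)))
    by (field; lra).
  apply (proj1 (Rle_div_r _ _ _ Q)).
  replace ((F b - F a) * (F d - F c) * ((c - a) * (d - b)))
    with (((F b - F a) * (c - a)) * ((F d - F c) * (d - b))) by ring.
  apply Rmult_le_compat; try assumption; apply Rmult_le_pos; lra.
Qed.

(** With [L x y = ln ((F y - F x) / (y - x))], the difference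
    [L a c + L b d - L b c - L a d] compares the quantities
    [- ln (1 - cross_ratio)] before and after [F]; two applications of the mean
    value theorem express it by the mixed derivative of [L]. *)
Lemma cross_ratio_schwarz F K a b c d :
  (forall x y, x < y -> F x < F y) -> (forall x, ex_derive F x) -> 0 <= K ->
  a < b -> b < c -> c < d ->
  (forall x y, a <= x <= b -> c <= y <= d -> schwarz F K x y) ->
  cross_ratio (F a) (F b) (F c) (F d) <= (1 + K * (d - a) ^ 2) * cross_ratio a b c d.
Proof.
  intros HF Hd HK Hab Hbc Hcd HS.
  assert (HD : forall x, is_derive F x (Derive F x)) by (intros x; apply Derive_correct, Hd).
  set (L := fun x y => ln (F y - F x) - ln (y - x)).
  set (Lx := fun x y => - Derive F x / (F y - F x) + / (y - x)).
  assert (HLx : forall x y, x < y -> is_derive (fun x => L x y) x (Lx x y)).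
  { intros x y Hxy. assert (Fxy := HF _ _ Hxy). unfold L, Lx.
    auto_derive.
    - repeat split; try lra. apply Hd.
    - change (Derive (fun z : R => F z) x) with (Derive F x). field; lra. }
  assert (HLxy : forall x y, x < y -> is_derive (fun y => Lx x y) y
     (Derive F x * Derive F y / (F y - F x) ^ 2 - / (y - x) ^ 2)).
  { intros x y Hxy. assert (Fxy := HF _ _ Hxy). unfold Lx.
    auto_derive.
    - repeat split; try lra. apply Hd.
    - change (Derive (fun z : R => F z) y) with (Derive F y). field; lra. }
  destruct (MVT_gen (fun x => L x d - L x c) a b (fun x => Lx x d - Lx x c)) as [x [Hx Ex]].
  { intros x Hx. rewrite Rmin_left, Rmax_right in Hx by lra.
    apply (is_derive_minus (fun x => L x d) (fun x => L x c)); apply HLx; lra. }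
  { intros x Hx. rewrite Rmin_left, Rmax_right in Hx by lra.
    apply is_derive_continuity_pt with (Lx x d - Lx x c).
    apply (is_derive_minus (fun x => L x d) (fun x => L x c)); apply HLx; lra. }
  rewrite Rmin_left, Rmax_right in Hx by lra.
  destruct (MVT_gen (fun y => Lx x y) c d
    (fun y => Derive F x * Derive F y / (F y - F x) ^ 2 - / (y - x) ^ 2)) as [y [Hy Ey]].
  { intros y Hy. rewrite Rmin_left, Rmax_right in Hy by lra. apply HLxy; lra. }
  { intros y Hy. rewrite Rmin_left, Rmax_right in Hy by lra.
    eapply is_derive_continuity_pt, HLxy; lra. }
  rewrite Rmin_left, Rmax_right in Hy by lra.
  assert (Fxy := HF x y ltac:(lra)).
  assert (HK2 : Derive F x * Derive F y / (F y - F x) ^ 2 - / (y - x) ^ 2 <= K).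
  { assert (S := HS x y Hx Hy). unfold schwarz in S.
    assert (P : 0 < (F y - F x) ^ 2) by (apply pow_lt; lra).
    assert (Q : 0 < (y - x) ^ 2) by (apply pow_lt; lra).
    assert (Derive F x * Derive F y / (F y - F x) ^ 2 <= K + / (y - x) ^ 2); [|lra].
    apply Rle_div_l; [exact P|].
    apply Rmult_le_reg_r with ((y - x) ^ 2); [exact Q|].
    apply Rle_trans with (1 := S). right; field. lra. }
  cbv beta in Ex, Ey. rewrite Ey in Ex.
  set (eps := K * ((b - a) * (d - c))).
  assert (Heps : L b d - L b c - (L a d - L a c) <= eps).
  { rewrite Ex. unfold eps. rewrite (Rmult_comm (b - a)), <- Rmult_assoc.
    apply Rmult_le_compat_r; [lra|]. apply Rmult_le_compat_r; lra. }
  assert (Fab := HF _ _ Hab). assert (Fbc := HF _ _ Hbc). assert (Fcd := HF _ _ Hcd).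
  (* [ln Q' <= ln Q + eps], where [1/Q] and [1/Q'] are 1 minus the cross-ratios *)
  set (Q := (d - b) * (c - a) / ((c - b) * (d - a))).
  set (Q' := (F d - F b) * (F c - F a) / ((F c - F b) * (F d - F a))).
  assert (HQ : 0 < Q) by (apply Rdiv_lt_0_compat; apply Rmult_lt_0_compat; lra).
  assert (HQ' : 0 < Q') by (apply Rdiv_lt_0_compat; apply Rmult_lt_0_compat; lra).
  assert (HlnQ : ln Q = ln (d - b) + ln (c - a) - (ln (c - b) + ln (d - a))).
  { unfold Q, Rdiv. rewrite ln_mult, ln_Rinv, !ln_mult; try lra;
      try (apply Rinv_0_lt_compat); try (apply Rmult_lt_0_compat; lra). }
  assert (HlnQ' : ln Q' = ln (F d - F b) + ln (F c - F a) - (ln (F c - F b) + ln (F d - F a))).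
  { unfold Q', Rdiv. rewrite ln_mult, ln_Rinv, !ln_mult; try lra;
      try (apply Rinv_0_lt_compat); try (apply Rmult_lt_0_compat; lra). }
  assert (Hln : ln Q' <= ln Q + eps) by (unfold L in Heps; lra).
  assert (Hexp : Q' <= Q * exp eps).
  { rewrite <- (exp_ln Q') by exact HQ'. rewrite <- (exp_ln Q) at 1 by exact HQ.
    rewrite <- exp_plus. destruct Hln as [Hln|Hln]; [left; apply exp_increasing, Hln|right; f_equal; exact Hln]. }
  assert (E1 : cross_ratio a b c d = 1 - / Q) by (unfold cross_ratio, Q; field; lra).
  assert (E1' : cross_ratio (F a) (F b) (F c) (F d) = 1 - / Q')
    by (unfold cross_ratio, Q'; field; lra).
  assert (Hinv : exp (- eps) * / Q <= / Q').
  { rewrite exp_Ropp, <- Rinv_mult. apply Rinv_le_contravar; [exact HQ'|lra]. }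
  assert (He := exp_ineq1_le (- eps)).
  assert (Hcr := cross_ratio_pos a b c d Hab Hbc Hcd).
  assert (HiQ : 0 < / Q) by (apply Rinv_0_lt_compat, HQ).
  assert (Heps0 : 0 <= eps) by (unfold eps; apply Rmult_le_pos; [lra|apply Rmult_le_pos; lra]).
  assert (Hstep : cross_ratio (F a) (F b) (F c) (F d) <= cross_ratio a b c d + eps).
  { rewrite E1, E1' in *. assert ((1 + - eps) * / Q <= exp (- eps) * / Q)
      by (apply Rmult_le_compat_r; lra). nra. }
  apply Rle_trans with (1 := Hstep).
  assert (Eeps : eps = K * ((c - a) * (d - b)) * cross_ratio a b c d)
    by (unfold eps, cross_ratio; field; lra).
  rewrite Eeps.
  assert (K * ((c - a) * (d - b)) * cross_ratio a b c d <= K * (d - a) ^ 2 * cross_ratio a b c d).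
  { apply Rmult_le_compat_r; [lra|]. apply Rmult_le_compat_l; [lra|].
    replace ((d - a) ^ 2) with ((d - a) * (d - a)) by ring. apply Rmult_le_compat; lra. }
  lra.
Qed.

(** * Weights that count critical points *)

(** [IZR (up (x - c))] jumps by 1 at the points congruent to [c] modulo 1, so the
    second term counts the critical points in an arc; the first one measures its length. *)
Definition crit_weight (lam kap : R) (l : list R) (x : R) : R :=
  lam * x + kap * fold_right (fun c s => IZR (up (x - c)) + s) 0 l.

Lemma up_mono x y : x <= y -> IZR (up x) <= IZR (up y).
Proof.
  intros H. destruct (archimed x) as [X1 X2]. destruct (archimed y) as [Y1 Y2].
  apply IZR_le. assert (IZR (up x) < IZR (up y + 1)) by (rewrite plus_IZR; lra).
  apply lt_IZR in H0. lia.
Qed.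

Lemma up_plus_1 x : IZR (up (x + 1)) = IZR (up x) + 1.
Proof.
  rewrite <- plus_IZR; f_equal. symmetry; apply tech_up.
  - rewrite plus_IZR. destruct (archimed x); lra.
  - rewrite plus_IZR. destruct (archimed x); lra.
Qed.

Lemma crit_weight_increment lam kap l a d : 0 <= kap -> a <= d ->
  lam * (d - a) <= crit_weight lam kap l d - crit_weight lam kap l a.
Proof.
  intros Hk Had. unfold crit_weight.
  assert (H : fold_right (fun c s => IZR (up (a - c)) + s) 0 l
           <= fold_right (fun c s => IZR (up (d - c)) + s) 0 l).
  { induction l as [|c l IH]; simpl; [lra|].
    assert (U := up_mono (a - c) (d - c) ltac:(lra)). lra. }
  assert (kap * fold_right (fun c s => IZR (up (a - c)) + s) 0 l
       <= kap * fold_right (fun c s => IZR (up (d - c)) + s) 0 l)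
    by (apply Rmult_le_compat_l; assumption). lra.
Qed.

Lemma crit_weight_critical lam kap l a d c (m : Z) : 0 <= kap ->
  In c l -> a < c + IZR m < d ->
  kap + lam * (d - a) <= crit_weight lam kap l d - crit_weight lam kap l a.
Proof.
  intros Hk Hin Hc. unfold crit_weight.
  assert (H : fold_right (fun c s => IZR (up (a - c)) + s) 0 l + 1
           <= fold_right (fun c s => IZR (up (d - c)) + s) 0 l).
  { induction l as [|c' l IH]; simpl; [destruct Hin|].
    assert (U := up_mono (a - c') (d - c') ltac:(lra)).
    destruct Hin as [->|Hin].
    - assert (H : fold_right (fun c s => IZR (up (a - c)) + s) 0 l
           <= fold_right (fun c s => IZR (up (d - c)) + s) 0 l).
      { clear IH. induction l as [|c'' l IH]; simpl; [lra|].
        assert (U' := up_mono (a - c'') (d - c'') ltac:(lra)). lra. }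
      assert (IZR (up (a - c)) + 1 <= IZR (up (d - c))); [|lra].
      destruct (archimed (a - c)) as [X1 X2]. destruct (archimed (d - c)) as [Y1 Y2].
      assert (A1 : IZR (up (a - c)) < IZR (m + 1)) by (rewrite plus_IZR; lra).
      assert (A2 : IZR m < IZR (up (d - c))) by lra.
      apply lt_IZR in A1. apply lt_IZR in A2.
      rewrite <- plus_IZR. apply IZR_le. lia.
    - specialize (IH Hin). lra. }
  assert (kap * (fold_right (fun c s => IZR (up (a - c)) + s) 0 l + 1)
       <= kap * fold_right (fun c s => IZR (up (d - c)) + s) 0 l)
    by (apply Rmult_le_compat_l; assumption). lra.
Qed.

Lemma crit_weight_shift lam kap l x :
  crit_weight lam kap l (x + 1) = crit_weight lam kap l x + (lam + kap * INR (length l)).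
Proof.
  unfold crit_weight.
  assert (H : fold_right (fun c s => IZR (up (x + 1 - c)) + s) 0 l
           = fold_right (fun c s => IZR (up (x - c)) + s) 0 l + INR (length l)).
  { induction l as [|c l IH]; [simpl; ring|].
    change (length (c :: l)) with (S (length l)). rewrite S_INR. simpl fold_right.
    rewrite IH. replace (x + 1 - c) with (x - c + 1) by ring. rewrite up_plus_1. ring. }
  rewrite H; ring.
Qed.

Lemma crit_weight_nondecreasing lam kap l : 0 <= lam -> 0 <= kap ->
  nondecreasing (crit_weight lam kap l).
Proof.
  intros Hl Hk x y Hxy. assert (H := crit_weight_increment lam kap l x y Hk Hxy).
  assert (0 <= lam * (y - x)) by (apply Rmult_le_pos; lra). lra.
Qed.

Lemma exp_le x y : x <= y -> exp x <= exp y.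
Proof. intros [H| ->]; [left; apply exp_increasing, H|lra]. Qed.

(** A small arc either contains a critical point, which costs the factor [(4 d)^2], or
    its distortion is quadratic in its length, hence at most its length if [e] bounds it. *)
Lemma one_step_small F d e lam l p0 p1 p2 p3 :
  degree_one F -> (forall y, ex_derive F y) -> 1 <= d -> 0 < e -> 1 <= lam ->
  (forall x y, x < y -> y - x < e -> tame F d (/ e) x y) ->
  (forall z, Derive F z = 0 -> exists c (m : Z), In c l /\ z = c + IZR m) ->
  p0 < p1 -> p1 < p2 -> p2 < p3 -> p3 - p0 < e ->
  let V := crit_weight lam (2 * ln (4 * d)) l in
  cross_ratio (F p0) (F p1) (F p2) (F p3) <= exp (V p3 - V p0) * cross_ratio p0 p1 p2 p3.
Proof.
  intros HF Hd Hd1 He Hlam Ht Hl H01 H12 H23 Hsz V.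
  assert (Hcr := cross_ratio_pos p0 p1 p2 p3 H01 H12 H23).
  assert (Hln : 0 < ln (4 * d)) by (rewrite <- ln_1; apply ln_increasing; lra).
  destruct (classic (critical_free F p0 p3)) as [Hfree|Hcrit].
  - assert (Hinv : 0 < / e) by (apply Rinv_0_lt_compat, He).
    apply Rle_trans with ((1 + / e * (p3 - p0) ^ 2) * cross_ratio p0 p1 p2 p3).
    + apply cross_ratio_schwarz; auto; try lra; [apply HF|].
      intros x y Hx Hy. apply (Ht x y); try lra.
      intros z Hz; apply Hfree; lra.
    + apply Rmult_le_compat_r; [lra|].
      apply Rle_trans with (1 := exp_ineq1_le _). apply exp_le.
      assert (HV := crit_weight_increment lam (2 * ln (4 * d)) l p0 p3 ltac:(lra) ltac:(lra)).
      fold V in HV. apply Rle_trans with (2 := HV).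
      replace (/ e * (p3 - p0) ^ 2) with (/ e * (p3 - p0) * (p3 - p0)) by ring.
      apply Rmult_le_compat_r; [lra|].
      apply Rle_trans with (/ e * e); [apply Rmult_le_compat_l; lra|].
      rewrite Rinv_l by lra. exact Hlam.
  - apply Rle_trans with ((4 * d) ^ 2 * cross_ratio p0 p1 p2 p3).
    + apply cross_ratio_slopes; auto; try lra; [apply HF| |]; apply Ht; lra.
    + apply Rmult_le_compat_r; [lra|].
      apply not_all_ex_not in Hcrit. destruct Hcrit as [z Hz].
      apply imply_to_and in Hz. destruct Hz as [Hz HD]. apply NNPP in HD.
      destruct (Hl z HD) as (c & m & Hin & ->).
      assert (HV := crit_weight_critical lam (2 * ln (4 * d)) l p0 p3 c m ltac:(lra) Hin Hz).
      fold V in HV.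
      replace ((4 * d) ^ 2) with (exp (2 * ln (4 * d))).
      * apply exp_le. assert (0 <= lam * (p3 - p0)) by (apply Rmult_le_pos; lra). lra.
      * replace (2 * ln (4 * d)) with (ln (4 * d) + ln (4 * d)) by ring.
        rewrite exp_plus, exp_ln by lra. ring.
Qed.

(** The linear part of the weight is taken large enough to give the same total for any
    number of critical points up to [N]. *)
Definition universal_weight (N : nat) (d : R) : R := 1 + 2 * ln (4 * d) * INR N.

Lemma controlled_small F d e l N :
  degree_one F -> (forall y, ex_derive F y) -> 1 <= d -> 0 < e ->
  (forall x y, x < y -> y - x < e -> tame F d (/ e) x y) ->
  (forall z, Derive F z = 0 -> exists c (m : Z), In c l /\ z = c + IZR m) ->
  (length l <= N)%nat ->
  exists V, controlled F V (universal_weight N d) (e / 2).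
Proof.
  intros HF Hd Hd1 He Ht Hl HN.
  assert (Hln : 0 < ln (4 * d)) by (rewrite <- ln_1; apply ln_increasing; lra).
  apply le_INR in HN.
  set (lam := 1 + 2 * ln (4 * d) * (INR N - INR (length l))).
  assert (Hlam : 1 <= lam).
  { unfold lam. assert (0 <= 2 * ln (4 * d) * (INR N - INR (length l)))
      by (apply Rmult_le_pos; lra). lra. }
  exists (crit_weight lam (2 * ln (4 * d)) l). split; [|split].
  - apply crit_weight_nondecreasing; lra.
  - intros x. rewrite crit_weight_shift. unfold universal_weight, lam. ring.
  - intros p0 p1 p2 p3 H01 H12 H23 Hsz. apply (one_step_small F d e lam l); auto; lra.
Qed.

Lemma continuous_of_C3 F : (forall x, C3_at F x) -> continuity F.
Proof. intros H x; eapply is_derive_continuity_pt, C3_at_Derive, H. Qed.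

Lemma derivative_bounded F : degree_one F -> (forall x, C3_at F x) ->
  exists M, 0 < M /\ forall x, Derive F x <= M.
Proof.
  intros HF HC.
  assert (Hd : forall x, ex_derive F x) by (intros x; eexists; apply C3_at_Derive, HC).
  destruct (continuity_ab_maj (Derive F) 0 1) as [z [Hz _]]; [lra| |].
  { intros c _. apply is_derive_continuity_pt with (Derive (Derive F) c).
    apply Derive_correct, (proj1 (HC c) 2%nat); lia. }
  exists (Rabs (Derive F z) + 1). split; [assert (P := Rabs_pos (Derive F z)); lra|].
  intros x. destruct (base_Int_part x) as [B1 B2].
  replace x with ((x - IZR (Int_part x)) + IZR (Int_part x)) by ring.
  rewrite Derive_shift by assumption.
  specialize (Hz (x - IZR (Int_part x)) ltac:(lra)).
  assert (A := Rle_abs (Derive F z)). lra.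
Qed.

Lemma increment_bounded_below F h : degree_one F -> continuity F -> 0 < h ->
  exists mu, 0 < mu /\ forall u w, h <= w - u -> mu <= F w - F u.
Proof.
  intros HF HC Hh.
  destruct (continuity_ab_min (fun x => F (x + h) - F x) 0 1) as [z [Hz _]]; [lra| |].
  { intros c _. apply continuity_pt_minus; [|apply HC].
    apply (continuity_pt_comp (fun x => x + h) F); [|apply HC].
    apply continuity_pt_plus; [apply continuity_pt_id|].
    apply continuity_pt_const; intros ? ?; reflexivity. }
  exists (F (z + h) - F z). split; [assert (A := proj1 HF z (z + h) ltac:(lra)); lra|].
  intros u w Huw. destruct (base_Int_part u) as [B1 B2].
  set (m := Int_part u) in *.
  specialize (Hz (u - IZR m) ltac:(lra)). cbv beta in Hz.
  assert (E : forall x, F (x - IZR m) = F x - IZR m) by (intros x; apply (iter_shift_minus F 1 m x HF)).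
  replace (u - IZR m + h) with ((u + h) - IZR m) in Hz by ring. rewrite !E in Hz.
  assert (F (u + h) <= F w).
  { destruct (Req_dec (u + h) w) as [<-|N]; [lra|left; apply HF; lra]. }
  lra.
Qed.

(** Without uniformity in [F], arcs of any length up to 3 are allowed: those of
    definite length distort cross-ratios by a bounded factor, which the linear part of
    the weight absorbs. *)
Lemma controlled_large F d e l :
  degree_one F -> (forall x, C3_at F x) -> 1 <= d -> 0 < e ->
  (forall x y, x < y -> y - x < e -> tame F d (/ e) x y) ->
  (forall z, Derive F z = 0 -> exists c (m : Z), In c l /\ z = c + IZR m) ->
  exists V v, controlled F V v 3.
Proof.
  intros HF HC Hd1 He Ht Hl.
  assert (Hd : forall x, ex_derive F x) by (intros x; eexists; apply C3_at_Derive, HC).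
  destruct (derivative_bounded F HF HC) as (M & HM & HDM).
  destruct (increment_bounded_below F e HF (continuous_of_C3 F HC) He) as (mu & Hmu & Hinc).
  set (S := Rmax (4 * d) (3 * M / mu)).
  assert (S1 : 4 * d <= S) by apply Rmax_l. assert (S2 : 3 * M / mu <= S) by apply Rmax_r.
  assert (Hslopes : forall u w, u < w -> w - u <= 3 -> bounded_slopes F S u w).
  { intros u w Huw H3 u' v' Hu' Hv' Hw'.
    assert (F1 : forall x y, x <= y -> 0 <= F y - F x).
    { intros x y [H| ->]; [assert (A := proj1 HF x y H)|]; lra. }
    assert (P1 := F1 u w ltac:(lra)). assert (P2 := F1 u' v' Hv').
    destruct (Rlt_le_dec (w - u) e) as [H|H].
    - apply Rle_trans with (1 := proj1 (Ht u w Huw H) u' v' Hu' Hv' Hw').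
      apply Rmult_le_compat_r; [apply Rmult_le_pos; lra|exact S1].
    - assert (HL : F v' - F u' <= M * (v' - u')).
      { destruct Hv' as [Hv'| ->]; [|lra].
        destruct (mean_value F u' v' Hv' (fun z _ => Hd z)) as (z & _ & E). rewrite E.
        apply Rmult_le_compat_r; [lra|apply HDM]. }
      apply Rle_trans with (M * (v' - u') * 3).
      + apply Rmult_le_compat; lra.
      + apply Rle_trans with (3 * M / mu * (mu * (v' - u'))); [right; field; lra|].
        apply Rle_trans with (S * (mu * (v' - u'))).
        * apply Rmult_le_compat_r; [apply Rmult_le_pos; lra|exact S2].
        * apply Rmult_le_compat_l; [lra|]. apply Rmult_le_compat_r; [lra|]. apply Hinc, H. }
  assert (HlnS : 0 < ln S) by (rewrite <- ln_1; apply ln_increasing; lra).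
  assert (Hln : 0 < ln (4 * d)) by (rewrite <- ln_1; apply ln_increasing; lra).
  set (lam := 1 + 2 * ln S / e).
  assert (Hlam : 1 <= lam).
  { unfold lam. assert (0 < 2 * ln S / e) by (apply Rdiv_lt_0_compat; lra). lra. }
  set (V := crit_weight lam (2 * ln (4 * d)) l).
  exists V, (lam + 2 * ln (4 * d) * INR (length l)). split; [|split].
  - apply crit_weight_nondecreasing; lra.
  - intros x. apply crit_weight_shift.
  - intros p0 p1 p2 p3 H01 H12 H23 Hsz.
    destruct (Rlt_le_dec (p3 - p0) e) as [H|H].
    + apply (one_step_small F d e lam l); auto.
    + assert (Hcr := cross_ratio_pos p0 p1 p2 p3 H01 H12 H23).
      apply Rle_trans with (S ^ 2 * cross_ratio p0 p1 p2 p3).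
      * apply cross_ratio_slopes; auto; try lra; [apply HF| |]; apply Hslopes; lra.
      * apply Rmult_le_compat_r; [lra|].
        replace (S ^ 2) with (exp (2 * ln S)).
        2:{ replace (2 * ln S) with (ln S + ln S) by ring. rewrite exp_plus, exp_ln by lra. ring. }
        apply exp_le.
        assert (HV := crit_weight_increment lam (2 * ln (4 * d)) l p0 p3 ltac:(lra) ltac:(lra)).
        fold V in HV. apply Rle_trans with (2 := HV).
        apply Rle_trans with (2 * ln S / e * e); [right; field; lra|].
        unfold lam. assert (0 < 2 * ln S / e) by (apply Rdiv_lt_0_compat; lra).
        apply Rmult_le_compat; lra.
Qed.

(** * The circle and its covering *)

Lemma S1_ext (x y : S1) : coord x = coord y -> x = y.
Proof.
  destruct x as [x Hx], y as [y Hy]; simpl; intros ->.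
  f_equal; apply proof_irrelevance.
Qed.

Lemma frac_part_unique x (m : Z) r : 0 <= r < 1 -> x = IZR m + r -> frac_part x = r.
Proof. intros Hr Hx; symmetry; apply (Int_part_frac_part_spec x m r Hr Hx). Qed.

Lemma proj_shift x (m : Z) : proj (x + IZR m) = proj x.
Proof.
  apply S1_ext; simpl. destruct (frac_part_range x) as [A B].
  apply (frac_part_unique _ (Int_part x + m)); [lra|].
  rewrite plus_IZR. assert (E := Rplus_Int_part_frac_part x). lra.
Qed.

Lemma proj_eq x y : proj x = proj y -> exists m : Z, x = y + IZR m.
Proof.
  intros H. apply (f_equal coord) in H; simpl in H.
  exists (Int_part x - Int_part y)%Z. rewrite minus_IZR.
  assert (E := Rplus_Int_part_frac_part x). assert (E' := Rplus_Int_part_frac_part y). lra.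
Qed.

Lemma proj_coord c : proj (coord c) = c.
Proof.
  apply S1_ext; simpl. destruct c as [c Hc]; simpl.
  apply (frac_part_unique _ 0); [exact Hc|simpl; ring].
Qed.

Lemma proj_rep (y : S1) u : exists w, u <= w < u + 1 /\ proj w = y.
Proof.
  set (m := Int_part (coord y - u)).
  destruct (base_Int_part (coord y - u)) as [B1 B2]; fold m in B1, B2.
  exists (coord y - IZR m); split; [lra|].
  unfold Rminus; rewrite <- opp_IZR, proj_shift; apply proj_coord.
Qed.

Lemma ccw_dist_proj u w : u <= w < u + 1 -> ccw_dist (proj u) (proj w) = w - u.
Proof.
  intros H. unfold ccw_dist; simpl.
  apply (frac_part_unique _ (Int_part u - Int_part w)); [lra|].
  rewrite minus_IZR.
  assert (E := Rplus_Int_part_frac_part u). assert (E' := Rplus_Int_part_frac_part w). lra.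
Qed.

Lemma in_arc_proj u v w : u <= v < u + 1 -> u <= w < u + 1 ->
  in_arc (Arc (proj u) (proj v)) (proj w) <-> w <= v.
Proof.
  intros Hv Hw. unfold in_arc, arc_length; simpl.
  rewrite !ccw_dist_proj by assumption. lra.
Qed.

(** The length of an arc being less than 1, it omits some point of the circle; its
    endpoints can then be read off from the set of its points. *)
Lemma arc_ext K u v : u <= v < u + 1 ->
  (forall y, in_arc K y <-> in_arc (Arc (proj u) (proj v)) y) ->
  src K = proj u /\ tgt K = proj v.
Proof.
  intros Huv Hset. destruct K as [a b]; simpl.
  destruct (proj_rep a u) as (s & Hs & <-).
  destruct (proj_rep b s) as (t & Hst & <-).
  assert (HK : forall w, s <= w < s + 1 -> (w <= t <-> in_arc (Arc (proj u) (proj v)) (proj w))).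
  { intros w Hw. rewrite <- Hset. symmetry; apply in_arc_proj; lra. }
  assert (Hsv : s <= v).
  { apply (in_arc_proj u v s Huv Hs). apply HK; lra. }
  assert (Esu : s = u).
  { apply Rle_antisym; [|lra]. apply Rnot_lt_le; intros Hus.
    (* otherwise the first arc would cover the whole gap from [v] to [u + 1] *)
    assert (H1 : u + 1 <= t).
    { apply HK; [lra|]. replace (u + 1) with (u + IZR 1) by (simpl; ring).
      rewrite proj_shift. apply in_arc_proj; lra. }
    assert (H2 := proj1 (HK ((v + (u + 1)) / 2) ltac:(lra)) ltac:(lra)).
    apply in_arc_proj in H2; lra. }
  subst s. split; [reflexivity|]. f_equal. apply Rle_antisym.
  - apply (in_arc_proj u v t Huv Hst). apply HK; lra.
  - apply HK; [lra|]. apply in_arc_proj; lra.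
Qed.

Lemma proj_iter F f k x : (forall y, proj (F y) = f (proj y)) ->
  Nat.iter k f (proj x) = proj (iter F k x).
Proof.
  intros H; induction k as [|k IH]; [reflexivity|].
  simpl Nat.iter. rewrite IH, <- H. reflexivity.
Qed.

Lemma image_arc F f rho i u v K : irrational_lift F rho ->
  (forall y, proj (F y) = f (proj y)) -> u <= v < u + 1 ->
  is_image (Nat.iter i f) (Arc (proj u) (proj v)) K ->
  src K = proj (iter F i u) /\ tgt K = proj (iter F i v).
Proof.
  intros HF Hf Huv HK. assert (HD := proj1 HF).
  assert (HU : iter F i u <= iter F i v < iter F i u + 1).
  { split; [apply iter_le; [exact HD|lra]|].
    destruct (iter_degree_one F i HD) as [A B]. rewrite <- B. apply A; lra. }
  apply arc_ext; [exact HU|].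
  intros y. rewrite (HK y). split.
  - intros (x & Hx & <-). destruct (proj_rep x u) as (w & Hw & <-).
    apply in_arc_proj in Hx; [|exact Huv|exact Hw].
    rewrite (proj_iter F f i w Hf).
    assert (A1 := iter_le F i u w HD ltac:(lra)). assert (A2 := iter_le F i w v HD Hx).
    apply in_arc_proj; lra.
  - intros Hy. destruct (proj_rep y (iter F i u)) as (z & Hz & <-).
    apply in_arc_proj in Hy; [|exact HU|exact Hz].
    destruct (iter_surjective F rho i HF z) as [w Hw].
    assert (Hw1 : u <= w).
    { apply Rnot_lt_le; intros L. apply (iter_lt F i _ _ HD) in L. lra. }
    assert (Hw2 : w <= v).
    { apply Rnot_lt_le; intros L. apply (iter_lt F i _ _ HD) in L. lra. }
    exists (proj w); split; [apply in_arc_proj; lra|].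
    rewrite (proj_iter F f i w Hf), Hw. reflexivity.
Qed.

(** * Lifts of multicritical maps *)

Lemma C3_lift_degree_one F f : C3_lift F f -> degree_one F.
Proof. intros (_ & H1 & H2 & _); split; assumption. Qed.

Lemma C3_lift_unique F F1 f : C3_lift F f -> C3_lift F1 f ->
  exists m : Z, forall x, F1 x = F x + IZR m.
Proof.
  intros HF HF1.
  assert (HI : forall x, exists m : Z, F1 x - F x = IZR m).
  { intros x. destruct (proj_eq (F1 x) (F x)) as [m Hm].
    - rewrite (proj1 HF x), (proj1 HF1 x); reflexivity.
    - exists m; lra. }
  destruct (HI 0) as [m Hm]. exists m.
  assert (HC : continuity (fun x => F1 x - F x)).
  { intros x; apply continuity_pt_minus;
      [apply (continuous_of_C3 F1), HF1|apply (continuous_of_C3 F), HF]. }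
  intros x. destruct (HI x) as [k Hk].
  destruct (Z.eq_dec k m) as [->|Hne]; [lra|exfalso].
  (* an integer-valued continuous function misses half-integers *)
  assert (Hhalf : exists h : Z, Rmin (IZR m) (IZR k) <= IZR h + 1 / 2 <= Rmax (IZR m) (IZR k)).
  { destruct (Z_lt_le_dec m k) as [L|L].
    - exists m. assert (IZR (m + 1) <= IZR k) by (apply IZR_le; lia).
      rewrite plus_IZR in H. rewrite Rmin_left, Rmax_right; lra.
    - exists k. assert (IZR (k + 1) <= IZR m) by (apply IZR_le; lia).
      rewrite plus_IZR in H. rewrite Rmin_right, Rmax_left; lra. }
  destruct Hhalf as [h Hh]. rewrite <- Hm, <- Hk in Hh.
  destruct (IVT_gen (fun x => F1 x - F x) 0 x (IZR h + 1 / 2) HC Hh) as [z [_ Hz]].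
  destruct (HI z) as [j Hj]. cbv beta in Hz. rewrite Hj in Hz.
  assert (A : IZR h < IZR j) by lra. assert (B : IZR j < IZR (h + 1)) by (rewrite plus_IZR; lra).
  apply lt_IZR in A. apply lt_IZR in B. lia.
Qed.

Lemma critical_point_lift F f c : C3_lift F f ->
  critical_point f c <-> exists x, proj x = c /\ Derive F x = 0.
Proof.
  intros HF; split.
  - intros (F1 & x & HF1 & Hx & HD). exists x; split; [exact Hx|].
    destruct (C3_lift_unique F F1 f HF HF1) as [m Hm].
    apply is_derive_unique. apply is_derive_ext with (fun y => F1 y - IZR m).
    + intros y; rewrite Hm; simpl; lra.
    + replace 0 with (0 - 0) by ring.
      apply (is_derive_minus F1 (fun _ => IZR m)); [exact HD|apply (is_derive_const (IZR m) x)].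
  - intros (x & Hx & HD). exists F, x; split; [exact HF|split; [exact Hx|]].
    rewrite <- HD. apply C3_at_Derive, HF.
Qed.

Lemma decreasing_near g t e : 0 < e -> (forall y, Rabs (y - t) < e -> C3_at g y) ->
  Derive g t < 0 -> exists h, 0 < h < e /\ g (t + h) < g t.
Proof.
  intros He HC HD.
  assert (Ht : C3_at g t) by (apply HC; rewrite Rminus_diag, Rabs_R0; exact He).
  destruct (continuous_near (Derive g) t (- Derive g t)) as (e1 & He1 & B1); [|lra|].
  { apply (ex_derive_continuous (Derive g)), (proj1 Ht 2%nat); lia. }
  set (h := Rmin e e1 / 2).
  assert (P : 0 < Rmin e e1) by (apply Rmin_glb_lt; assumption).
  assert (A1 := Rmin_l e e1). assert (A2 := Rmin_r e e1).
  exists h; split; [unfold h; lra|].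
  destruct (mean_value g t (t + h)) as (z & Hz & E); [unfold h; lra| |].
  { intros z Hz. eexists; apply C3_at_Derive, HC, Rabs_def1; unfold h in Hz; lra. }
  specialize (B1 z ltac:(apply Rabs_def1; unfold h in Hz; lra)).
  apply Rabs_def2 in B1. assert (0 < h) by (unfold h; lra). nra.
Qed.

Lemma C3_at_translate g b x : C3_at g (x + b) -> C3_at (fun y => g (y + b)) x.
Proof.
  intros [H1 H2]; split.
  - intros k Hk. apply ex_derive_n_comp_trans, H1, Hk.
  - apply continuous_ext with (fun y => Derive_n g 3 (y + b)).
    + intros y. symmetry; apply Derive_n_comp_trans.
    + apply (continuous_comp (fun y => y + b) (Derive_n g 3)); [|exact H2].
      apply (continuous_plus (fun y : R => y) (fun _ => b));
        [apply continuous_id|apply continuous_const].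
Qed.

(** The normal form at a critical point, transported to a given lift; the inverse function
    shows that the coordinate has nonzero derivative, and monotonicity of the
    lift that it preserves orientation. *)
Lemma non_flat_normal_form F f t delta : C3_lift F f -> non_flat f (proj t) delta ->
  exists phi e0, 0 < e0 /\
    (forall y, Rabs (y - t) < e0 -> C3_at phi y) /\
    (forall y, Rabs (y - t) < e0 -> F y = F t + odd_power delta (phi y)) /\
    phi t = 0 /\ 0 < Derive phi t.
Proof.
  intros HF [Hd (F1 & x & W & phi & HF1 & Hx & HW & HWx & [HphiC [psi Hpsi]] & Hphi0 & Hform)].
  destruct (C3_lift_unique F F1 f HF HF1) as [k Hk].
  destruct (proj_eq x t Hx) as [m Hm].
  destruct (HW x HWx) as [e0 He0].
  assert (He0' : forall y, Rabs (y - t) < e0 -> W (y + IZR m)).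
  { intros y Hy. apply He0. change (Rabs (y + IZR m - x) < e0).
    replace (y + IZR m - x) with (y - t) by (rewrite Hm; ring). exact Hy. }
  assert (HFm : forall y, F (y + IZR m) = F y + IZR m)
    by (intros y; apply (iter_shift F 1 m y (C3_lift_degree_one F f HF))).
  assert (Hcoord : forall y, Rabs (y - t) < e0 -> F y = F t + odd_power delta (phi (y + IZR m))).
  { intros y Hy. assert (E := Hform _ (He0' y Hy)).
    rewrite !Hk, Hm, !HFm in E. unfold odd_power. lra. }
  set (phi' := fun y => phi (y + IZR m)).
  assert (HC : forall y, Rabs (y - t) < e0 -> C3_at phi' y)
    by (intros y Hy; apply C3_at_translate, HphiC, He0', Hy).
  assert (Hphit : phi' t = 0) by (unfold phi'; rewrite <- Hm; exact Hphi0).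
  exists phi', e0; split; [apply cond_pos|split; [exact HC|split; [exact Hcoord|]]].
  split; [exact Hphit|].
  assert (Ht0 : Rabs (t - t) < e0) by (rewrite Rminus_diag, Rabs_R0; apply cond_pos).
  assert (Hne : Derive phi' t <> 0).
  { intros E0. destruct (Hpsi (t + IZR m) (He0' t Ht0)) as [_ HpsiC].
    assert (D : is_derive (fun y => psi (phi' y)) t (Derive phi' t * Derive psi (phi' t))).
    { apply (is_derive_comp psi phi').
      - apply C3_at_Derive, HpsiC.
      - apply C3_at_Derive, HC, Ht0. }
    assert (D1 : is_derive (fun y => psi (phi' y)) t 1).
    { apply is_derive_ext_loc with (fun y => y + IZR m).
      - exists e0; intros y Hy. symmetry; apply (proj1 (Hpsi _ (He0' y Hy))).
      - auto_derive; [exact I|ring]. }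
    apply is_derive_unique in D. apply is_derive_unique in D1.
    rewrite D, E0 in D1. lra. }
  destruct (Rlt_le_dec 0 (Derive phi' t)) as [|Hle]; [assumption|exfalso].
  destruct (decreasing_near phi' t e0 (cond_pos e0) HC ltac:(lra)) as (h & Hh & Hlt).
  assert (E := Hcoord (t + h) ltac:(apply Rabs_def1; lra)).
  assert (L := odd_power_le delta _ _ (Rlt_le _ _ Hd) (Rlt_le _ _ Hlt)).
  rewrite Hphit, odd_power_0 in L. fold (phi' (t + h)) in E.
  assert (I := proj1 (proj2 (proj2 HF)) t (t + h) ltac:(lra)). lra.
Qed.

Lemma multicritical_tame F f d t : C3_lift F f -> 1 < d ->
  multicritical_circle_map f -> criticalities_bounded f d ->
  exists e, 0 < e /\ forall x y, t - e < x -> x < y -> y < t + e -> tame F d (/ e) x y.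
Proof.
  intros HF Hd Hmc Hcb.
  assert (HC := proj2 (proj2 (proj2 HF))).
  destruct (Req_dec (Derive F t) 0) as [H0|Hreg].
  - assert (Hcrit : critical_point f (proj t))
      by (apply (critical_point_lift F f _ HF); exists t; split; [reflexivity|exact H0]).
    destruct (proj2 (proj2 (proj2 Hmc)) _ Hcrit) as [delta Hnf].
    assert (Hle := Hcb _ _ Hcrit Hnf).
    destruct (non_flat_normal_form F f t delta HF Hnf) as (phi & e0 & He0 & H1 & H2 & H3 & H4).
    destruct Hnf as [Hdel _].
    apply (power_form_tame F d t phi delta e0); auto; lra.
  - set (phi := fun y => F y + - F t).
    assert (HCphi : forall y, C3_at phi y).
    { intros y. split.
      - intros k Hk. apply (ex_derive_n_plus F (fun _ => - F t)).
        + exists posreal_one. intros z _ j Hj. apply HC; lia.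
        + exists posreal_one. intros z _ j Hj. apply ex_derive_n_const.
      - apply continuous_ext with (Derive_n F 3); [|apply HC].
        intros z. symmetry. unfold phi. rewrite Derive_n_plus.
        + rewrite Derive_n_const. simpl; ring.
        + exists posreal_one. intros w _ j Hj. apply HC; lia.
        + exists posreal_one. intros w _ j Hj. apply ex_derive_n_const. }
    assert (HDphi : Derive phi t = Derive F t).
    { unfold phi. rewrite Derive_plus, Derive_const; [ring| |apply ex_derive_const].
      eexists; apply C3_at_Derive, HC. }
    apply (power_form_tame F d t phi 1 1); auto; try lra.
    + intros y _. rewrite odd_power_1. unfold phi; ring.
    + unfold phi; ring.
    + rewrite HDphi. destruct (Rlt_le_dec 0 (Derive F t)) as [|Hle]; [assumption|exfalso].
      destruct (decreasing_near F t 1 Rlt_0_1 (fun y _ => HC y) ltac:(lra)) as (h & Hh & Hlt).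
      assert (I := proj1 (proj2 (proj2 HF)) t (t + h) ltac:(lra)). lra.
Qed.

Lemma critical_point_quadratic F f x : C3_lift F f ->
  multicritical_circle_map f -> Derive F x = 0 ->
  exists e, 0 < e /\ quadratic_at F x e.
Proof.
  intros HF Hmc H0.
  assert (HC := proj2 (proj2 (proj2 HF))).
  assert (Hcrit : critical_point f (proj x))
    by (apply (critical_point_lift F f _ HF); exists x; split; [reflexivity|exact H0]).
  destruct (proj2 (proj2 (proj2 Hmc)) _ Hcrit) as [delta Hnf].
  destruct (non_flat_normal_form F f x delta HF Hnf) as (phi & e0 & He0 & H1 & H2 & H3 & H4).
  destruct Hnf as [Hdel _].
  assert (Hd2 : 2 <= delta) by (apply (criticality_ge_2 F x phi delta e0); auto; lra).
  apply (power_form_quadratic F x phi delta e0); auto.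
Qed.

Lemma quadratic_at_smaller F x e e' : e' <= e -> quadratic_at F x e -> quadratic_at F x e'.
Proof. intros He H s t H1 H2 H3; apply H; lra. Qed.

Lemma uniformly_quadratic F f (l : list S1) : C3_lift F f -> multicritical_circle_map f ->
  exists e, 0 < e /\ forall c, In c l -> Derive F (coord c) = 0 ->
    quadratic_at F (coord c) e.
Proof.
  intros HF Hmc; induction l as [|c l (e & He & IH)].
  - exists 1; split; [lra|intros c []].
  - destruct (Req_dec (Derive F (coord c)) 0) as [H0|H0].
    + destruct (critical_point_quadratic F f _ HF Hmc H0) as (e' & He' & Hq).
      exists (Rmin e e'); split; [apply Rmin_glb_lt; assumption|].
      intros c' [<-|Hin] Hc'.
      * apply quadratic_at_smaller with (2 := Hq), Rmin_r.
      * apply quadratic_at_smaller with (2 := IH c' Hin Hc'), Rmin_l.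
    + exists e; split; [exact He|]. intros c' [<-|Hin] Hc'; [contradiction|].
      apply IH; assumption.
Qed.

(** * The intervals of the dynamical partitions *)

Definition partition_piece (f : S1 -> S1) (q : nat -> nat) (n i : nat) (c : S1) (K : arc) : Prop :=
  exists I, is_base_arc f q n c I /\ is_image (Nat.iter i f) I K.

(** Of the two arcs with endpoints [c] and [f^(q_n) c], only the short one contains
    [f^(q_(n+2)) c], which is a closer return on the same side. *)
Lemma base_arc_endpoints F f rho a n c I :
  irrational_lift F rho -> cf_expansion rho a -> (forall y, proj (F y) = f (proj y)) ->
  is_base_arc f (return_time a) n (proj c) I ->
  exists u v, I = Arc (proj u) (proj v) /\ u <= v < u + 1 /\
    let g := step F (return_time a n) (numer a n) c in
    (u = c /\ v = g \/ u = g /\ v = c).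
Proof.
  intros HF Ha Hf [HI Hin].
  replace (n + 2)%nat with (S (S n)) in Hin by lia.
  rewrite !(proj_iter F f _ _ Hf) in HI.
  set (g := step F (return_time a n) (numer a n) c).
  set (y := step F (return_time a (S (S n))) (numer a (S (S n))) c).
  assert (Eg : proj (iter F (return_time a n) c) = proj g).
  { unfold g, step, Rminus; rewrite <- opp_IZR, proj_shift; reflexivity. }
  assert (Ey : proj (iter F (return_time a (S (S n))) c) = proj y).
  { unfold y, step, Rminus; rewrite <- opp_IZR, proj_shift; reflexivity. }
  rewrite Eg in HI. rewrite (proj_iter F f _ _ Hf), Ey in Hin.
  assert (S0 := closeness_sign rho a n Ha). assert (S2 := closeness_sign rho a (S (S n)) Ha).
  replace ((-1) ^ S (S n)) with ((-1) ^ n) in S2 by (simpl; ring).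
  assert (D : Rabs (closeness rho a (S (S n))) < Rabs (closeness rho a n)).
  { apply Rlt_trans with (Rabs (closeness rho a (S n))); apply closeness_decr, Ha. }
  assert (Bg : c - 1 < g < c + 1).
  { assert (A := orbit_above F rho (return_time a n) (1 - numer a n) c HF).
    assert (B := orbit_below F rho (return_time a n) (- 1 - numer a n) c HF).
    rewrite minus_IZR in A, B. unfold g, step.
    assert (HB := closeness_lt_1 rho a n Ha).
    apply Rabs_def2 in HB. unfold closeness in HB. lra. }
  assert (Hcmp : c < y < g \/ g < y < c).
  { unfold y, g, step, Rminus. rewrite <- !opp_IZR.
    destruct (Nat.Even_or_Odd n) as [Hn|Hn].
    - left. assert (P : (-1) ^ n = 1) by (destruct Hn as [k ->]; apply pow_1_even).
      rewrite P in S0, S2.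
      rewrite !Rabs_pos_eq in D by lra. unfold closeness in *. split.
      + apply (orbit_above F rho); [exact HF|rewrite opp_IZR; lra].
      + apply (orbit_lt F rho); [exact HF|rewrite !opp_IZR; lra].
    - right. assert (P : (-1) ^ n = -1)
        by (destruct Hn as [k ->]; rewrite Nat.add_1_r; apply pow_1_odd).
      rewrite P in S0, S2.
      rewrite !Rabs_left in D by lra. unfold closeness in *. split.
      + apply (orbit_lt F rho); [exact HF|rewrite !opp_IZR; lra].
      + apply (orbit_below F rho); [exact HF|rewrite opp_IZR; lra]. }
  assert (Esh : forall z, proj (z + 1) = proj z)
    by (intros z; change 1 with (IZR 1); apply proj_shift).
  destruct Hcmp as [Hcy|Hcy]; destruct HI as [-> | ->].
  - exists c, g; split; [reflexivity|split; [lra|left; auto]].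
  - exfalso. rewrite <- (Esh c), <- (Esh y) in Hin. apply in_arc_proj in Hin; lra.
  - exfalso. rewrite <- (Esh g), <- (Esh y) in Hin. apply in_arc_proj in Hin; lra.
  - exists g, c; split; [reflexivity|split; [lra|right; auto]].
Qed.

Lemma partition_piece_spec F f rho a n i c K :
  irrational_lift F rho -> cf_expansion rho a -> (forall y, proj (F y) = f (proj y)) ->
  partition_piece f (return_time a) n i (proj c) K ->
  arc_length K = return_length F a n (iter F i c) /\
  (src K = proj (iter F i c) /\ tgt K = proj (iter F (i + return_time a n) c) \/
   src K = proj (iter F (i + return_time a n) c) /\ tgt K = proj (iter F i c)).
Proof.
  intros HF Ha Hf (I & HI & HK). assert (HD := proj1 HF).
  destruct (base_arc_endpoints F f rho a n c I HF Ha Hf HI) as (u & v & -> & Huv & Hg).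
  destruct (image_arc F f rho i u v K HF Hf Huv HK) as [Es Et].
  assert (Hi : iter F i u <= iter F i v < iter F i u + 1).
  { split; [apply iter_le; [exact HD|lra]|].
    destruct (iter_degree_one F i HD) as [A B]. rewrite <- B. apply A; lra. }
  set (g := step F (return_time a n) (numer a n) c) in *.
  assert (Eg : proj (iter F i g) = proj (iter F (i + return_time a n) c)).
  { unfold g, step, Rminus; rewrite <- opp_IZR, iter_shift, <- iter_plus by exact HD.
    apply proj_shift. }
  assert (Eg' : step F (return_time a n) (numer a n) (iter F i c) = iter F i g)
    by (apply step_iter, HD).
  split.
  - unfold arc_length, return_length. rewrite Es, Et, Eg', ccw_dist_proj by exact Hi.
    destruct Hg as [[-> ->]|[-> ->]].
    + rewrite Rabs_pos_eq; lra.
    + rewrite Rabs_left1; lra.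
  - rewrite Es, Et. destruct Hg as [[-> ->]|[-> ->]]; rewrite Eg; auto.
Qed.

Lemma orbit_injective F rho i j c : irrational_lift F rho ->
  proj (iter F i c) = proj (iter F j c) -> i = j.
Proof.
  intros HF H. destruct (proj_eq _ _ H) as [m Hm].
  destruct (Rtotal_order (INR i * rho + IZR 0) (INR j * rho + IZR m)) as [L|[E|L]].
  - apply (orbit_lt F rho _ _ _ _ c HF) in L. lra.
  - apply (rotation_injective F rho _ _ _ _ HF E).
  - apply (orbit_lt F rho _ _ _ _ c HF) in L. lra.
Qed.

(** * Adjacent intervals *)

Lemma return_length_next F a n i c C : degree_one F ->
  comparable_steps F (return_time a n) (numer a n) C ->
  return_length F a n (iter F i c) <= C * return_length F a n (iter F (i + return_time a n) c) /\
  return_length F a n (iter F (i + return_time a n) c) <= C * return_length F a n (iter F i c).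
Proof.
  intros HD H. destruct (H (iter F i c)) as [A B]; cbv zeta in A, B.
  assert (E : return_length F a n (iter F (i + return_time a n) c) =
    Rabs (step F (return_time a n) (numer a n)
            (step F (return_time a n) (numer a n) (iter F i c))
          - step F (return_time a n) (numer a n) (iter F i c))).
  { unfold return_length. f_equal.
    replace (step F (return_time a n) (numer a n) (iter F i c))
      with (iter F (i + return_time a n) c + IZR (- numer a n)).
    - rewrite step_shift by exact HD. ring.
    - rewrite Nat.add_comm, iter_plus, opp_IZR. unfold step at 1. ring. }
  rewrite E. split; assumption.
Qed.

Lemma step_bound_pos v : 0 < step_bound v.
Proof.
  unfold step_bound. assert (P := exp_pos (3 * v)).
  assert (0 < exp (3 * v) ^ 3) by (apply pow_lt, P).
  apply Rmult_lt_0_compat; apply pow_lt; lra.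
Qed.

Lemma ratio_bound_pos v : 0 < ratio_bound v.
Proof.
  unfold ratio_bound, transport_bound, critical_bound, critical_factor.
  assert (P := exp_pos (3 * v)). assert (Q := step_bound_pos v).
  set (E := exp (3 * v)) in *. set (C := step_bound v) in *.
  assert (0 < 2 * (1 + C) * (8 * E * (1 + 2 * C) + 2 + 1)).
  { apply Rmult_lt_0_compat; [lra|].
    assert (0 < 8 * E * (1 + 2 * C)) by (apply Rmult_lt_0_compat; lra). lra. }
  set (C2 := 2 * (1 + C) * (8 * E * (1 + 2 * C) + 2 + 1)) in *.
  assert (0 < (C2 + 1) * C) by (apply Rmult_lt_0_compat; lra).
  assert (0 < ((C2 + 1) * C + 1) * C) by (apply Rmult_lt_0_compat; lra).
  apply Rmult_lt_0_compat; [apply Rmult_lt_0_compat|]; try lra.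
  apply pow_lt, P.
Qed.

Definition adjacency_bound (v : R) : R := step_bound v ^ 3 * (1 + ratio_bound v) + 1.

(** Adjacent intervals of the same level are equal, or one is the image of the other under
    the return of that level. Adjacent intervals of different levels share
    their first or their last time in the orbit of [c]; the first case is the
    comparison along the critical orbit, and one return leads from the second case to it. *)
Lemma adjacent_pieces_comparable F f rho a n c v :
  irrational_lift F rho -> cf_expansion rho a -> (forall y, proj (F y) = f (proj y)) ->
  1 <= step_bound v ->
  comparable_steps F (return_time a n) (numer a n) (step_bound v) ->
  comparable_steps F (return_time a (S n)) (numer a (S n)) (step_bound v) ->
  (forall i, (i <= return_time a (S n) + return_time a (S n))%nat ->
    return_length F a n (iter F i c) <= ratio_bound v * return_length F a (S n) (iter F i c)
    /\ return_length F a (S n) (iter F i c)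
         <= step_bound v * return_length F a n (iter F i c)) ->
  forall I J,
    dyn_partition f (return_time a) n (proj c) I ->
    dyn_partition f (return_time a) n (proj c) J ->
    adjacent I J ->
    arc_length I <= adjacency_bound v * arc_length J /\
    arc_length J <= adjacency_bound v * arc_length I.
Proof.
  intros HF Ha Hf HC C1 C2 HR. assert (HD := proj1 HF).
  set (C := step_bound v) in *. set (R := ratio_bound v) in *.
  assert (HRpos : 0 < R) by apply ratio_bound_pos.
  set (B := adjacency_bound v).
  assert (HB : forall k X Y, 0 <= Y -> k <= C ^ 3 * (1 + R) -> X <= k * Y -> X <= B * Y).
  { intros k X Y HY Hk HX. apply Rle_trans with (1 := HX).
    apply Rmult_le_compat_r; [exact HY|]. unfold B, adjacency_bound. fold C R. lra. }
  assert (HC2 : C <= C ^ 2) by nra. assert (HC3 : C ^ 2 <= C ^ 3) by nra.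
  assert (HkC : C <= C ^ 3 * (1 + R)) by nra.
  assert (HkC3 : C ^ 3 <= C ^ 3 * (1 + R)) by nra.
  assert (HkR : R <= C ^ 3 * (1 + R)) by nra.
  assert (HkC2R : C ^ 2 * R <= C ^ 3 * (1 + R)) by nra.
  assert (Hk1 : 1 <= C ^ 3 * (1 + R)) by nra.
  destruct (return_time_mono a n (proj1 Ha)) as [Hq1 Hq2].
  assert (Lpos : forall m x, 0 <= return_length F a m x) by (intros; apply Rabs_pos).
  set (q := return_time a n) in *. set (q' := return_time a (S n)) in *.
  assert (Same : forall m i j,
    comparable_steps F (return_time a m) (numer a m) C ->
    (i = j \/ j = i + return_time a m \/ i = j + return_time a m)%nat ->
    return_length F a m (iter F i c) <= B * return_length F a m (iter F j c)).
  { intros m i j Hm [->|[->| ->]].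
    - apply (HB 1); auto; lra.
    - apply (HB C); auto. apply return_length_next; assumption.
    - apply (HB C); auto. apply return_length_next; assumption. }
  assert (Mixed : forall i j, (i < q')%nat -> (j < q)%nat ->
    (i = j \/ i + q = j \/ i = j + q' \/ i + q = j + q')%nat ->
    return_length F a n (iter F i c) <= B * return_length F a (S n) (iter F j c) /\
    return_length F a (S n) (iter F j c) <= B * return_length F a n (iter F i c)).
  { intros i j Hi Hj [->|[E|[E|E]]]; try lia.
    - destruct (HR j ltac:(lia)) as [A1 A2].
      split; [apply (HB R)|apply (HB C)]; auto.
    - destruct (HR (i + q)%nat ltac:(lia)) as [A1 A2].
      destruct (return_length_next F a n i c C HD C1) as [N1 N2]. fold q in N1, N2.
      destruct (return_length_next F a (S n) j c C HD C2) as [M1 M2]. fold q' in M1, M2.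
      rewrite <- E in M1, M2.
      assert (P1 := Lpos n (iter F i c)). assert (P2 := Lpos (S n) (iter F j c)).
      set (X := return_length F a n (iter F i c)) in *.
      set (Y := return_length F a (S n) (iter F j c)) in *.
      set (X' := return_length F a n (iter F (i + q) c)) in *.
      set (Y' := return_length F a (S n) (iter F (i + q) c)) in *.
      split.
      + apply (HB (C ^ 2 * R)); auto.
        apply Rle_trans with (1 := N1).
        apply Rle_trans with (C * (R * (C * Y))); [|right; ring].
        apply Rmult_le_compat_l; [lra|]. apply Rle_trans with (1 := A1).
        apply Rmult_le_compat_l; lra.
      + apply (HB (C ^ 3)); auto.
        apply Rle_trans with (1 := M1).
        apply Rle_trans with (C * (C * (C * X))); [|right; ring].
        apply Rmult_le_compat_l; [lra|]. apply Rle_trans with (1 := A2).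
        apply Rmult_le_compat_l; lra. }
  assert (Hpiece : forall K, dyn_partition f (return_time a) n (proj c) K ->
    (exists i, (i < q')%nat /\ partition_piece f (return_time a) n i (proj c) K) \/
    (exists j, (j < q)%nat /\ partition_piece f (return_time a) (S n) j (proj c) K)).
  { intros K HK. unfold dyn_partition in HK. replace (n + 1)%nat with (S n) in HK by lia.
    destruct HK as [(I & i & H1 & H2 & H3)|(I & j & H1 & H2 & H3)].
    - left; exists i; split; [exact H2|exists I; split; assumption].
    - right; exists j; split; [exact H2|exists I; split; assumption]. }
  (* the orbit is infinite, so a common endpoint is a common time *)
  assert (Times : forall I J m i k j,
    partition_piece f (return_time a) m i (proj c) I ->
    partition_piece f (return_time a) k j (proj c) J -> adjacent I J ->
    (i = j \/ i + return_time a m = j \/ i = j + return_time a k \/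
      i + return_time a m = j + return_time a k)%nat).
  { intros I J m i k j HI HJ Hadj.
    destruct (partition_piece_spec F f rho a m i c I HF Ha Hf HI) as [_ EI].
    destruct (partition_piece_spec F f rho a k j c J HF Ha Hf HJ) as [_ EJ].
    unfold adjacent in Hadj; revert Hadj.
    destruct EI as [[-> ->]|[-> ->]]; destruct EJ as [[-> ->]|[-> ->]];
      intros [E|[E|[E|E]]];
      apply (orbit_injective F rho _ _ c HF) in E; auto. }
  assert (Len : forall I m i, partition_piece f (return_time a) m i (proj c) I ->
    arc_length I = return_length F a m (iter F i c)).
  { intros I m i HI. apply (partition_piece_spec F f rho a m i c I HF Ha Hf HI). }
  intros I J HI HJ Hadj.
  destruct (Hpiece I HI) as [(i & Hi & PI)|(i & Hi & PI)];
    destruct (Hpiece J HJ) as [(j & Hj & PJ)|(j & Hj & PJ)];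
    assert (T := Times I J _ _ _ _ PI PJ Hadj);
    rewrite (Len _ _ _ PI), (Len _ _ _ PJ).
  - split; apply Same; auto; lia.
  - destruct (Mixed i j Hi Hj T); split; assumption.
  - fold q q' in T. destruct (Mixed j i Hj Hi ltac:(lia)); split; assumption.
  - split; apply Same; auto; lia.
Qed.

Theorem theorem1 :
  forall (N : nat) (d : R), (1 <= N)%nat -> 1 < d ->
  exists B : R, 1 < B /\
    forall (f : S1 -> S1) (rho : R) (a : nat -> nat),
      multicritical_circle_map f ->
      no_periodic_points f ->
      at_most_critical_points f N ->
      criticalities_bounded f d ->
      is_rotation_number f rho ->
      cf_expansion rho a ->
      exists n0 : nat,
        forall c0 : S1, critical_point f c0 ->
        forall n : nat, (n0 <= n)%nat ->
        forall I J : arc,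
          dyn_partition f (return_time a) n c0 I ->
          dyn_partition f (return_time a) n c0 J ->
          adjacent I J ->
          arc_length J / B <= arc_length I <= B * arc_length J.
Proof.
  intros N d _ Hd.
  set (v := universal_weight N d). set (B := adjacency_bound v).
  assert (HB : 1 < B).
  { unfold B, adjacency_bound. assert (P := step_bound_pos v). assert (Q := ratio_bound_pos v).
    assert (0 < step_bound v ^ 3 * (1 + ratio_bound v)); [|lra].
    apply Rmult_lt_0_compat; [apply pow_lt, P|lra]. }
  exists B; split; [exact HB|].
  intros f rho a Hmc _ [l [HlN Hl]] Hcb [_ (F & HF & Hrot)] Ha.
  assert (HD := C3_lift_degree_one F f HF).
  assert (HC := proj2 (proj2 (proj2 HF))).
  assert (Hder : forall x, ex_derive F x) by (intros x; eexists; apply C3_at_Derive, HC).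
  assert (HI : irrational_lift F rho).
  { apply irrational_lift_intro; [exact HD|apply continuous_of_C3, HC|exact Hrot|].
    intros k m; apply (cf_irrational rho a k m Ha). }
  assert (Hzeros : forall z, Derive F z = 0 ->
    exists c (m : Z), In c (map coord l) /\ z = c + IZR m).
  { intros z Hz. exists (coord (proj z)), (Int_part z). split.
    - apply in_map, Hl, (critical_point_lift F f _ HF). exists z; split; [reflexivity|exact Hz].
    - simpl. assert (E := Rplus_Int_part_frac_part z). lra. }
  destruct (uniformly_tame F d HD Hder (fun t => multicritical_tame F f d t HF Hd Hmc Hcb))
    as (e & He & Htame).
  (* the constants of the first inequality depend on [f]; it only serves to reach the
     scale [e / 2] below which the second one, with universal constants, applies *)
  destruct (controlled_large F d e (map coord l) HD HC ltac:(lra) He Htame Hzeros)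
    as (V1 & v1 & HV1).
  destruct (controlled_small F d e (map coord l) N HD Hder ltac:(lra) He Htame Hzeros)
    as (V & HV); [rewrite length_map; exact HlN|].
  fold v in HV.
  destruct (uniformly_quadratic F f l HF Hmc) as (e1 & He1 & Hquad).
  destruct (return_length_vanishes F rho a V1 v1 HI Ha HV1 (Rmin (e / 2 / 3) (e1 / 2)))
    as [n0 Hn0]; [apply Rmin_glb_lt; lra|].
  assert (M1 := Rmin_l (e / 2 / 3) (e1 / 2)). assert (M2 := Rmin_r (e / 2 / 3) (e1 / 2)).
  exists n0. intros c0 Hc0 n Hn I J HIn HJn Hadj.
  assert (Hcrit : Derive F (coord c0) = 0).
  { destruct (proj1 (critical_point_lift F f c0 HF) Hc0) as (x & Hx & Hx0).
    rewrite <- (proj_coord c0) in Hx. destruct (proj_eq x (coord c0) Hx) as [m ->].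
    rewrite Derive_shift in Hx0 by assumption. exact Hx0. }
  assert (L0 : forall x, return_length F a n x <= e / 2 / 3 /\ return_length F a n x < e1).
  { intros x; specialize (Hn0 n Hn x); lra. }
  assert (L1 : forall x, return_length F a (S n) x <= e / 2 / 3).
  { intros x; specialize (Hn0 (S n) ltac:(lia) x); lra. }
  rewrite <- (proj_coord c0) in HIn, HJn.
  destruct (adjacent_pieces_comparable F f rho a n (coord c0) v HI Ha (proj1 HF)
    (step_bound_ge_1 F V v _ HV)
    (return_lengths_comparable F rho a V v _ n HI Ha HV (fun x => proj1 (L0 x)))
    (return_lengths_comparable F rho a V v _ (S n) HI Ha HV L1)
    (consecutive_levels F rho a V v _ (coord c0) e1 n HI Ha HV
      (Hquad c0 (Hl c0 Hc0) Hcrit) L0 L1)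
    I J HIn HJn Hadj) as [A1 A2].
  fold B in A1, A2. split; [|exact A1].
  apply Rle_div_l; lra.
Qed.
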